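(* Consider the singularly perturbed stochastic hybrid system $\mathcal H_\varepsilon$ (with slow state $x\in\mathbb R^{n_1}$, fast state $z\in\mathbb R^{n_2}$, $y=(x,z)$) and its reduced system, as described in the context. Let $\mathcal A\subset\mathbb R^{n_1}$ be compact. Suppose there is a set-valued map $\mathcal M:\mathbb R^{n_1}\rightrightarrows\mathbb R^{n_2}$ that is outer semicontinuous and locally bounded, with $\mathcal M(x)\neq\emptyset$ and $\mathcal M(x)\subset C_z$ for all $x\in C_x$, and a function $\alpha\in\mathcal K_\infty$ such that $$\min_{r_2\in\mathcal M(x)}\|r_2^*-r_2\|\le\alpha(\|x-r_1^*\|)\quad\text{for all }x\in\mathbb R^{n_1},\ r_1^*\in\mathcal A,\ r_2^*\in\mathcal M(r_1^* ).$$ Let $\tilde{\mathcal A}:=\{(x,z)\in\mathbb R^{n_1+n_2}:x\in\mathcal A,\ z\in\mathcal M(x)\}$. (a) Suppose there exist locally Lipschitz regular functions $W:\mathbb R^{n_1}\times\mathbb R^{n_2}\to\mathbb R_{\ge0}$ and $V:\mathbb R^{n_1}\to\mathbb R_{\ge0}$, functions $\alpha_1,\alpha_2,\alpha_3,\alpha_4\in\mathcal K_\infty$, a continuous function $\varphi_z:\mathbb R_{\ge0}\to\mathbb R_{\ge0}$ of class $\mathcal{PD}$, a continuous function $\varphi_x:\mathbb R^{n_1}\to\mathbb R_{\ge0}$ of class $\mathcal{PD}(\mathcal A)$, and constants $k_z,k_x,k_1,k_2,k_3>0$ such that: (i) $\alpha_1(|z|_{\mathcal M(x)})\le W(x,z)\le\alpha_2(|z|_{\mathcal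 M(x)})$ for all $(x,z)\in C\cup D\cup G(D\times\mathcal V)$; (ii) $\max_{v\in\partial_zW(x,z)}\langle v,f_z\rangle\le-k_z\varphi_z^2(|z|_{\mathcal M(x)})$ for all $(x,z)\in C$ and $f_z\in F_z(x,z)$; (iii) $\alpha_3(|x|_{\mathcal A})\le V(x)\le\alpha_4(|x|_{\mathcal A})$ for all $x\in C_x\cup D_x\cup\tilde G(D_x\times\mathcal V)$; (iv) $\max_{v\in\partial V(x)}\langle v,\tilde f_x\rangle\le-k_x\varphi_x^2(x)$ for all $x\in C_x$ and $\tilde f_x\in\tilde F(x)$; (v) for all $(x,z)\in C$ and all $f_x\in F_x(x,z)$: $\max_{v\in\partial_xW(x,z)}\langle v,f_x\rangle\le k_1\varphi_z(|z|_{\mathcal M(x)})\varphi_x(x)+k_2\varphi_z^2(|z|_{\mathcal M(x)})$; (vi) for all $(x,z)\in C$ and all $f_x\in F_x(x,z)$ there exists $\tilde f_x\in\tilde F(x)$ such that $\max_{v\in\partial V(x)}\langle v,f_x-\tilde f_x\rangle\le k_3\varphi_z(|z|_{\mathcal M(x)})\varphi_x(x)$. (b) Suppose, with $\theta^*:=\frac{k_3}{k_1+k_3}$ and $E_{\theta^*}(y):=(1-\theta^* )V(x)+\theta^*W(x,z)$, that there exists a function $\hat\rho\in\mathcal{PD}(\tilde{\mathcal A})$ such that $$\int_{\mathbb R^m}\sup_{g\in G(x,z,v)}E_{\theta^*}(g)\,\mu(dv)\le E_{\theta^*}(y)-\hat\rho(y)\quad\text{for all }y=(x,z)\in D.$$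 Then there exists $\varepsilon^*>0$ such that for all $\varepsilon\in(0,\varepsilon^* )$ the set $\tilde{\mathcal A}$ is Uniformly Globally Asymptotically Stable in Probability (UGASp) for $\mathcal H_\varepsilon$.
   Context: Notation. $|z|_{S}:=\inf_{s\in S}\|z-s\|$. $\mathbb B^\circ$ is the open unit ball. A function $\alpha:\mathbb R_{\ge0}\to\mathbb R_{\ge0}$ is of class $\mathcal K_\infty$ if it is zero at zero, continuous, strictly increasing and unbounded. A nonnegative function is of class $\mathcal{PD}(S)$ if it is positive definite with respect to $S$ (zero on $S$, positive off $S$); $\mathcal{PD}=\mathcal{PD}(\{0\})$. For locally Lipschitz $f$, $\partial f$ is the Clarke generalized gradient, and $\partial_xf(x,z)$, $\partial_zf(x,z)$ are the partial Clarke gradients (Clarke gradients of $f(\cdot,z)$ at $x$ and of $f(x,\cdot)$ at $z$). $f$ is regular if at every point $y$ and for every direction $u$ the one-sided directional derivative $f'(y;u)$ exists and equals $\max\{v^\top u:v\in\partial f(y)\}$. A set-valued map $M$ is outer semicontinuous (OSC) if $(x_i,y_i)\to(x,y)$ with $y_i\in M(x_i)$ implies $y\in M(x)$; it is locally bounded (LB) if $M(K)=\bigcup_{x\in K}M(x)$ is bounded for each bounded $K$. System. $\mathcal H_\varepsilon$, with parameter $\varepsilon>0$, is $$(x,z)\in C:\ \dot x\in F_x(x,z),\ \varepsilon\dot z\in F_z(x,z);\qquad (x,z)\in D:\ (x^+,z^+)\in G(x,z,v),\ v\sim\mu,$$ where $x\in\mathbb R^{n_1}$, $z\in\mathbb R^{n_2}$,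 $C=C_x\times C_z$, $D=D_x\times D_z$ with $C_x,D_x\subset\mathbb R^{n_1}$, $C_z,D_z\subset\mathbb R^{n_2}$, and $F_x,F_z$, $G$ (with $G(x,z,v)\subset\mathbb R^{n_1+n_2}$, $v\in\mathbb R^m$) are set-valued. Write $F_\varepsilon(x,z)=F_x(x,z)\times\varepsilon^{-1}F_z(x,z)$. The random input is an i.i.d. sequence $\mathbf v_k:\Omega\to\mathbb R^m$, $k\ge1$, on a probability space $(\Omega,\mathcal F,\mathbb P)$ with distribution $\mu$, and $\mathcal V:=\bigcup_{\omega\in\Omega,k\ge1}\{\mathbf v_k(\omega)\}$. Standing assumption (Basic Conditions): $C,D$ are closed, $C\subset\mathrm{dom}(F_\varepsilon)$, $D\subset\mathrm{dom}(G)$ (the maps are nonempty-valued there); $F_\varepsilon$ is OSC, LB and convex-valued for every $\varepsilon>0$; $G$ is LB and $v\mapsto\mathrm{graph}(G(\cdot,\cdot,v))$ is measurable with closed values. The reduced system is also assumed to satisfy the analogous Basic Conditions. Reduced system: $x\in C_x:\ \dot x\in\tilde F(x)$; $x\in D_x:\ x^+\in\tilde G(x,v)$, $v\sim\mu$, where $\tilde F(x):=\overline{\mathrm{co}}\{\tilde f_x\in\mathbb R^{n_1}:\tilde f_x\in F_x(x,z),\ z\in\mathcal M(x)\}$ and $\tilde G(x,v):=\{s\in\mathbb R^{n_1}:(s,l)\in G(x,z,v)\text{ for some }l\in\mathbb R^{n_2},\ z\in D_z\}$. Random solutions. A hybrid time domain is a subset of $\mathbb R_{\ge0}\times\mathbb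 Z_{\ge0}$ that is a (finite or infinite) union of consecutive intervals $[t_j,t_{j+1}]\times\{j\}$, $0=t_0\le t_1\le\dots$, the last one (if any) possibly of the form $[t_j,T)\times\{j\}$ with $T\le\infty$; a hybrid arc is a function $\psi$ on a hybrid time domain $\mathrm{dom}(\psi)$ with $t\mapsto\psi(t,j)$ locally absolutely continuous for each $j$. Let $\mathcal F_0$ be trivial and $\mathcal F_\ell=\sigma(\mathbf v_1,\dots,\mathbf v_\ell)$. A stochastic hybrid arc is a map $\omega\mapsto\mathbf y_\omega$ to hybrid arcs such that $\omega\mapsto\mathrm{graph}(\mathbf y_\omega)=\{(t,j,s):(t,j)\in\mathrm{dom}(\mathbf y_\omega),s=\mathbf y_\omega(t,j)\}$ is $\mathcal F$-measurable with closed values; it is adapted if $\omega\mapsto\mathrm{graph}(\mathbf y_\omega)\cap(\mathbb R_{\ge0}\times\{0,\dots,\ell\}\times\mathbb R^{n_1+n_2})$ is $\mathcal F_\ell$-measurable for each $\ell$. (A set-valued map $\Phi$ on $\Omega$ is $\mathcal F$-measurable if $\{\omega:\Phi(\omega)\cap O\ne\emptyset\}\in\mathcal F$ for every open $O$.) A random solution of $\mathcal H_\varepsilon$ from $y_0$ is an adapted stochastic hybrid arc with $\mathbf y_\omega(0,0)=y_0$ such that: if $(t_1,j),(t_2,j)\in\mathrm{dom}(\mathbf y_\omega)$, $t_1<t_2$, then for almost all $t\in[t_1,t_2]$, $\mathbf y_\omega(t,j)\in C$ and $\dot{\mathbf y}_\omega(t,j)\in F_\varepsilon(\mathbf y_\omega(t,j))$;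 and if $(t,j),(t,j+1)\in\mathrm{dom}(\mathbf y_\omega)$, then $\mathbf y_\omega(t,j)\in D$ and $\mathbf y_\omega(t,j+1)\in G(\mathbf y_\omega(t,j),\mathbf v_{j+1}(\omega))$. It is maximal if it cannot be extended to a random solution whose sample paths are strictly longer with positive probability. UGASp of a compact set $\tilde{\mathcal A}$ means that all of the following hold, with $\varpi(y):=|y|_{\tilde{\mathcal A}}$ for $y\in C\cup D$. (C1) For each $\epsilon>0,\rho>0$ there is $\delta>0$ such that every maximal random solution with $\varpi(\mathbf y_\omega(0,0))\le\delta$ satisfies $\mathbb P(\mathbf y_\omega(t,j)\in\tilde{\mathcal A}+\epsilon\mathbb B^\circ\ \forall(t,j)\in\mathrm{dom}(\mathbf y_\omega))\ge1-\rho$. (C2) For each $\delta>0,\rho>0$ there is $\epsilon>0$ such that the same inequality holds for every maximal random solution with $\varpi(\mathbf y_\omega(0,0))\le\delta$. (C3) For each $\epsilon,\rho,R>0$ there is $T\ge0$ such that every random solution with $\varpi(\mathbf y_\omega(0,0))\le R$ satisfies $\mathbb P(\mathbf y_\omega(t,j)\in\tilde{\mathcal A}+\epsilon\mathbb B^\circ\ \forall (t,j)\in\mathrm{dom}(\mathbf y_\omega)\text{ with }t+j\ge T)\ge1-\rho$. *)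

(* Defs.v *)
From HB Require Import structures.
From mathcomp Require Import all_boot all_order all_algebra.
From mathcomp Require Import all_classical all_reals all_analysis.

Set Implicit Arguments.
Unset Strict Implicit.
Unset Printing Implicit Defensive.

Import Order.TTheory GRing.Theory Num.Theory.
Import numFieldNormedType.Exports.

Local Open Scope classical_set_scope.
Local Open Scope ring_scope.

(* The library norm on ['rV[R]_n] is the sup norm; it is
   only used below through the topology, boundedness and Lipschitz continuity,
   which do not depend on the choice of a norm. *)

Definition dot (R : realType) (n : nat) (u v : 'rV[R]_n) : R :=
  \sum_i u 0 i * v 0 i.

Definition enorm (R : realType) (n : nat) (u : 'rV[R]_n) : R :=
  Num.sqrt (dot u u).

(* |z|_S, equal to [+oo] when [S] is empty. *)
Definition eset_dist (R : realType) (n : nat) (S : set 'rV[R]_n) (z : 'rV[R]_n)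
    : \bar R :=
  ereal_inf [set (enorm (z - s))%:E | s in S].

Definition set_dist (R : realType) (n : nat) (S : set 'rV[R]_n) (z : 'rV[R]_n) : R :=
  fine (eset_dist S z).

(* S + e B°, with B° the open unit ball *)
Definition inflate (R : realType) (n : nat) (S : set 'rV[R]_n) (e : R)
    : set 'rV[R]_n :=
  [set y | exists2 s, S s & exists2 b, enorm b < 1 & y = s + e *: b].

(* A function on R_{>=0} is represented by a function on [R] whose values at
   negative arguments are irrelevant. *)

Definition class_Kinf (R : realType) (a : R -> R) : Prop :=
  [/\ a 0 = 0,
      {within `[0, +oo[, continuous a},
      (forall s t, 0 <= s -> s < t -> a s < a t) &
      (forall M, exists2 s, 0 <= s & M < a s)].

(* [f], viewed as a function on [X], is positive definite with respect to [S]. *)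
Definition class_PD (R : realType) (T : Type) (X S : set T) (f : T -> R) : Prop :=
  forall x, X x -> (S x -> f x = 0) /\ (~ S x -> 0 < f x).

Definition osc (T U : topologicalType) (M : T -> set U) : Prop :=
  forall (x_ : nat -> T) (y_ : nat -> U) (x : T) (y : U),
    x_ @ \oo --> x -> y_ @ \oo --> y -> (forall i, M (x_ i) (y_ i)) -> M x y.

Definition loc_bounded (R : realType) (T U : normedModType R) (M : T -> set U)
    : Prop :=
  forall K : set T, bounded_set K -> bounded_set (\bigcup_(x in K) M x).

Definition sv_graph (T U : Type) (M : T -> set U) : set (T * U) :=
  [set p | M p.1 p.2].

Definition closed_convex_hull (R : realType) (n : nat) (A : set 'rV[R]_n)
    : set 'rV[R]_n :=
  closure (smallest (fun B : set 'rV[R]_n => convex_set B) A).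

Definition sv_measurable (T : Type) (U : topologicalType) (S : set (set T))
    (Phi : T -> set U) : Prop :=
  forall O : set U, open O -> S [set w | Phi w `&` O !=set0].

Definition loc_lipschitz (R : realType) (n : nat) (f : 'rV[R]_n -> R) : Prop :=
  forall x : 'rV[R]_n,
    exists2 U, nbhs x U & [lipschitz (f y : R^o) | y in U].

(* f°(x; u), the upper limit of (f (y + t u) - f y) / t as y -> x, t -> 0+ *)
Definition clarke_dderiv (R : realType) (n : nat) (f : 'rV[R]_n -> R)
    (x u : 'rV[R]_n) : \bar R :=
  limf_esup (fun p : 'rV[R]_n * R => ((f (p.1 + p.2 *: u) - f p.1) / p.2)%:E)
            (filter_prod (nbhs x) 0^'+).

Definition clarke (R : realType) (n : nat) (f : 'rV[R]_n -> R) (x : 'rV[R]_n)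
    : set 'rV[R]_n :=
  [set v | forall u, ((dot v u)%:E <= clarke_dderiv f x u)%E].

(* max {<v, u> : v in clarke f x}. It is only used for locally Lipschitz [f]:
   the Clarke gradient is then nonempty and compact, so the supremum is a
   maximum. *)
Definition clarke_max (R : realType) (n : nat) (f : 'rV[R]_n -> R)
    (x u : 'rV[R]_n) : \bar R :=
  ereal_sup [set (dot v u)%:E | v in clarke f x].

Definition regular_fun (R : realType) (n : nat) (f : 'rV[R]_n -> R) : Prop :=
  forall y u, exists2 l : R,
    (fun h => (f (y + h *: u) - f y) / h) @ 0^'+ --> l &
    clarke_max f y u = l%:E.

(* A joint function of (x, z) as a function of y = row_mx x z. *)
Definition joint (R : realType) (n1 n2 : nat) (T : Type)
    (f : 'rV[R]_n1 -> 'rV[R]_n2 -> T) (y : 'rV[R]_(n1 + n2)) : T :=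
  f (lsubmx y) (rsubmx y).

Definition joint_set (R : realType) (n1 n2 : nat) (A : set 'rV[R]_n1)
    (B : 'rV[R]_n1 -> set 'rV[R]_n2) : set 'rV[R]_(n1 + n2) :=
  [set y | A (lsubmx y) /\ B (lsubmx y) (rsubmx y)].

(* Stochastic hybrid system with state in R^n and random inputs in R^m. *)
Record shs (R : realType) (n m : nat) := SHS {
  flow_set : set 'rV[R]_n;
  flow_map : 'rV[R]_n -> set 'rV[R]_n;
  jump_set : set 'rV[R]_n;
  jump_map : 'rV[R]_n -> 'rV[R]_m -> set 'rV[R]_n }.

Definition borel (R : realType) (m : nat) := g_sigma_algebraType (@open 'rV[R]_m).

Definition basic_conditions (R : realType) (n m : nat) (H : shs R n m) : Prop :=
  [/\ closed (flow_set H) /\ closed (jump_set H),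
      (forall y, flow_set H y -> flow_map H y !=set0) /\
      (forall y v, jump_set H y -> jump_map H y v !=set0),
      [/\ osc (flow_map H), loc_bounded (flow_map H) &
          forall y, convex_set (flow_map H y)],
      loc_bounded (fun p : 'rV[R]_n * 'rV[R]_m => jump_map H p.1 p.2) &
      (forall v, closed (sv_graph (jump_map H ^~ v))) /\
      sv_measurable (measurable : set (set (borel R m)))
        (fun v => sv_graph (jump_map H ^~ v))].

(* G(D x Vs) *)
Definition jump_image (R : realType) (n m : nat)
    (G : 'rV[R]_n -> 'rV[R]_m -> set 'rV[R]_n) (D : set 'rV[R]_n)
    (Vs : set 'rV[R]_m) : set 'rV[R]_n :=
  \bigcup_(y in D) \bigcup_(v in Vs) G y v.

Definition hybrid_time_domain (R : realType) (E : set (R * nat)) : Prop :=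
  exists2 t : nat -> R, t 0%N = 0 /\ (forall j, t j <= t j.+1) &
    E = [set p | t p.2 <= p.1 <= t p.2.+1] \/
    (* [b] ranges over all right ends, closed, open or infinite, for which
       the last interval is nonempty *)
    exists J (b : itv_bound R), (BLeft (t J) < b)%O /\
      E = [set p | ((p.2 < J)%N /\ t p.2 <= p.1 <= t p.2.+1) \/
                   (p.2 = J /\ p.1 \in Interval (BLeft (t J)) b)].

Definition abs_continuous (R : realType) (n : nat) (f : R -> 'rV[R]_n) (a b : R)
    : Prop :=
  forall e, 0 < e -> exists2 d, 0 < d &
    forall (k : nat) (s t : 'I_k -> R),
      (forall i, a <= s i /\ s i <= t i /\ t i <= b) ->
      (forall i j, i != j -> t i <= s j \/ t j <= s i) ->
      \sum_i (t i - s i) < d -> \sum_i enorm (f (t i) - f (s i)) < e.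

(* The values of [arc_val] outside [arc_dom] are irrelevant. *)
Record harc (R : realType) (n : nat) := HArc {
  arc_dom : set (R * nat);
  arc_val :> R -> nat -> 'rV[R]_n }.

Definition hybrid_arc (R : realType) (n : nat) (y : harc R n) : Prop :=
  hybrid_time_domain (arc_dom y) /\
  forall j a b, a < b -> (forall t, a <= t <= b -> arc_dom y (t, j)) ->
    abs_continuous (y ^~ j) a b.

Definition arc_graph (R : realType) (n : nat) (y : harc R n)
    : set (R * nat * 'rV[R]_n) :=
  [set q | arc_dom y q.1 /\ q.2 = y q.1.1 q.1.2].

(* The random inputs are indexed from 0: [v k] stands for v_{k+1}. *)

Definition iid (R : realType) (m : nat) (d : measure_display)
    (Om : measurableType d) (P : probability Om R)
    (mu : probability (borel R m) R) (v : nat -> Om -> 'rV[R]_m) : Prop :=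
  [/\ forall k, measurable_fun setT (v k : Om -> borel R m),
      forall k (B : set (borel R m)), measurable B -> P (v k @^-1` B) = mu B &
      forall (s : seq nat) (B : nat -> set (borel R m)), uniq s ->
        (forall k, measurable (B k)) ->
        P (\bigcap_(k in [set` s]) (v k @^-1` B k)) =
        (\prod_(k <- s) P (v k @^-1` B k))%E].

Definition noise_range (R : realType) (m : nat) (Om : Type)
    (v : nat -> Om -> 'rV[R]_m) : set 'rV[R]_m :=
  \bigcup_k range (v k).

(* F_l = sigma(v_1, ..., v_l); trivial for l = 0 *)
Definition nat_filtration (R : realType) (m : nat) (Om : Type)
    (v : nat -> Om -> 'rV[R]_m) (l : nat) : set (set Om) :=
  <<s [set A | exists k (B : set (borel R m)),
        [/\ (k < l)%N, measurable B & A = v k @^-1` B]] >>.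

Definition stochastic_hybrid_arc (R : realType) (n : nat) (d : measure_display)
    (Om : measurableType d) (y : Om -> harc R n) : Prop :=
  [/\ forall w, hybrid_arc (y w),
      forall w, closed (arc_graph (y w)) &
      sv_measurable measurable (fun w => arc_graph (y w))].

Definition adapted (R : realType) (n m : nat) (Om : Type)
    (v : nat -> Om -> 'rV[R]_m) (y : Om -> harc R n) : Prop :=
  forall l, sv_measurable (nat_filtration v l)
    (fun w => arc_graph (y w) `&` [set q | (q.1.2 <= l)%N]).

Definition random_solution (R : realType) (n m : nat) (d : measure_display)
    (Om : measurableType d) (v : nat -> Om -> 'rV[R]_m) (H : shs R n m)
    (y0 : 'rV[R]_n) (y : Om -> harc R n) : Prop :=
  [/\ stochastic_hybrid_arc y /\ adapted v y,
      forall w, arc_dom (y w) (0, 0%N) /\ y w 0 0%N = y0,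
      forall w j t1 t2,
        arc_dom (y w) (t1, j) -> arc_dom (y w) (t2, j) -> t1 < t2 ->
        {ae lebesgue_measure, forall t : R, t1 <= t <= t2 ->
          flow_set H (y w t j) /\
          exists2 f, is_derive t 1 (y w ^~ j) f & flow_map H (y w t j) f} &
      forall w t j, arc_dom (y w) (t, j) -> arc_dom (y w) (t, j.+1) ->
        jump_set H (y w t j) /\ jump_map H (y w t j) (v j w) (y w t j.+1)].

Definition maximal_solution (R : realType) (n m : nat) (d : measure_display)
    (Om : measurableType d) (P : probability Om R) (v : nat -> Om -> 'rV[R]_m)
    (H : shs R n m) (y0 : 'rV[R]_n) (y : Om -> harc R n) : Prop :=
  random_solution v H y0 y /\
  ~ exists y' : Om -> harc R n,
    [/\ random_solution v H y0 y',
        forall w, arc_graph (y w) `<=` arc_graph (y' w) &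
        (0 < P [set w | arc_dom (y w) `<` arc_dom (y' w)])%E].

Definition UGASp (R : realType) (n m : nat) (d : measure_display)
    (Om : measurableType d) (P : probability Om R) (v : nat -> Om -> 'rV[R]_m)
    (H : shs R n m) (A : set 'rV[R]_n) : Prop :=
  let start (r : R) y0 :=
    (flow_set H `|` jump_set H) y0 /\ (eset_dist A y0 <= r%:E)%E in
  let stays (y : Om -> harc R n) (e : R) := [set w | forall t j,
    arc_dom (y w) (t, j) -> inflate A e (y w t j)] in
  let stays_after (y : Om -> harc R n) (e T : R) := [set w | forall t j,
    arc_dom (y w) (t, j) -> T <= t + j%:R -> inflate A e (y w t j)] in
  [/\ (forall e rho, 0 < e -> 0 < rho -> exists2 delta, 0 < delta &
        forall y0 y, maximal_solution P v H y0 y -> start delta y0 ->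
          ((1 - rho)%:E <= P (stays y e))%E),
      (forall delta rho, 0 < delta -> 0 < rho -> exists2 e, 0 < e &
        forall y0 y, maximal_solution P v H y0 y -> start delta y0 ->
          ((1 - rho)%:E <= P (stays y e))%E) &
      (forall e rho r, 0 < e -> 0 < rho -> 0 < r -> exists2 T, 0 <= T &
        forall y0 y, random_solution v H y0 y -> start r y0 ->
          ((1 - rho)%:E <= P (stays_after y e T))%E)].

(* Data of the singularly perturbed system: slow state x, fast state z. *)
Record sp_data (R : realType) (n1 n2 m : nat) := SPData {
  sp_Cx : set 'rV[R]_n1;
  sp_Cz : set 'rV[R]_n2;
  sp_Dx : set 'rV[R]_n1;
  sp_Dz : set 'rV[R]_n2;
  sp_Fx : 'rV[R]_n1 -> 'rV[R]_n2 -> set 'rV[R]_n1;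
  sp_Fz : 'rV[R]_n1 -> 'rV[R]_n2 -> set 'rV[R]_n2;
  sp_G : 'rV[R]_n1 -> 'rV[R]_n2 -> 'rV[R]_m -> set 'rV[R]_(n1 + n2) }.

Definition sp_C (R : realType) (n1 n2 m : nat) (S : sp_data R n1 n2 m)
    : set 'rV[R]_(n1 + n2) :=
  joint_set (sp_Cx S) (fun=> sp_Cz S).

Definition sp_D (R : realType) (n1 n2 m : nat) (S : sp_data R n1 n2 m)
    : set 'rV[R]_(n1 + n2) :=
  joint_set (sp_Dx S) (fun=> sp_Dz S).

Definition sp_jump (R : realType) (n1 n2 m : nat) (S : sp_data R n1 n2 m)
    (y : 'rV[R]_(n1 + n2)) (v : 'rV[R]_m) : set 'rV[R]_(n1 + n2) :=
  sp_G S (lsubmx y) (rsubmx y) v.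

Definition sp_flow (R : realType) (n1 n2 m : nat) (S : sp_data R n1 n2 m)
    (eps : R) (y : 'rV[R]_(n1 + n2)) : set 'rV[R]_(n1 + n2) :=
  joint_set (sp_Fx S (lsubmx y) (rsubmx y))
    (fun=> [set eps^-1 *: f | f in sp_Fz S (lsubmx y) (rsubmx y)]).

Definition perturbed (R : realType) (n1 n2 m : nat) (S : sp_data R n1 n2 m)
    (eps : R) : shs R (n1 + n2) m :=
  SHS (sp_C S) (sp_flow S eps) (sp_D S) (sp_jump S).

Definition reduced_flow (R : realType) (n1 n2 m : nat) (S : sp_data R n1 n2 m)
    (M : 'rV[R]_n1 -> set 'rV[R]_n2) (x : 'rV[R]_n1) : set 'rV[R]_n1 :=
  closed_convex_hull (\bigcup_(z in M x) sp_Fx S x z).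

Definition reduced_jump (R : realType) (n1 n2 m : nat) (S : sp_data R n1 n2 m)
    (x : 'rV[R]_n1) (v : 'rV[R]_m) : set 'rV[R]_n1 :=
  [set s | exists l z, sp_Dz S z /\ sp_G S x z v (row_mx s l)].

Definition reduced (R : realType) (n1 n2 m : nat) (S : sp_data R n1 n2 m)
    (M : 'rV[R]_n1 -> set 'rV[R]_n2) : shs R n1 m :=
  SHS (sp_Cx S) (reduced_flow S M) (sp_Dx S) (reduced_jump S).

(* Main.v *)
Require Import Defs.
From HB Require Import structures.
From mathcomp Require Import all_boot all_order all_algebra.
From mathcomp Require Import all_classical all_reals all_analysis.
From mathcomp Require Import measurable_realfun.
From mathcomp Require Import ring lra.

(** The function E(x, z) = lam V(x) + th W(x, z), with th = k3 / (k1 + k3) and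
    lam = 1 - th, is a Lyapunov function of the perturbed system as soon as
    eps is small, and a Lyapunov function of this kind forces uniform global
    asymptotic stability in probability.

    Flows. A generalized gradient of the regular function W at (x, z) has its
    two blocks in the two partial gradients ([clarke_split]). Hence, at almost
    every time, the slope of E along a flow is at most a quadratic form in
    phix(x) and phiz(|z|_M(x)). The weight th is the one that makes the two
    cross terms equal, and the form is negative definite once kz / eps exceeds
    a constant ([composite_slope]). A bound on the slopes at almost every time
    passes to increments because the flow is absolutely continuous and E is
    locally Lipschitz ([ac_slope_le], [flow_decrease]). On the part of the flow
    set where a <= E <= c the decrease is at least a constant rate: the
    distance |z|_M(x) is only lower semicontinuous, but this is the right
    direction for a compactness argument ([dissipation_pos]).

    Jumps. The decrease rho in the jump condition has no regularity, so it
    could be arbitrarily small on a compact set. It is not: the map that sends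
    y to the integral of min(sup_{g in G(y, u)} E(g), c) is upper
    semicontinuous by Fatou's lemma, where the graph of G gives the pointwise
    semicontinuity ([jump_usc]) and the truncation at c the domination. The
    difference between E(y) and this integral is therefore lower
    semicontinuous, and it is positive where E is, so it is bounded below on
    compact sets ([uniform_jump_decrease]).

    Probability. Adaptedness speaks of set-valued maps. It is first turned into
    measurability of the state before the jump of index j with respect to the
    inputs of index less than j ([measurable_fun_endpoint_state]). The input of
    index j is independent of these, so that the expectation of a function of
    both is an iterated integral ([freezing]). This yields two maximal
    inequalities, by supermartingales indexed by the number of jumps:
    after a value below a, the function E reaches c at a later jump index with
    probability at most a / c ([rebound_bound]); and E remains between a and c
    up to hybrid time t + j >= T with probability at most E(y0) / (k T), since
    E + k (t + j) is a supermartingale there ([slow_bound]).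

    The first inequality alone gives stability and boundedness, with the
    initial state as the low value. If a solution is far from the target after
    time T, then either E has exceeded c, or it has climbed from below a to c1,
    or it has remained between a and c up to time T; the three probabilities
    are small for a suitable choice of c, then a, then T ([lyapunov_UGASp]).
    The bounds on V and W translate values of E into distances to the target
    ([composite_small_inflate], [composite_start_small]). *)

Set Implicit Arguments.
Unset Strict Implicit.
Unset Printing Implicit Defensive.

Import Order.TTheory GRing.Theory Num.Theory.
Import numFieldNormedType.Exports.

Local Open Scope classical_set_scope.
Local Open Scope ring_scope.

(** * Slopes of absolutely continuous functions *)

(** Cousin's lemma: an additive property of intervals that holds for all short
    intervals around each point holds for the whole segment. The supremum of
    the points reached from the left end is reached, and can be passed. *)
Lemma cousin (R : realType) (P : R -> R -> Prop) (a b : R) : a <= b ->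
  (forall s t u, s <= t -> t <= u -> P s t -> P t u -> P s u) ->
  (forall t, a <= t <= b -> exists2 r, 0 < r &
     forall s u, a <= s -> s <= t -> t <= u -> u <= b ->
       t - r < s -> u < t + r -> P s u) ->
  P a b.
Proof.
move=> ab Ptrans Ploc.
pose S := [set t | a <= t <= b /\ P a t].
have Sa : S a.
  split; first by rewrite lexx.
  have [|r r0] := Ploc a; first by rewrite lexx.
  by apply; rewrite ?lexx ?ltrDl ?ltrBlDr ?ltrDl.
have Sub : ubound S b by move=> t [/andP[]].
have hS : has_sup S by split; [exists a|exists b].
have ac : a <= sup S by apply: ub_le_sup => //; exists b.
have cb : sup S <= b by apply: ge_sup => //; exists a.
have [|r r0 Pr] := Ploc (sup S); first by rewrite ac.
have [t [/andP[at_ tb] Pat] ct] := sup_adherent r0 hS.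
have tc : t <= sup S by apply: ub_le_sup; [exists b|split=> //; apply/andP].
pose u := Num.min b (sup S + r / 2).
have cu : sup S <= u by rewrite le_min cb lerDl divr_ge0 // ltW.
have ub : u <= b by rewrite ge_min lexx.
have Pau : P a u.
  apply: (Ptrans a t u) => //; first exact: le_trans cu.
  apply: Pr => //.
  by rewrite gt_min; apply/orP; right; rewrite ltrD2l ltr_pdivrMr // ltr_pMr // ltr1n.
have uc : u <= sup S.
  apply: ub_le_sup; [by exists b|split=> //].
  by rewrite ub (le_trans ac).
have [/eqP <- //|/eqP bu] := boolP (u == b).
have : u = sup S + r / 2.
  by move: bu; rewrite /u; case: (leP b) => // h /eqP.
by move=> /(congr1 (fun x => x <= sup S)); rewrite uc gerDl leNgt divr_gt0.
Qed.

(** One-sided upper bounds on the difference quotients on both sides of t;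
    unlike a bound on a derivative, it applies to functions with different
    one-sided derivatives. *)
Definition slope_le (R : realType) (g : R -> R) (q t : R) : Prop :=
  forall e, 0 < e -> exists2 r, 0 < r & forall h, 0 < h -> h < r ->
    g (t + h) - g t <= (q + e) * h /\ g t - g (t - h) <= (q + e) * h.

Definition real_ac (R : realType) (g : R -> R) (a b : R) : Prop :=
  forall e, 0 < e -> exists2 d, 0 < d &
    forall (k : nat) (s t : 'I_k -> R),
      (forall i, a <= s i /\ s i <= t i /\ t i <= b) ->
      (forall i j, i != j -> t i <= s j \/ t j <= s i) ->
      \sum_i (t i - s i) < d -> \sum_i `|g (t i) - g (s i)| < e.

Lemma sum_itv_le (R : realType) (k : nat) (s t : 'I_k -> R) (U : set R) (d : R) :
  open U -> (lebesgue_measure U < d%:E)%E ->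
  (forall i, s i <= t i /\ `]s i, t i[ `<=` U) ->
  (forall i j, i != j -> t i <= s j \/ t j <= s i) ->
  \sum_i (t i - s i) < d.
Proof.
move=> oU Ud sU disj; rewrite -lte_fin; apply: le_lt_trans Ud.
pose F i : set R := `]s i, t i[%classic.
have -> : (\sum_i (t i - s i))%:E = (\sum_(i < k) lebesgue_measure (F i))%E.
  rewrite -sumEFin; apply: eq_bigr => i _.
  rewrite lebesgue_measure_itv /= lte_fin.
  by have [+ _] := sU i; case: ltgtP => // -> _; rewrite subrr.
have tF : trivIset setT F.
  move=> i j _ _ [x []] /=; rewrite /F /= !in_itv /= => /andP[s1 t1] /andP[s2 t2].
  apply/eqP/negPn/negP => /disj[] h.
    by have := lt_trans (lt_le_trans t1 h) s2; rewrite ltxx.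
  by have := lt_trans (lt_le_trans t2 h) s1; rewrite ltxx.
have mF i : measurable (F i) by exact: measurable_itv.
rewrite -(measure_bigsetU_ord lebesgue_measure xpredT (F := F)) //.
apply: le_measure; rewrite ?inE.
- by apply: bigsetU_measurable => i _; exact: mF.
- exact: measurable_realfun.open_measurable.
- apply: (big_ind (fun A : set R => A `<=` U)) => //.
    by move=> A B AU BU x [/AU|/BU].
  by move=> i _; have [] := sU i.
Qed.

Definition glue (T : Type) (k1 k2 : nat) (f1 : 'I_k1 -> T) (f2 : 'I_k2 -> T)
    (i : 'I_(k1 + k2)) : T :=
  match fintype.split i with inl j => f1 j | inr j => f2 j end.

(** Cover the exceptional null set by an open set U of small measure. Around a
    point outside the null set the slope bound controls the increment, and
    around a point inside it short intervals lie in U. Cousin's lemma glues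
    these intervals together; those in U are disjoint of small total length,
    so absolute continuity makes their contribution small. *)
Lemma ac_slope_le (R : realType) (g : R -> R) (q a b : R) : a <= b ->
  real_ac g a b ->
  {ae lebesgue_measure, forall t : R, a <= t <= b -> slope_le g q t} ->
  g b - g a <= q * (b - a).
Proof.
move=> ab gac [N [mN N0 Nsl]].
suff main e : 0 < e -> g b - g a <= (q + e) * (b - a) + (e + `|q + e| * e).
  apply/ler_addgt0Pr => e e0.
  pose K := (b - a) + 2 + `|q|.
  have K0 : 0 < K by rewrite /K; have := normr_ge0 q; lra.
  pose e' := Num.min 1 (e / K).
  have e'0 : 0 < e' by rewrite lt_min ltr01 divr_gt0.
  have e'1 : e' <= 1 by rewrite ge_min lexx.
  have e'K : e' * K <= e by rewrite -ler_pdivlMr // ge_min lexx orbT.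
  have := main _ e'0.
  have : `|q + e'| <= `|q| + 1.
    by rewrite (le_trans (ler_normD _ _)) // lerD2l ger0_norm // ltW.
  move=> /(ler_wpM2r (ltW e'0)); rewrite /K in e'K; nra.
move=> e0.
have [d d0 Hd] := gac e e0.
pose d' := Num.min d e.
have d'0 : 0 < d' by rewrite lt_min d0.
have muN : (lebesgue_measure N <= 0)%E.
  by rewrite le_eqVlt; apply/orP; left; apply/eqP; exact: N0.
have [|U [oU NU Ud]] := lebesgue_regularity_outer (eps := d') mN _ d'0.
  exact: le_lt_trans muN (ltry _).
have {}Ud : (lebesgue_measure U < d'%:E)%E.
  apply: le_lt_trans Ud.
  have mU : measurable U by exact: measurable_realfun.open_measurable.
  have mUN : measurable (U `\` N) by exact: measurableD.
  have UE : (U `\` N) `|` N = U by rewrite setUC setDUK.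
  have := measureU2 lebesgue_measure mUN mN; rewrite UE => /le_trans; apply.
  by rewrite -[leRHS]adde0 leeD2l.
pose P s u := exists k (x y : 'I_k -> R),
  [/\ forall i, [/\ s <= x i, x i <= y i, y i <= u & `]x i, y i[ `<=` U],
      forall i j, i != j -> y i <= x j \/ y j <= x i &
      g u - g s <= (q + e) * (u - s) +
        \sum_i (`|g (y i) - g (x i)| + `|q + e| * (y i - x i))].
suff [k [x [y [xy disj ]]]] : P a b.
  move=> /le_trans; apply; rewrite lerD2l big_split /=.
  have sd : \sum_i (y i - x i) < d'.
    by apply: (sum_itv_le oU Ud) => // i; have [] := xy i.
  rewrite -mulr_sumr lerD //.
    apply/ltW/Hd => // [i|]; first by have [] := xy i.
    by apply: lt_le_trans sd _; rewrite ge_min lexx.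
  rewrite ler_wpM2l //; apply: le_trans (ltW sd) _.
  by rewrite ge_min lexx orbT.
apply: cousin => // [s t u st tu|t tab].
  move=> [k1 [x1 [y1 [xy1 dj1 g1]]]] [k2 [x2 [y2 [xy2 dj2 g2]]]].
  exists (k1 + k2)%N, (glue x1 x2), (glue y1 y2); split.
  - move=> i; rewrite /glue; case: (fintype.split i) => j.
      by have [? ? ? ?] := xy1 j; split => //; exact: le_trans tu.
    by have [? ? ? ?] := xy2 j; split => //; exact: le_trans st _.
  - move=> i j ij; rewrite /glue.
    have : fintype.split i != fintype.split j.
      by apply: contra ij => /eqP /(can_inj (@splitK _ _)) ->.
    case: (fintype.split i) => i'; case: (fintype.split j) => j' ij'.
    + by apply: dj1; apply: contra ij' => /eqP ->.
    + left; have [_ _ h _] := xy1 i'; have [h' _ _ _] := xy2 j'.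
      exact: le_trans h h'.
    + right; have [_ _ h _] := xy1 j'; have [h' _ _ _] := xy2 i'.
      exact: le_trans h h'.
    + by apply: dj2; apply: contra ij' => /eqP ->.
  rewrite big_split_ord /=.
  have e1 i : glue y1 y2 (lshift k2 i) = y1 i.
    by rewrite /glue; case: split_ordP => j /eqP; rewrite ?eq_shift // => /eqP ->.
  have e2 i : glue x1 x2 (lshift k2 i) = x1 i.
    by rewrite /glue; case: split_ordP => j /eqP; rewrite ?eq_shift // => /eqP ->.
  have e3 i : glue y1 y2 (rshift k1 i) = y2 i.
    by rewrite /glue; case: split_ordP => j /eqP; rewrite ?eq_shift // => /eqP ->.
  have e4 i : glue x1 x2 (rshift k1 i) = x2 i.
    by rewrite /glue; case: split_ordP => j /eqP; rewrite ?eq_shift // => /eqP ->.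
  under eq_bigr do rewrite e1 e2.
  under [X in _ + (_ + X)]eq_bigr do rewrite e3 e4.
  move: g1 g2; set S1 := \sum_i _; set S2 := \sum_i _; nra.
have [Nt|/(contra_not (@Nsl t)) /contrapT /(_ tab) sl] := pselect (N t).
  have /NU Ut := Nt.
  have [r /= r0 rU] := open_nbhs_nbhs (conj oU Ut).
  exists r => // s u as_ st tu ub rs ur.
  exists 1%N, (fun=> s), (fun=> u); split.
  - move=> i; split=> //; first exact: le_trans tu.
    move=> x /=; rewrite in_itv /= => /andP[sx xu]; apply: rU => /=.
    by rewrite /ball_ /= ltr_distlC; apply/andP; split; lra.
  - by move=> i j; rewrite !ord1 eqxx.
  - rewrite big_ord1.
    have h1 := ler_norm (g u - g s).
    have h2 : - `|q + e| <= q + e by rewrite lerNl -normrN ler_norm.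
    have h3 : 0 <= u - s by rewrite subr_ge0 (le_trans st).
    nra.
have [r r0 Hr] := sl e e0.
exists r => // s u as_ st tu ub rs ur.
exists 0%N, (fun=> 0), (fun=> 0); split; [by case|by case|].
rewrite big_ord0 addr0.
have h1 : g u - g t <= (q + e) * (u - t).
  have [->|ut] := eqVneq u t; first by rewrite !subrr mulr0.
  have ut0 : 0 < u - t by rewrite subr_gt0 lt_neqAle eq_sym ut.
  have [|+ _] := Hr (u - t) ut0; first lra.
  by rewrite [t + _]addrC subrK.
have h2 : g t - g s <= (q + e) * (t - s).
  have [->|ut] := eqVneq s t; first by rewrite !subrr mulr0.
  have ut0 : 0 < t - s by rewrite subr_gt0 lt_neqAle ut.
  have [|_] := Hr (t - s) ut0; first lra.
  by rewrite opprB [t + _]addrC subrK.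
nra.
Qed.

(** * Norms and generalized gradients *)

Lemma enorm_ge0 (R : realType) (n : nat) (u : 'rV[R]_n) : 0 <= enorm u.
Proof. exact: sqrtr_ge0. Qed.

Lemma normr_coord_le (R : realType) (n : nat) (u : 'rV[R]_n) i : `|u 0 i| <= `|u|.
Proof. by rewrite /Num.norm /= mx_normrE; apply: (le_bigmax _ _ (0, i)). Qed.

Lemma normr_le_coord (R : realType) (n : nat) (u : 'rV[R]_n) (e : R) : 0 <= e ->
  (forall i, `|u 0 i| <= e) -> `|u| <= e.
Proof.
move=> e0 ue; rewrite /Num.norm /= mx_normrE; apply: bigmax_le => // -[i j] _.
by rewrite (ord1 i); exact: ue.
Qed.

Lemma norm_le_enorm (R : realType) (n : nat) (u : 'rV[R]_n) : `|u| <= enorm u.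
Proof.
apply: normr_le_coord => [|i]; first exact: enorm_ge0.
rewrite -sqrtr_sqr /enorm ler_wsqrtr // /dot (bigD1 i) //= -expr2 lerDl.
by apply: sumr_ge0 => j _; rewrite -expr2 sqr_ge0.
Qed.

Lemma enorm_le_norm (R : realType) (n : nat) (u : 'rV[R]_n) :
  enorm u <= n%:R * `|u|.
Proof.
have n0 : 0 <= n%:R * `|u| by rewrite mulr_ge0.
rewrite -[leRHS]ger0_norm // -sqrtr_sqr ler_wsqrtr // /dot.
have h i : u 0 i * u 0 i <= `|u| ^+ 2.
  by rewrite -expr2 -real_normK ?num_real // lerXn2r ?nnegrE ?normr_coord_le.
apply: le_trans (ler_sum _ (fun i _ => h i)) _.
rewrite sumr_const card_ord -[leLHS]mulr_natl exprMn ler_wpM2r ?sqr_ge0 //.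
by rewrite -natrX ler_nat -mulnn; case: (posnP n) => [->//|np]; rewrite leq_pmulr.
Qed.

Lemma norm_lsubmx (R : realType) (n1 n2 : nat) (u : 'rV[R]_(n1 + n2)) :
  `|lsubmx u| <= `|u|.
Proof. by apply: normr_le_coord => // i; rewrite mxE; exact: normr_coord_le. Qed.

Lemma norm_rsubmx (R : realType) (n1 n2 : nat) (u : 'rV[R]_(n1 + n2)) :
  `|rsubmx u| <= `|u|.
Proof. by apply: normr_le_coord => // i; rewrite mxE; exact: normr_coord_le. Qed.

Lemma norm_row_mx (R : realType) (n1 n2 : nat) (u : 'rV[R]_n1) (v : 'rV[R]_n2) :
  `|row_mx u v| <= Num.max `|u| `|v|.
Proof.
apply: normr_le_coord => [|i]; first by rewrite le_max normr_ge0.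
by rewrite mxE; case: fintype.split => j; rewrite le_max normr_coord_le ?orbT.
Qed.

Lemma dot_row_mx (R : realType) (n1 n2 : nat) (v : 'rV[R]_(n1 + n2)) a b :
  dot v (row_mx a b) = dot (lsubmx v) a + dot (rsubmx v) b.
Proof.
rewrite /dot big_split_ord /=; congr (_ + _); apply: eq_bigr => i _.
  by rewrite row_mxEl !mxE.
by rewrite row_mxEr !mxE.
Qed.

Lemma dotZr (R : realType) (n : nat) (v u : 'rV[R]_n) a :
  dot v (a *: u) = a * dot v u.
Proof.
by rewrite /dot mulr_sumr; apply: eq_bigr => i _; rewrite mxE mulrCA.
Qed.

Lemma dotDr (R : realType) (n : nat) (v u w : 'rV[R]_n) :
  dot v (u + w) = dot v u + dot v w.
Proof.
by rewrite /dot -big_split /=; apply: eq_bigr => i _; rewrite mxE mulrDr.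
Qed.

Lemma dot0r (R : realType) (n : nat) (v : 'rV[R]_n) : dot v 0 = 0.
Proof. by rewrite /dot big1 // => i _; rewrite mxE mulr0. Qed.

Lemma loc_lipschitzE (R : realType) (n : nat) (f : 'rV[R]_n -> R) :
  loc_lipschitz f -> forall x, exists r L : R, [/\ 0 < r, 0 < L &
    forall y z, `|y - x| < r -> `|z - x| < r -> `|f y - f z| <= L * `|y - z|].
Proof.
move=> fl x; have [U /nbhs_ballP[r /= r0 rU] [M [_ HM]]] := fl x.
exists r, (Num.max 1 (M + 1)); split => //.
  by rewrite lt_max ltr01.
move=> y z yx zx.
have -> := HM (Num.max 1 (M + 1)) _ (y, z) => //.
  by rewrite lt_max ltrDl ltr01 orbT.
by split; apply: rU; rewrite /= -ball_normE /ball_ /= distrC.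
Qed.

(** A one-sided directional derivative at x is a limit of quotients with the
    base point kept at x, while the generalized derivative is an upper limit
    that lets the base point move. *)
Lemma dirderiv_le_clarke (R : realType) (n : nat) (f : 'rV[R]_n -> R)
    (x u : 'rV[R]_n) (l : R) :
  (fun h => (f (x + h *: u) - f x) / h) @ 0^'+ --> l ->
  (l%:E <= clarke_dderiv f x u)%E.
Proof.
move=> fl; apply: le_ereal_inf_tmp => _ [V [[A B] /= [xA B0] ABV]] <-.
apply/lee_addgt0Pr => e e0.
have : \forall h \near 0^'+, B h /\ `|l - (f (x + h *: u) - f x) / h| < e.
  by near=> h; split; near: h => //; move/cvgrPdist_lt : fl; exact.
move=> /filter_ex [h [Bh lh]].
have : (((f (x + h *: u) - f x) / h)%:E <= ereal_sup
   [set ((f (p.1 + p.2 *: u) - f p.1) / p.2)%:E | p in V])%E.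
  apply: ereal_sup_ubound; exists (x, h) => //.
  by apply: ABV; split => //=; exact: nbhs_singleton.
move=> /(leeD2r e%:E); apply: le_trans.
rewrite -EFinD lee_fin; move: lh; rewrite ltr_distlC => /andP[/ltW + _].
by rewrite lerBlDr.
Unshelve. all: by end_near. Qed.

(** Testing v against (u, 0) only involves the directional derivative of W
    along (u, 0), by regularity, and this is a directional derivative of the
    partial function. *)
Lemma clarke_split (R : realType) (n1 n2 : nat)
    (W : 'rV[R]_n1 -> 'rV[R]_n2 -> R) x z (v : 'rV[R]_(n1 + n2)) :
  regular_fun (joint W) -> clarke (joint W) (row_mx x z) v ->
  clarke (W ^~ z) x (lsubmx v) /\ clarke (W x) z (rsubmx v).
Proof.
move=> reg cv.
have key w l : clarke_max (joint W) (row_mx x z) w = l%:E -> dot v w <= l.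
  by move=> e; rewrite -lee_fin -e; apply: ereal_sup_ubound; exists v.
split=> u.
- have [l Wl /key vl] := reg (row_mx x z) (row_mx u 0).
  apply: (@le_trans _ _ l%:E).
    by move: vl; rewrite lee_fin dot_row_mx dot0r addr0.
  apply: dirderiv_le_clarke.
  suff -> : (fun h => ((W ^~ z) (x + h *: u) - (W ^~ z) x) / h) =
      (fun h => (joint W (row_mx x z + h *: (row_mx u 0)) - joint W (row_mx x z)) / h).
    exact: Wl.
  apply/funext => h; rewrite /joint scale_row_mx scaler0 add_row_mx addr0.
  by rewrite !row_mxKl !row_mxKr.
- have [l Wl /key vl] := reg (row_mx x z) (row_mx 0 u).
  apply: (@le_trans _ _ l%:E).
    by move: vl; rewrite lee_fin dot_row_mx dot0r add0r.
  apply: dirderiv_le_clarke.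
  suff -> : (fun h => ((W x) (z + h *: u) - (W x) z) / h) =
      (fun h => (joint W (row_mx x z + h *: (row_mx 0 u)) - joint W (row_mx x z)) / h).
    exact: Wl.
  apply/funext => h; rewrite /joint scale_row_mx scaler0 add_row_mx addr0.
  by rewrite !row_mxKl !row_mxKr.
Qed.

Lemma clarke_max_le (R : realType) (n : nat) (f : 'rV[R]_n -> R) x u v (q : R) :
  (clarke_max f x u <= q%:E)%E -> clarke f x v -> dot v u <= q.
Proof.
move=> fq fv; rewrite -lee_fin; apply: le_trans fq.
by apply: ereal_sup_ubound; exists v.
Qed.

(** Differentiability of a curve with an explicit remainder, a form that
    passes to the first block of coordinates and combines directly with a
    Lipschitz bound. *)
Definition expands_at (R : realType) (n : nat) (c : R -> 'rV[R]_n) (t : R)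
    (u : 'rV[R]_n) : Prop :=
  forall e, 0 < e -> exists2 r, 0 < r &
    forall h, `|h| < r -> `|c (t + h) - c t - h *: u| <= e * `|h|.

Lemma is_derive_expands (R : realType) (n : nat) (c : R -> 'rV[R]_n) (t : R) u :
  is_derive t 1 c u -> expands_at c t u.
Proof.
move=> [dc <-] e e0.
have := dc; move=> /cvgrPdist_le /(_ e e0).
move=> /nbhs_ballP [r /= r0 Hr]; exists r => // h hr.
have [->|h0] := eqVneq h 0; first by rewrite addr0 subrr scale0r subr0 !normr0 mulr0.
have := Hr h; rewrite /= -ball_normE /ball_ /= sub0r normrN => /(_ hr h0).
rewrite -[h *: 1]/(h * 1) mulr1 => H.
have -> : c (t + h) - c t - h *: 'D_1 c t =
   - (h *: ('D_1 c t - h^-1 *: (c (h + t) - c t))).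
  by rewrite scalerBr scalerA divff // scale1r opprB [h + t]addrC.
by rewrite normrN normrZ mulrC ler_wpM2r.
Qed.

Lemma expands_lsubmx (R : realType) (n1 n2 : nat) (c : R -> 'rV[R]_(n1 + n2)) (t : R) u :
  expands_at c t u -> expands_at (fun s => lsubmx (c s)) t (lsubmx u).
Proof.
move=> cu e e0; have [r r0 Hr] := cu e e0; exists r => // h hr.
apply: le_trans (Hr h hr).
by rewrite -linearZ -!linearB; exact: norm_lsubmx.
Qed.

(** By the Lipschitz bound the curve may be replaced by its tangent. To the
    right, regularity gives the derivative max <v, u>. To the left it gives -
    max <v, - u> = min <v, u>, which is at most max <v, u> because the
    gradient is nonempty. *)
Lemma clarke_slope_le (R : realType) (n : nat) (f : 'rV[R]_n -> R)
    (c : R -> 'rV[R]_n) (t : R) u q :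
  loc_lipschitz f -> regular_fun f -> expands_at c t u ->
  (forall v, clarke f (c t) v -> dot v u <= q) ->
  slope_le (f \o c) q t.
Proof.
move=> flip freg cu vq e e0.
have [r [L [r0 L0 HL]]] := loc_lipschitzE flip (c t).
have [l1 fl1 ml1] := freg (c t) u.
have [l2 fl2 ml2] := freg (c t) (- u).
have l1q : l1 <= q.
  by rewrite -lee_fin -ml1; apply: ge_ereal_sup => _ [v cv <-]; rewrite lee_fin vq.
have l2q : - l2 <= q.
  have [v cv] : exists v, clarke f (c t) v.
    apply: contrapT => nv; move: ml2; rewrite /clarke_max.
    suff -> : clarke f (c t) = set0 by rewrite image_set0 ereal_sup0.
    by rewrite -subset0 => v cv; apply: nv; exists v.
  apply: le_trans (vq v cv).
  rewrite lerNl -lee_fin -ml2; apply: ereal_sup_ubound; exists v => //.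
  by rewrite -scaleN1r dotZr mulN1r.
have e20 : 0 < e / 2 by rewrite divr_gt0.
have [r1 r10 Hr1] := cu (e / 2 / L) (divr_gt0 e20 L0).
have [r2 r20 Hr2] := cu 1 ltr01.
have : \forall h \near 0^'+,
    (f (c t + h *: u) - f (c t)) / h <= l1 + e / 2 /\
    l2 - e / 2 <= (f (c t + h *: - u) - f (c t)) / h.
  near=> h; split; near: h.
    move/cvgrPdist_le : fl1 => /(_ _ e20); apply: filterS => h.
    by rewrite ler_distlC => /andP[_].
  move/cvgrPdist_le : fl2 => /(_ _ e20); apply: filterS => h.
  by rewrite ler_distlC => /andP[].
rewrite near_withinE => /nbhs_ballP[r3 /= r30 Hr3].
pose K := `|u| + 1.
have K0 : 0 < K by rewrite /K ltr_wpDl.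
pose r' := Num.min (Num.min r1 r2) (Num.min r3 (r / K)).
exists r'; first by rewrite !lt_min r10 r20 r30 divr_gt0.
move=> h h0; rewrite !lt_min => /andP[/andP[hr1 hr2] /andP[hr3 hrK]].
have hn : `|h| = h by rewrite gtr0_norm.
have [] := Hr3 h _ h0; first by rewrite -ball_normE /ball_ /= sub0r normrN hn.
rewrite ler_pdivrMr // ler_pdivlMr // => Hu HNu.
have hK : h * K < r by rewrite -ltr_pdivlMr.
have near_lin w : `|w| <= `|u| -> `|c t + h *: w - c t| < r.
  move=> wu; rewrite addrC addKr normrZ hn; apply: le_lt_trans hK.
  by rewrite ler_pM2l // /K (le_trans wu) // lerDl.
have near_c k : `|k| = h -> `|c (t + k) - c t| < r.
  move=> kh; have := Hr2 k; rewrite kh mul1r => /(_ hr2) H.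
  have -> : c (t + k) - c t = (c (t + k) - c t - k *: u) + k *: u by rewrite subrK.
  apply: le_lt_trans (ler_normD _ _) _; rewrite normrZ kh.
  apply: le_lt_trans hK; rewrite /K mulrDr mulr1 addrC lerD2l //.
have dist k w : `|k| = h -> `|w| <= `|u| -> k *: u = h *: w ->
    `|f (c (t + k)) - f (c t + h *: w)| <= e / 2 * h.
  move=> kh wu kw; apply: le_trans (HL _ _ (near_c _ kh) (near_lin _ wu)) _.
  have := Hr1 k; rewrite kh => /(_ hr1); rewrite -ler_pdivlMl // opprD addrA -kw.
  by move=> /le_trans; apply; rewrite mulrAC mulrC.
have := dist h u hn (lexx _) erefl.
have := dist (- h) (- u); rewrite !normrN hn => /(_ erefl (lexx _)).
rewrite scaleNr scalerN => /(_ erefl).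
rewrite scalerN in HNu.
rewrite !ler_norml => /andP[d1 d2] /andP[d3 d4].
by split => /=; nra.
Unshelve. all: by end_near. Qed.

Lemma slope_le_lin (R : realType) (g1 g2 : R -> R) (a b q1 q2 t : R) :
  0 <= a -> 0 <= b -> slope_le g1 q1 t -> slope_le g2 q2 t ->
  slope_le (fun s => a * g1 s + b * g2 s) (a * q1 + b * q2) t.
Proof.
move=> a0 b0 h1 h2 e e0.
have K0 : 0 < a + b + 1 by lra.
pose e' := e / (a + b + 1).
have e'0 : 0 < e' by rewrite divr_gt0.
have eK : e' * (a + b + 1) = e by rewrite /e' divfK // gt_eqF.
have [r1 r10 H1] := h1 _ e'0; have [r2 r20 H2] := h2 _ e'0.
exists (Num.min r1 r2); first by rewrite lt_min r10.
move=> h h0; rewrite lt_min => /andP[/(H1 _ h0)[A1 B1] /(H2 _ h0)[A2 B2]].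
have := ler_wpM2l a0 A1; have := ler_wpM2l a0 B1.
have := ler_wpM2l b0 A2; have := ler_wpM2l b0 B2.
have := mulr_gt0 e'0 h0.
rewrite -eK; split; nra.
Qed.

Lemma slope_leW (R : realType) (g : R -> R) (q q' t : R) :
  q <= q' -> slope_le g q t -> slope_le g q' t.
Proof.
move=> qq' h e e0; have [r r0 H] := h e e0; exists r => // k k0 /(H _ k0)[A B].
have : (q + e) * k <= (q' + e) * k by rewrite ler_pM2r // lerD2r.
by split; [exact: le_trans A _|exact: le_trans B _].
Qed.

(** * Decrease of locally Lipschitz functions along curves *)

Lemma dotNN (R : realType) (n : nat) (u : 'rV[R]_n) : dot (- u) (- u) = dot u u.
Proof. by apply: eq_bigr => i _; rewrite !mxE mulrNN. Qed.

Lemma enormN (R : realType) (n : nat) (u : 'rV[R]_n) : enorm (- u) = enorm u.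
Proof. by rewrite /enorm dotNN. Qed.

Lemma enormZ (R : realType) (n : nat) (u : 'rV[R]_n) a : 0 <= a ->
  enorm (a *: u) = a * enorm u.
Proof.
move=> a0; rewrite /enorm.
have -> : dot (a *: u) (a *: u) = a ^+ 2 * dot u u.
  by rewrite /dot mulr_sumr; apply: eq_bigr => i _; rewrite !mxE expr2; ring.
by rewrite sqrtrM ?sqr_ge0 // sqrtr_sqr ger0_norm.
Qed.

Lemma continuous_enorm (R : realType) (n : nat) :
  continuous (@enorm R n : 'rV[R]_n -> R).
Proof.
have sc : continuous (fun v : 'rV[R]_n => \sum_i v 0 i * v 0 i).
  apply: continuous_big => [|i _]; first exact: add_continuous.
  by move=> v; apply: continuousM; exact: coord_continuous.
by move=> u; apply: continuous_comp; [exact: sc|exact: sqrt_continuous].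
Qed.

(** The local form of the Lipschitz condition in terms of the supremum norm,
    free of filters. *)
Definition locally_lip (R : realType) (n : nat) (f : 'rV[R]_n -> R) : Prop :=
  forall x, exists r L : R, [/\ 0 < r, 0 < L &
    forall y z, `|y - x| < r -> `|z - x| < r -> `|f y - f z| <= L * `|y - z|].

Lemma locally_lip_continuous (R : realType) (n : nat) (f : 'rV[R]_n -> R) :
  locally_lip f -> continuous (f : 'rV[R]_n -> R^o).
Proof.
move=> lf x; have [r [L [r0 L0 HL]]] := lf x.
have F : Filter (nbhs x) by exact: nbhs_filter.
apply/cvgrPdist_lt => e e0.
have d0 : 0 < Num.min r (e / L) by rewrite lt_min r0 divr_gt0.
have := nbhsx_ballx x _ d0; apply: filterS => y.
rewrite -ball_normE /ball_ /= lt_min => /andP[xr xe].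
apply: le_lt_trans (HL x y _ _) _; rewrite ?subrr ?normr0 // 1?distrC //.
by rewrite mulrC distrC -ltr_pdivlMr // distrC.
Qed.

Lemma locally_lip_combination (R : realType) (n1 n2 : nat) (V : 'rV[R]_n1 -> R)
    (W : 'rV[R]_(n1 + n2) -> R) (a b : R) :
  0 <= a -> 0 <= b -> locally_lip V -> locally_lip W ->
  locally_lip (fun y => a * V (lsubmx y) + b * W y).
Proof.
move=> a0 b0 lV lW y.
have [r1 [L1 [r10 L10 H1]]] := lV (lsubmx y).
have [r2 [L2 [r20 L20 H2]]] := lW y.
exists (Num.min r1 r2), (a * L1 + b * L2 + 1); split.
- by rewrite lt_min r10.
- by rewrite ltr_wpDl // addr_ge0 // mulr_ge0 // ltW.
move=> u v; rewrite !lt_min => /andP[u1 u2] /andP[v1 v2].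
have := H1 (lsubmx u) (lsubmx v); rewrite -!linearB.
move=> /(_ (le_lt_trans (norm_lsubmx _) u1) (le_lt_trans (norm_lsubmx _) v1)) h1.
have {}h1 := le_trans h1 (ler_wpM2l (ltW L10) (norm_lsubmx (u - v))).
have h2 := H2 u v u2 v2.
have -> : a * V (lsubmx u) + b * W u - (a * V (lsubmx v) + b * W v) =
  a * (V (lsubmx u) - V (lsubmx v)) + b * (W u - W v) by ring.
apply: le_trans (ler_normD _ _) _; rewrite !normrM (ger0_norm a0) (ger0_norm b0).
have := ler_wpM2l a0 h1; have := ler_wpM2l b0 h2.
by have := normr_ge0 (u - v); lra.
Qed.

(** The case of one interval in the definition of absolute continuity. *)
Lemma abs_continuous_near (R : realType) (n : nat) (c : R -> 'rV[R]_n) (a b t e : R) :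
  abs_continuous c a b -> a <= t <= b -> 0 < e ->
  exists2 d, 0 < d & forall x, a <= x <= b -> `|x - t| < d -> `|c x - c t| < e.
Proof.
move=> cac tab e0; have [d d0 Hd] := cac e e0.
exists d => // x xab xt; apply: (le_lt_trans (norm_le_enorm _)).
have := Hd 1%N (fun=> Num.min x t) (fun=> Num.max x t).
rewrite !big_ord1; case: (leP x t) xt => xt h.
  rewrite -enormN opprB; apply => [i|i j|].
  - by move: xab tab => /andP[-> _] /andP[_ ->].
  - by rewrite !ord1 eqxx.
  - by rewrite -[X in X < _]ger0_norm ?subr_ge0 // distrC.
apply => [i|i j|].
- by move: xab tab => /andP[_ ->] /andP[-> _]; rewrite ltW.
- by rewrite !ord1 eqxx.
- by rewrite -[X in X < _]ger0_norm ?subr_ge0 // ltW.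
Qed.

(** On a short interval the curve stays where f is Lipschitz, so that f along
    the curve is absolutely continuous there and its increment is bounded by
    the slope; increments of consecutive intervals add up. *)
Lemma flow_decrease (R : realType) (n : nat) (f : 'rV[R]_n -> R)
    (c : R -> 'rV[R]_n) (a b q : R) : a <= b ->
  locally_lip f -> abs_continuous c a b ->
  {ae lebesgue_measure, forall t : R, a <= t <= b -> slope_le (f \o c) q t} ->
  f (c b) - f (c a) <= q * (b - a).
Proof.
move=> ab lf cac ae.
pose P s u := f (c u) - f (c s) <= q * (u - s).
apply: (@cousin _ P a b) => //.
  by rewrite /P => s t u _ _ h1 h2; lra.
move=> t tab; have [r [L [r0 L0 HL]]] := lf (c t).
have [rho rho0 near_c] := abs_continuous_near cac tab r0.
exists rho => // s u as_ st tu ub rs ur.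
have Hin x : s <= x <= u -> a <= x <= b /\ `|x - t| < rho.
  by move=> /andP[sx xu]; split; [lra|rewrite ltr_distl; lra].
apply: (@ac_slope_le _ (f \o c)); first exact: le_trans tu.
- move=> e e0; have [d d0 Hd] := cac (e / L) (divr_gt0 e0 L0).
  exists d => // k x y xy dj xyd.
  have := Hd k x y _ dj xyd.
  have xy' i : a <= x i /\ x i <= y i /\ y i <= b.
    by have [? [? ?]] := xy i; lra.
  move=> /(_ xy'); rewrite ltr_pdivlMr // mulr_suml; apply: le_lt_trans.
  apply: ler_sum => i _; have [? [? ?]] := xy i.
  have [xi1 xi2] : a <= x i <= b /\ `|x i - t| < rho by apply: Hin; lra.
  have [yi1 yi2] : a <= y i <= b /\ `|y i - t| < rho by apply: Hin; lra.
  apply: le_trans (HL _ _ (near_c _ yi1 yi2) (near_c _ xi1 xi2)) _.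
  by rewrite mulrC ler_wpM2r ?norm_le_enorm // ltW.
- have [N [mN N0 aeN]] := ae; exists N; split => // x nx; apply: aeN => Hx.
  by apply: nx => sxu; apply: Hx; have [] := Hin _ sxu.
Qed.

Section Kinf.
Variables (R : realType) (a : R -> R).
Hypothesis ha : class_Kinf a.

Lemma Kinf_le s t : 0 <= s -> s <= t -> a s <= a t.
Proof.
have [_ _ h _] := ha; move=> s0; rewrite le_eqVlt => /orP[/eqP -> //|st].
exact/ltW/h.
Qed.

Lemma Kinf_lt_inv s t : 0 <= s -> a t < a s -> t < s.
Proof.
move=> s0 h; rewrite ltNge; apply/negP => st.
by have := lt_le_trans h (Kinf_le s0 st); rewrite ltxx.
Qed.

Lemma Kinf_gt0 s : 0 < s -> 0 < a s.
Proof. by have [a0 _ h _] := ha => s0; rewrite -[ltLHS]a0; exact: h. Qed.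

Lemma Kinf_ge0 s : 0 <= s -> 0 <= a s.
Proof. by move=> s0; have [a0 _ _ _] := ha; rewrite -[leLHS]a0; exact: Kinf_le. Qed.

Lemma Kinf_small e : 0 < e -> exists2 d, 0 < d &
  forall s, 0 <= s -> s <= d -> a s < e.
Proof.
move=> e0; have [a0 ac h _] := ha.
have [_] := (continuous_within_itvcyP _ _).1 ac; rewrite a0.
move=> /cvgrPdist_lt /(_ e e0); rewrite near_withinE.
move=> /nbhs_ballP[d /= d0 Hd].
have d20 : 0 < d / 2 by rewrite divr_gt0.
exists (d / 2) => // s s0 sd; apply: (le_lt_trans (Kinf_le s0 sd)).
have := Hd (d / 2); rewrite /= -ball_normE /ball_ /= !sub0r !normrN.
rewrite !gtr0_norm ?Kinf_gt0 //; apply => //.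
by rewrite ltr_pdivrMr // ltr_pMr // ltr1n.
Qed.

End Kinf.

Section set_dist.
Variables (R : realType) (n : nat) (S : set 'rV[R]_n).
Implicit Types z s : 'rV[R]_n.

Lemma eset_dist_ge0 z : (0 <= eset_dist S z)%E.
Proof.
by apply: le_ereal_inf_tmp => _ [s _ <-]; rewrite lee_fin enorm_ge0.
Qed.

Lemma set_dist_ge0 z : 0 <= set_dist S z.
Proof. exact/fine_ge0/eset_dist_ge0. Qed.

Lemma eset_dist_le z s : S s -> (eset_dist S z <= (enorm (z - s))%:E)%E.
Proof. by move=> Ss; apply: ereal_inf_lbound; exists s. Qed.

Lemma eset_distE z : S !=set0 -> eset_dist S z = (set_dist S z)%:E.
Proof.
move=> [s Ss]; rewrite fineK // ge0_fin_numE ?eset_dist_ge0 //.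
exact: le_lt_trans (eset_dist_le z Ss) (ltry _).
Qed.

Lemma set_dist_le z s : S s -> set_dist S z <= enorm (z - s).
Proof.
by move=> Ss; rewrite -lee_fin -eset_distE ?eset_dist_le //; exists s.
Qed.

Lemma eset_dist_lt z b : (eset_dist S z < b%:E)%E ->
  exists2 s, S s & enorm (z - s) < b.
Proof.
by move=> /ereal_inf_lt[_ [s Ss <-]]; rewrite lte_fin => sb; exists s.
Qed.

Lemma set_dist_lt z b : S !=set0 -> set_dist S z < b ->
  exists2 s, S s & enorm (z - s) < b.
Proof. by move=> S0 zb; apply: eset_dist_lt; rewrite eset_distE. Qed.

Lemma set_dist_ge z b : S !=set0 -> (forall s, S s -> b <= enorm (z - s)) ->
  b <= set_dist S z.
Proof.
move=> S0 Sb; rewrite -lee_fin -eset_distE //.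
by apply: le_ereal_inf_tmp => _ [s Ss <-]; rewrite lee_fin Sb.
Qed.

Lemma set_dist_in z : S z -> set_dist S z = 0.
Proof.
move=> Sz; apply/le_anti; rewrite set_dist_ge0 andbT.
apply: le_trans (set_dist_le _ Sz) _.
by rewrite subrr /enorm dot0r sqrtr0.
Qed.

Lemma set_dist_near_gt0 x : closed S -> S !=set0 -> ~ S x ->
  exists2 e, 0 < e & \forall x' \near x, e <= set_dist S x'.
Proof.
move=> cS S0 nSx.
have /nbhs_ballP[r /= r0 Hr] : nbhs x (~` S).
  by apply: open_nbhs_nbhs; split => //; exact: closed_openC.
have r20 : 0 < r / 2 by rewrite divr_gt0.
exists (r / 2) => //; apply/nbhs_ballP; exists (r / 2) => // x'.
rewrite -ball_normE /ball_ /= => xx'; apply: set_dist_ge => // s Ss.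
apply: le_trans (norm_le_enorm _); rewrite leNgt; apply/negP => x's.
apply: (Hr s) => //; rewrite -ball_normE /ball_ /=.
have -> : x - s = (x - x') + (x' - s) by rewrite addrA subrK.
apply: le_lt_trans (ler_normD _ _) _.
by rewrite [ltRHS]splitr ltrD.
Qed.

End set_dist.

(** Otherwise points of M(x_k) at distance tending to zero from z_k, with
    (x_k, z_k) converging to (x, z), would converge to z, and outer
    semicontinuity would put z in M(x). *)
Lemma osc_set_dist_near_gt0 (R : realType) (n1 n2 : nat)
    (M : 'rV[R]_n1 -> set 'rV[R]_n2) (y : 'rV[R]_(n1 + n2)) :
  osc M -> (forall x, M x !=set0) -> ~ M (lsubmx y) (rsubmx y) ->
  exists2 e, 0 < e & \forall y' \near y, e <= set_dist (M (lsubmx y')) (rsubmx y').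
Proof.
move=> oM M0 nM; apply: contrapT => nex; apply: nM.
have Hk k : exists yr : 'rV[R]_(n1 + n2) * 'rV[R]_n2,
    [/\ `|yr.1 - y| < k.+1%:R^-1, M (lsubmx yr.1) yr.2 &
        `|yr.2 - rsubmx y| < 2 * k.+1%:R^-1].
  apply: contrapT => nyr; apply: nex; exists k.+1%:R^-1; first by rewrite invr_gt0.
  apply/nbhs_ballP; exists k.+1%:R^-1; first by rewrite /= invr_gt0.
  move=> y'; rewrite -ball_normE /ball_ /= distrC => yy'.
  rewrite leNgt; apply/negP => /set_dist_lt[|s Ms ys]; first exact: M0.
  apply: nyr; exists (y', s); split => //=.
  have -> : s - rsubmx y = (rsubmx y' - rsubmx y) - (rsubmx y' - s).
    by rewrite opprB [RHS]addrC addrA subrK.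
  apply: le_lt_trans (ler_normB _ _) _; rewrite mulr2n mulrDl !mul1r ltrD //.
    by rewrite -linearB; exact: le_lt_trans (norm_rsubmx _) yy'.
  exact: le_lt_trans (norm_le_enorm _) ys.
have [g Hg] := choice Hk.
apply: (oM (fun k => lsubmx (g k).1) (fun k => (g k).2)).
- apply/cvgrPdist_lt => e e0.
  have := @cvg_harmonic R; move=> /cvgrPdist_lt /(_ e e0); apply: filterS => k.
  rewrite sub0r normrN ger0_norm ?invr_ge0 // => ke.
  have [h _ _] := Hg k; rewrite -linearB; apply: (le_lt_trans (norm_lsubmx _)).
  by rewrite distrC; exact: lt_trans h ke.
- apply/cvgrPdist_lt => e e0.
  have e20 : 0 < e / 2 by rewrite divr_gt0.
  have := @cvg_harmonic R; move=> /cvgrPdist_lt /(_ _ e20); apply: filterS => k.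
  rewrite sub0r normrN ger0_norm ?invr_ge0 // => ke.
  have [_ _ h] := Hg k; rewrite distrC; apply: lt_trans h _.
  by rewrite mulrC -ltr_pdivlMr.
- by move=> k; have [] := Hg k.
Qed.

Lemma inflateP (R : realType) (n : nat) (S : set 'rV[R]_n) (e : R) y :
  0 < e -> inflate S e y <-> exists2 s, S s & enorm (y - s) < e.
Proof.
move=> e0; split=> [[s Ss [b b1 ->]]|[s Ss ys]]; exists s => //.
  by rewrite addrC addKr enormZ ?ltW // gtr_pMr.
exists (e^-1 *: (y - s)).
  by rewrite enormZ ?invr_ge0 ?ltW // mulrC ltr_pdivrMr // mul1r.
by rewrite scalerA divff ?gt_eqF // scale1r addrC subrK.
Qed.

Lemma open_inflate (R : realType) (n : nat) (S : set 'rV[R]_n) (e : R) :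
  0 < e -> open (inflate S e).
Proof.
move=> e0.
have -> : inflate S e = \bigcup_(s in S) ((fun y : 'rV[R]_n => enorm (y - s)) @^-1` [set x | x < e]).
  apply/seteqP; split=> y.
    by move=> /(inflateP _ _ e0)[s Ss ys]; exists s.
  by move=> [s Ss ys]; apply/(inflateP _ _ e0); exists s.
apply: bigcup_open => s _.
suff /continuousP c : continuous (fun y : 'rV[R]_n => enorm (y - s)).
  have h := c [set x | x < e] (@open_lt _ e).
  exact: h.
move=> y; apply: (@continuous_comp _ _ _ (fun y : 'rV[R]_n => y - s) (@enorm R n)).
  by apply: continuousB; [exact: cvg_id|exact: cst_continuous].
exact: continuous_enorm.
Qed.

(** * The composite function and the distance to the target *)

Lemma inv_succ_lt (R : realType) (e : R) : 0 < e -> exists k : nat, k.+1%:R^-1 < e.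
Proof.
move=> e0; have /cvgrPdist_lt/(_ e e0)/filter_ex[k] := @cvg_harmonic R.
by rewrite sub0r normrN ger0_norm ?invr_ge0 // => ke; exists k.
Qed.

(** How every compactness argument below is run: a property that holds near
    each point for all small positive constants holds on the whole set for one
    constant. *)
Lemma compact_uniform_pos (R : realType) (X : topologicalType) (K : set X)
    (P : R -> X -> Prop) : compact K ->
  (forall y, K y -> \forall y' \near y & k \near 0^'+, P k y') ->
  exists2 k, 0 < k & forall y, K y -> P k y.
Proof.
have F : Filter (0^'+ : set_system R) by exact: at_right_proper_filter.
move=> /compact_near_coveringP/(_ _ (0^'+ : set_system R) P F) cK KP.
have h := @filterI _ _ F _ _ (nbhs_right_gt (0 : R)) (cK KP).
by have [k [/= k0 Hk]] := filter_ex h; exists k.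
Qed.

Lemma compact_closed_bounded (R : realType) (n : nat) (K : set 'rV[R]_n) (B : R) :
  closed K -> (forall y, K y -> `|y| <= B) -> compact K.
Proof.
move=> cK KB; apply: bounded_closed_compact => //.
exists B; split; first by rewrite num_real.
by move=> r Br x /= /KB /le_trans; apply; exact: ltW.
Qed.

Lemma closed_norm_le (R : realType) (n : nat) (B : R) :
  closed [set y : 'rV[R]_n | `|y| <= B].
Proof.
suff /continuous_closedP c : continuous (fun y : 'rV[R]_n => `|y| : R).
  have h := c [set x | x <= B] (@closed_le _ B); exact: h.
exact: norm_continuous.
Qed.

Section composite_bounds.
Variables (R : realType) (n1 n2 : nat).
Variables (M : 'rV[R]_n1 -> set 'rV[R]_n2) (A : set 'rV[R]_n1).
Hypotheses (hA : compact A) (hMosc : osc M) (hMlb : loc_bounded M).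
Hypotheses (A0 : A !=set0) (M0 : forall x, M x !=set0).
Variable alpha : R -> R.
Hypothesis halpha : class_Kinf alpha.
Hypothesis hMalpha : forall x r1 r2, A r1 -> M r1 r2 ->
  (eset_dist (M x) r2 <= (alpha (enorm (x - r1)))%:E)%E.
Variables (W : 'rV[R]_n1 -> 'rV[R]_n2 -> R) (V : 'rV[R]_n1 -> R).
Variables (alpha1 alpha2 alpha3 alpha4 : R -> R).
Hypotheses (halpha1 : class_Kinf alpha1) (halpha2 : class_Kinf alpha2).
Hypotheses (halpha3 : class_Kinf alpha3) (halpha4 : class_Kinf alpha4).
Variable Y : set 'rV[R]_(n1 + n2).
Hypothesis YW : forall y, Y y ->
  alpha1 (set_dist (M (lsubmx y)) (rsubmx y)) <= W (lsubmx y) (rsubmx y)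
    <= alpha2 (set_dist (M (lsubmx y)) (rsubmx y)).
Hypothesis YV : forall y, Y y ->
  alpha3 (set_dist A (lsubmx y)) <= V (lsubmx y) <= alpha4 (set_dist A (lsubmx y)).
Variables (lam th : R).
Hypotheses (lam0 : 0 < lam) (th0 : 0 < th).

Let E (y : 'rV[R]_(n1 + n2)) := lam * V (lsubmx y) + th * W (lsubmx y) (rsubmx y).
Let At := joint_set A M.
Let dM (y : 'rV[R]_(n1 + n2)) := set_dist (M (lsubmx y)) (rsubmx y).
Let dA (y : 'rV[R]_(n1 + n2)) := set_dist A (lsubmx y).

Let closedA : closed A.
Proof. exact: (compact_closed (@norm_hausdorff _ _) hA). Qed.

Let dM0 y : 0 <= dM y. Proof. exact: set_dist_ge0. Qed.
Let dA0 y : 0 <= dA y. Proof. exact: set_dist_ge0. Qed.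

Lemma composite_ge y : Y y -> lam * alpha3 (dA y) + th * alpha1 (dM y) <= E y.
Proof.
move=> Yy; have /andP[h1 _] := YW Yy; have /andP[h3 _] := YV Yy.
by rewrite lerD // ler_wpM2l // ltW.
Qed.

Lemma composite_le y : Y y -> E y <= lam * alpha4 (dA y) + th * alpha2 (dM y).
Proof.
move=> Yy; have /andP[_ h1] := YW Yy; have /andP[_ h3] := YV Yy.
by rewrite lerD // ler_wpM2l // ltW.
Qed.

(** A bound on E bounds |x|_A, hence x because A is bounded, and |z|_M(x),
    hence z because M is bounded over bounded sets of x. *)
Lemma composite_sublevel_bounded c : exists2 B, 0 < B & forall y, Y y -> E y <= c ->
  `|y| <= B /\ dM y <= B.
Proof.
have [_ _ _ un3] := halpha3; have [_ _ _ un1] := halpha1.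
have [b3 b30 Hb3] := un3 (c / lam); have [b1 b10 Hb1] := un1 (c / th).
have [BA [_ HBA]] := compact_bounded hA.
pose B1 := `|BA| + 1 + (b3 + 1).
have xB y : dA y < b3 + 1 -> `|lsubmx y| <= B1.
  move=> /(set_dist_lt A0)[s As ys].
  have -> : lsubmx y = s + (lsubmx y - s) by rewrite addrC subrK.
  apply: le_trans (ler_normD _ _) _; apply: lerD.
    by apply: HBA => //; rewrite (le_lt_trans (ler_norm _)) // ltrDl.
  exact/ltW/(le_lt_trans (norm_le_enorm _) ys).
have [BM [_ HBM]] : bounded_set (\bigcup_(x in [set x | `|x| <= B1]) M x).
  apply: hMlb; exists B1; split; first by rewrite num_real.
  by move=> r B1r x /= /le_trans; apply; exact: ltW.
pose B2 := `|BM| + 1 + (b1 + 1).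
have B10 : 0 < B1 by rewrite /B1; have := normr_ge0 BA; lra.
have B20 : 0 < B2 by rewrite /B2; have := normr_ge0 BM; lra.
exists (B1 + B2); first exact: addr_gt0.
move=> y Yy Ec; have Ege := composite_ge Yy.
have a3 : 0 <= lam * alpha3 (dA y) by rewrite mulr_ge0 ?Kinf_ge0 // ltW.
have a1 : 0 <= th * alpha1 (dM y) by rewrite mulr_ge0 ?Kinf_ge0 // ltW.
have dAb : dA y < b3.
  apply: (Kinf_lt_inv halpha3 b30); apply: le_lt_trans Hb3.
  by rewrite ler_pdivlMr // mulrC; lra.
have dMb : dM y < b1.
  apply: (Kinf_lt_inv halpha1 b10); apply: le_lt_trans Hb1.
  by rewrite ler_pdivlMr // mulrC; lra.
have xb : `|lsubmx y| <= B1 by apply: xB; lra.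
split; last by rewrite /B2; have := normr_ge0 BM; lra.
rewrite -[y]hsubmxK; apply: le_trans (norm_row_mx _ _) _.
rewrite ge_max; apply/andP; split; first lra.
apply: (@le_trans _ _ B2); last lra.
have [s Ms ys] := set_dist_lt (M0 (lsubmx y)) dMb.
have -> : rsubmx y = s + (rsubmx y - s) by rewrite addrC subrK.
apply: le_trans (ler_normD _ _) _; apply: lerD.
  apply: HBM; first by rewrite (le_lt_trans (ler_norm _)) // ltrDl.
  by exists (lsubmx y).
by apply/ltW; apply: le_lt_trans (norm_le_enorm _) _; lra.
Qed.

(** If x is in A then z is not in M(x), and |z|_M(x) is bounded below near the
    point by outer semicontinuity; otherwise |x|_A is, because A is closed. *)
Lemma joint_set_dist_near y : ~ At y ->
  exists2 e, 0 < e & \forall y' \near y, e <= dA y' \/ e <= dM y'.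
Proof.
move=> nAt; have [Ay|nAy] := pselect (A (lsubmx y)).
  have [|e e0 He] := @osc_set_dist_near_gt0 _ _ _ _ y hMosc M0.
    by move=> My; apply: nAt.
  by exists e => //; apply: filterS He; right.
have [e e0 He] := set_dist_near_gt0 closedA A0 nAy.
exists e => //; have /nbhs_ballP[r /= r0 Hr] := He.
apply/nbhs_ballP; exists r => // y'; rewrite -ball_normE /ball_ /= => yy'.
left; apply: Hr; rewrite -ball_normE /ball_ /= -linearB.
exact: le_lt_trans (norm_lsubmx _) yy'.
Qed.

(** Sublevel sets being bounded, it suffices to bound E from below on a closed
    ball deprived of the open neighbourhood of the target, which is compact;
    near each of its points one of the two distances is bounded below. *)
Lemma composite_small_inflate e : 0 < e -> exists2 c, 0 < c &
  forall y, Y y -> E y < c -> inflate At e y.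
Proof.
move=> e0; have [B B0 HB] := composite_sublevel_bounded 1.
pose K := [set y : 'rV[R]_(n1 + n2) | `|y| <= B] `&` ~` inflate At e.
have cK : compact K.
  apply: (@compact_closed_bounded _ _ _ B) => [|y []//].
  apply: closedI; first exact: closed_norm_le.
  exact/open_closedC/open_inflate.
have [|k k0 Hk] := compact_uniform_pos (P := fun k y => Y y -> k <= E y) cK.
  move=> y [_ nin].
  have [|eta eta0 Heta] := @joint_set_dist_near y.
    by move=> Aty; apply: nin; apply/(inflateP _ _ e0); exists y;
      rewrite // subrr /enorm dot0r sqrtr0.
  pose mm := Num.min (lam * alpha3 eta) (th * alpha1 eta).
  have mm0 : 0 < mm by rewrite lt_min !mulr_gt0 ?Kinf_gt0.
  near=> y' k; move=> /= Yy'.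
  apply: le_trans (composite_ge Yy').
  have : eta <= dA y' \/ eta <= dM y' by near: y'.
  have : k <= mm by near: k; exact: nbhs_right_le.
  have a3 : 0 <= lam * alpha3 (dA y') by rewrite mulr_ge0 ?Kinf_ge0 // ltW.
  have a1 : 0 <= th * alpha1 (dM y') by rewrite mulr_ge0 ?Kinf_ge0 // ltW.
  rewrite le_min => /andP[k3 k1] [h|h].
    have h3 := Kinf_le halpha3 (ltW eta0) h.
    have : lam * alpha3 eta <= lam * alpha3 (dA y') by rewrite ler_wpM2l // ltW.
    lra.
  have h1 := Kinf_le halpha1 (ltW eta0) h.
  have : th * alpha1 eta <= th * alpha1 (dM y') by rewrite ler_wpM2l // ltW.
  lra.
exists (Num.min 1 k); first by rewrite lt_min ltr01.
move=> y Yy; rewrite lt_min => /andP[E1 Ek]; apply: contrapT => nin.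
have Ky : K y by split => //; have [] := HB y Yy (ltW E1).
by have := Hk y Ky Yy; rewrite leNgt Ek.
Unshelve. all: by end_near. Qed.

Lemma composite_sublevel_inflate c : exists2 e, 0 < e &
  forall y, Y y -> E y <= c -> inflate At e y.
Proof.
have [B B0 HB] := composite_sublevel_bounded c.
have [a Aa] := A0; have [b Mb] := M0 a.
pose s := row_mx a b.
have Ats : At s by rewrite /At /joint_set /= row_mxKl row_mxKr.
pose e := (n1 + n2)%:R * (B + `|s|) + 1.
have e0 : 0 < e by rewrite ltr_wpDl // mulr_ge0 // addr_ge0 // ltW.
exists e => // y Yy Ec; apply/(inflateP _ _ e0); exists s => //.
apply: le_lt_trans (enorm_le_norm _) _; rewrite ltr_pwDr // ler_wpM2l //.
by apply: le_trans (ler_normB _ _) _; rewrite lerD2r; have [] := HB y Yy Ec.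
Qed.

Lemma enorm_lsubmx (u : 'rV[R]_(n1 + n2)) : enorm (lsubmx u) <= enorm u.
Proof.
rewrite /enorm ler_wsqrtr // -[u in X in _ <= X]hsubmxK -{2}[u]hsubmxK.
rewrite dot_row_mx row_mxKl row_mxKr lerDl /dot.
by apply: sumr_ge0 => j _; rewrite -expr2 sqr_ge0.
Qed.

Let N : R := n2%:R.

(** If (r1, r2) is a point of the target near (x, z), then |z|_M(x) is at most
    |z - r2| + |r2|_M(x), and the second term is at most alpha(|x - r1|). The
    factor N compares the Euclidean norm with the supremum norm, for which the
    triangle inequality is used. *)
Lemma composite_dist_le y d : 0 < d -> Y y -> (eset_dist At y <= d%:E)%E ->
  E y <= lam * alpha4 (2 * d) + th * alpha2 (N * (3 * d + alpha (2 * d))).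
Proof.
move=> d0 Yy yd; have d2 : 0 < 2 * d by lra.
have [|r [Ar Mr] yr] := @eset_dist_lt _ _ At y (2 * d).
  by apply: le_lt_trans yd _; rewrite lte_fin; lra.
have xr : enorm (lsubmx y - lsubmx r) < 2 * d.
  by rewrite -linearB; exact: le_lt_trans (enorm_lsubmx _) yr.
have zr : `|rsubmx y - rsubmx r| < 2 * d.
  rewrite -linearB; apply: le_lt_trans (norm_rsubmx _) _.
  exact: le_lt_trans (norm_le_enorm _) yr.
have dAy : dA y <= 2 * d by apply: le_trans (set_dist_le _ Ar) (ltW xr).
have [|s Ms rs] := @eset_dist_lt _ _ (M (lsubmx y)) (rsubmx r) (alpha (2 * d) + d).
  apply: le_lt_trans (hMalpha _ Ar Mr) _; rewrite lte_fin ltr_pwDr //.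
  by apply: Kinf_le (ltW xr) => //; exact: enorm_ge0.
have dMy : dM y <= N * (3 * d + alpha (2 * d)).
  apply: le_trans (set_dist_le _ Ms) _; apply: le_trans (enorm_le_norm _) _.
  rewrite ler_wpM2l //.
  have -> : rsubmx y - s = (rsubmx y - rsubmx r) + (rsubmx r - s).
    by rewrite addrA subrK.
  apply: le_trans (ler_normD _ _) _.
  have := le_lt_trans (norm_le_enorm _) rs; lra.
apply: le_trans (composite_le Yy) _; apply: lerD.
  by rewrite (ler_wpM2l (ltW lam0)) //; apply: Kinf_le.
by rewrite (ler_wpM2l (ltW th0)) //; apply: Kinf_le.
Qed.

Lemma composite_start_small eta : 0 < eta -> exists2 d, 0 < d &
  forall y, Y y -> (eset_dist At y <= d%:E)%E -> E y < eta.
Proof.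
move=> eta0.
have [d4 d40 H4] := Kinf_small halpha4 (divr_gt0 (divr_gt0 eta0 lam0) (ltr0n _ 2)).
have [d2 d20 H2] := Kinf_small halpha2 (divr_gt0 (divr_gt0 eta0 th0) (ltr0n _ 2)).
have N1 : 0 < N + 1 by rewrite ltr_wpDl.
have q0 : 0 < d2 / (N + 1) / 2 by rewrite !divr_gt0.
have [da da0 Ha] := Kinf_small halpha q0.
pose d := Num.min (Num.min (d4 / 2) (da / 2)) (d2 / (N + 1) / 6).
have d0 : 0 < d by rewrite !lt_min !divr_gt0.
have dd4 : d <= d4 / 2 by rewrite !ge_min lexx.
have dda : d <= da / 2 by rewrite !ge_min lexx orbT.
have dd2 : d <= d2 / (N + 1) / 6 by rewrite !ge_min lexx !orbT.
exists d => // y Yy yd; apply: le_lt_trans (composite_dist_le d0 Yy yd) _.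
have h4 : alpha4 (2 * d) < eta / lam / 2 by apply: H4; lra.
have ha : alpha (2 * d) < d2 / (N + 1) / 2 by apply: Ha; lra.
have ha0 : 0 <= alpha (2 * d) by apply: Kinf_ge0 => //; lra.
have N0 : 0 <= N by rewrite /N.
have h2 : alpha2 (N * (3 * d + alpha (2 * d))) < eta / th / 2.
  apply: H2; first by rewrite mulr_ge0 //; lra.
  apply: (@le_trans _ _ ((N + 1) * (d2 / (N + 1)))); last first.
    by rewrite mulrCA divff ?mulr1 // gt_eqF.
  by apply: ler_pM => //; lra.
have := ltr_pM2l lam0 (alpha4 (2 * d)) (eta / lam / 2); rewrite h4.
have := ltr_pM2l th0 (alpha2 (N * (3 * d + alpha (2 * d)))) (eta / th / 2); rewrite h2.
have -> : th * (eta / th / 2) = eta / 2 by field; rewrite gt_eqF.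
have -> : lam * (eta / lam / 2) = eta / 2 by field; rewrite gt_eqF.
lra.
Qed.

Lemma composite_in_eq0 y : Y y -> At y -> E y <= 0.
Proof.
move=> Yy [Ay My]; apply: le_trans (composite_le Yy) _.
rewrite /dA /dM !set_dist_in //.
by have [-> _ _ _] := halpha4; have [-> _ _ _] := halpha2; rewrite !mulr0 addr0.
Qed.

Variables (C : set 'rV[R]_(n1 + n2)) (phiz : R -> R) (phix : 'rV[R]_n1 -> R).
Hypotheses (closedC : closed C) (CY : C `<=` Y).
Hypothesis Ec : continuous (E : 'rV[R]_(n1 + n2) -> R).
Hypothesis hphizc : {within `[0, +oo[, continuous phiz}.
Hypothesis hphiz : class_PD `[0, +oo[ [set 0] phiz.
Hypothesis hphixc : continuous (phix : 'rV[R]_n1 -> R^o).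
Hypothesis hphix : class_PD setT A phix.

(** The points of C with a <= E <= c form a compact set off the target. Near
    one of them, either phix is positive by continuity, or |z|_M(x) stays in
    some [e, B], where the continuous function phiz has a positive minimum. *)
Lemma dissipation_pos a c : 0 < a -> exists2 k, 0 < k &
  forall y, C y -> a <= E y -> E y <= c ->
    k <= phix (lsubmx y) ^+ 2 + phiz (dM y) ^+ 2.
Proof.
move=> a0; have [B B0 HB] := composite_sublevel_bounded c.
pose K := [set y : 'rV[R]_(n1 + n2) | `|y| <= B] `&`
  (C `&` ((E @^-1` [set x | a <= x]) `&` (E @^-1` [set x | x <= c]))).
have cK : compact K.
  apply: (@compact_closed_bounded _ _ _ B) => [|y []//].
  apply: closedI; first exact: closed_norm_le.
  apply: closedI => //; have /continuous_closedP Ecl := Ec.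
  apply: closedI.
    exact: (Ecl [set x | a <= x] (@closed_ge _ a)).
  exact: (Ecl [set x | x <= c] (@closed_le _ c)).
have [|k k0 Hk] := compact_uniform_pos (P := fun k y =>
    dM y <= B -> k <= phix (lsubmx y) ^+ 2 + phiz (dM y) ^+ 2) cK; last first.
  exists k => // y Cy ay yc.
  by have [yB dB] := HB y (CY Cy) yc; apply: Hk.
move=> y [_ [Cy [/= ay yc]]].
have nAt : ~ At y.
    by move=> /(composite_in_eq0 (CY Cy)); move: ay; rewrite /E; lra.
  have [Ay|nAy] := pselect (A (lsubmx y)).
    have [|e e0 He] := @osc_set_dist_near_gt0 _ _ _ _ y hMosc M0.
      by move=> My; apply: nAt.
    (* phiz attains its minimum on [e, B'], which is nonempty even if e
       exceeds the bound B on the distances *)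
    pose B' := Num.max B e.
    have eB' : e <= B' by rewrite le_max lexx orbT.
    have pc : {within `[e, B'], continuous phiz}.
      apply: continuous_subspaceW hphizc => x /=; rewrite !in_itv /= andbT.
      by move=> /andP[ex _]; exact: le_trans (ltW e0) ex.
    have [t teB Ht] := EVT_min eB' pc.
    have pt : 0 < phiz t.
      have t0 : 0 < t by move: teB; rewrite in_itv /= => /andP[et _]; exact: lt_le_trans et.
      have ti : [set` `[0, +oo[] t by rewrite /= in_itv /= andbT ltW.
      have [_] := hphiz ti; apply => /= t00; by rewrite t00 ltxx in t0.
    near=> y' k; move=> /= dMB.
    have ey' : e <= dM y' by near: y'.
    have k2 : k <= phiz t ^+ 2 by near: k; apply: nbhs_right_le; rewrite exprn_gt0.
    have pm : phiz t <= phiz (dM y') by apply: Ht; rewrite in_itv /= ey' le_max dMB.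
    apply: (le_trans k2); rewrite ler_wpDl ?sqr_ge0 //.
    by rewrite lerXn2r ?nnegrE ?(ltW pt) // (le_trans (ltW pt)).
  have [_ /(_ nAy) p0] := hphix (I : setT (lsubmx y)).
  have p20 : 0 < phix (lsubmx y) / 2 by rewrite divr_gt0.
  have Hx : \forall x \near lsubmx y, phix (lsubmx y) / 2 <= phix x.
    have F : Filter (nbhs (lsubmx y)) by exact: nbhs_filter.
    have := @hphixc (lsubmx y); move=> /cvgrPdist_le /(_ _ p20).
    apply: filterS => x.
    by rewrite ler_distlC => /andP[+ _]; lra.
  have Hy : \forall y' \near y, phix (lsubmx y) / 2 <= phix (lsubmx y').
    have /nbhs_ballP[r /= r0 Hr] := Hx.
    apply/nbhs_ballP; exists r => // y'; rewrite -ball_normE /ball_ /= => yy'.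
    apply: Hr; rewrite -ball_normE /ball_ /= -linearB.
    exact: le_lt_trans (norm_lsubmx _) yy'.
  near=> y' k; move=> /= _.
  have h : phix (lsubmx y) / 2 <= phix (lsubmx y') by near: y'.
  have k2 : k <= (phix (lsubmx y) / 2) ^+ 2.
    by near: k; apply: nbhs_right_le; rewrite exprn_gt0.
  apply: (le_trans k2); rewrite ler_wpDr ?sqr_ge0 //.
  by rewrite lerXn2r ?nnegrE ?(ltW p20) // (le_trans (ltW p20)).
Unshelve. all: by end_near. Qed.

End composite_bounds.

(** * Slope of the composite function along flows *)

Section composite_slope.
Variables (R : realType) (n1 n2 m : nat) (S : sp_data R n1 n2 m).
Variables (M : 'rV[R]_n1 -> set 'rV[R]_n2) (A : set 'rV[R]_n1).
Variables (W : 'rV[R]_n1 -> 'rV[R]_n2 -> R) (V : 'rV[R]_n1 -> R).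
Hypotheses (hWlip : loc_lipschitz (joint W)) (hWreg : regular_fun (joint W)).
Hypotheses (hVlip : loc_lipschitz V) (hVreg : regular_fun V).
Variables (phiz : R -> R) (phix : 'rV[R]_n1 -> R).
Hypothesis hphiz : class_PD `[0, +oo[ [set 0] phiz.
Hypothesis hphix : class_PD setT A phix.
Variables kz kx k1 k2 k3 : R.
Hypotheses (hkz : 0 < kz) (hkx : 0 < kx) (hk2 : 0 < k2) (hk3 : 0 < k3).
Hypothesis h_ii : forall x z fz, sp_Cx S x -> sp_Cz S z -> sp_Fz S x z fz ->
  (clarke_max (W x) z fz <= (- kz * phiz (set_dist (M x) z) ^+ 2)%:E)%E.
Hypothesis h_iv : forall x fx, sp_Cx S x -> reduced_flow S M x fx ->
  (clarke_max V x fx <= (- kx * phix x ^+ 2)%:E)%E.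
Hypothesis h_v : forall x z fx, sp_Cx S x -> sp_Cz S z -> sp_Fx S x z fx ->
  (clarke_max (W ^~ z) x fx <=
   (k1 * phiz (set_dist (M x) z) * phix x + k2 * phiz (set_dist (M x) z) ^+ 2)%:E)%E.
Hypothesis h_vi : forall x z fx, sp_Cx S x -> sp_Cz S z -> sp_Fx S x z fx ->
  exists2 fx', reduced_flow S M x fx' &
  (clarke_max V x (fx - fx') <= (k3 * phiz (set_dist (M x) z) * phix x)%:E)%E.
Variables lam th : R.
Hypotheses (lam0 : 0 < lam) (th0 : 0 < th) (balance : lam * k3 = th * k1).

Lemma phiz_ge0 s : 0 <= s -> 0 <= phiz s.
Proof.
move=> s0; have si : [set` `[0, +oo[] s by rewrite /= in_itv /= andbT.
have [h1 h2] := hphiz si; have [/h1 ->//|/h2 /ltW//] := pselect ([set 0] s).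
Qed.

Lemma phix_ge0 x : 0 <= phix x.
Proof.
have [h1 h2] := hphix (I : setT x).
by have [/h1 ->//|/h2 /ltW//] := pselect (A x).
Qed.

(** With a = phix(x) and b = phiz(|z|_M(x)), the slope of E is at most - p a^2
    + 2 mm a b - th (kz / eps - k2) b^2, where p = lam kx and where mm = lam
    k3 = th k1 is the weight of each cross term. As 2 mm a b <= (p / 2) a^2 +
    (2 mm^2 / p) b^2, it suffices that th (kz / eps - k2) be at least s = 2
    mm^2 / p + p / 2. *)
Lemma composite_slope : exists epsstar c0, [/\ 0 < epsstar, 0 < c0 &
  forall eps, 0 < eps -> eps < epsstar ->
  forall (c : R -> 'rV[R]_(n1 + n2)) t u,
    sp_C S (c t) -> sp_flow S eps (c t) u -> expands_at c t u ->
    slope_le (fun s => lam * V (lsubmx (c s)) + th * W (lsubmx (c s)) (rsubmx (c s)))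
      (- (c0 * (phix (lsubmx (c t)) ^+ 2 +
         phiz (set_dist (M (lsubmx (c t))) (rsubmx (c t))) ^+ 2))) t].
Proof.
pose mm := lam * k3; pose p := lam * kx; pose s := 2 * mm ^+ 2 / p + p / 2.
have p0 : 0 < p by rewrite mulr_gt0.
have s0 : 0 < s by rewrite ltr_wpDl ?divr_gt0 // divr_ge0 ?mulr_ge0 ?sqr_ge0 // ltW.
have K0 : 0 < k2 + s / th by rewrite addr_gt0 // divr_gt0.
exists (kz / (k2 + s / th)), (p / 2); split; [by rewrite divr_gt0..|].
move=> eps eps0 epsK c t u [Cx Cz] [Fx [fz Fz ufz]] cu.
set x := lsubmx (c t) in Cx Fx Fz *; set z := rsubmx (c t) in Cz Fx Fz *.
pose a := phix x; pose b := phiz (set_dist (M x) z).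
have a0 : 0 <= a by exact: phix_ge0.
have b0 : 0 <= b by apply: phiz_ge0; exact: set_dist_ge0.
have sV : slope_le (V \o (fun s => lsubmx (c s))) (- kx * a ^+ 2 + k3 * b * a) t.
  apply: (clarke_slope_le hVlip hVreg (expands_lsubmx cu)) => v cv.
  have [fx' Fx' dfx] := h_vi Cx Cz Fx.
  have -> : lsubmx u = fx' + (lsubmx u - fx') by rewrite addrC subrK.
  rewrite dotDr; apply: lerD; first exact: clarke_max_le (h_iv Cx Fx') cv.
  exact: clarke_max_le dfx cv.
have sW : slope_le (joint W \o c)
    (k1 * b * a + k2 * b ^+ 2 + eps^-1 * (- kz * b ^+ 2)) t.
  apply: (clarke_slope_le hWlip hWreg cu) => v.
  rewrite -[c t]hsubmxK => /(clarke_split hWreg)[cx cz].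
  rewrite -[u]hsubmxK dot_row_mx -ufz dotZr; apply: lerD.
    exact: clarke_max_le (h_v Cx Cz Fx) cx.
  rewrite ler_pM2l ?invr_gt0 //; exact: clarke_max_le (h_ii Cx Cz Fz) cz.
apply: slope_leW (slope_le_lin (ltW lam0) (ltW th0) sV sW).
have epsK' : k2 + s / th <= kz / eps.
  rewrite ler_pdivlMr // mulrC -ler_pdivlMr //; exact: ltW.
have sle : s <= th * (kz / eps - k2).
  by rewrite mulrC -ler_pdivrMr // lerBrDl.
have am : 2 * mm * (a * b) <= p / 2 * a ^+ 2 + 2 * mm ^+ 2 / p * b ^+ 2.
  have h := sqr_ge0 (p * a - 2 * mm * b).
  rewrite -subr_ge0.
  have -> : p / 2 * a ^+ 2 + 2 * mm ^+ 2 / p * b ^+ 2 - 2 * mm * (a * b) =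
    (p * a - 2 * mm * b) ^+ 2 / (2 * p) by field; rewrite gt_eqF.
  by rewrite divr_ge0 // mulr_ge0 // ltW.
have sb : s * b ^+ 2 <= th * (kz / eps - k2) * b ^+ 2.
  by rewrite ler_wpM2r ?sqr_ge0.
have E1 : lam * (- kx * a ^+ 2 + k3 * b * a) +
   th * (k1 * b * a + k2 * b ^+ 2 + eps^-1 * (- kz * b ^+ 2)) =
   - p * a ^+ 2 + 2 * mm * (a * b) - th * (kz / eps - k2) * b ^+ 2.
  have -> : 2 * mm * (a * b) = lam * k3 * (a * b) + th * k1 * (a * b).
    by rewrite -balance /mm; ring.
  by rewrite /p; ring.
rewrite E1; have s2 : s * b ^+ 2 = 2 * mm ^+ 2 / p * b ^+ 2 + p / 2 * b ^+ 2.
  by rewrite /s mulrDl.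
by rewrite -/a -/b; lra.
Qed.

End composite_slope.

(** * Solution arcs *)

Section time_domain.
Variables (R : realType) (E : set (R * nat)).
Hypothesis hE : hybrid_time_domain E.

Lemma htd_between s t u j : E (s, j) -> E (t, j) -> s <= u -> u <= t -> E (u, j).
Proof.
have [T [T0 Tm] [->|[J [b [Jb ->]]]]] := hE => /=.
  by move=> /andP[? _] /andP[_ ?] ? ?; apply/andP; split; lra.
move=> [[jJ /andP[s1 s2]]|[-> sI]] [[jJ' /andP[t1 t2]]|[e tI]] su ut.
- by left; split=> //; lra.
- by rewrite e ltnn in jJ.
- by rewrite ltnn in jJ'.
- by right; split => //; apply: (@interval_is_interval _ _ s t) => //; apply/andP.
Qed.

Lemma htd_start t : E (t, 0%N) -> 0 <= t.
Proof.
have [T [T0 Tm] [->|[J [b [Jb ->]]]]] := hE => /=.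
  by rewrite T0 => /andP[].
move=> [[_]|[<-]]; first by rewrite T0 => /andP[].
by rewrite itv_boundlr => /andP[]; rewrite T0 bnd_simp.
Qed.

(** The time of the jump from index j to j + 1 is the last time of index j and
    the first time of index j + 1. *)
Lemma htd_jump t j : E (t, j.+1) -> exists T, [/\ E (T, j), E (T, j.+1),
  forall s, E (s, j) -> s <= T & forall s, E (s, j.+1) -> T <= s].
Proof.
have [T [T0 Tm] [->|[J [b [Jb ->]]]]] := hE => /=.
  move=> _; exists (T j.+1); split => [|||s /andP[]//].
  - by rewrite Tm lexx.
  - by rewrite lexx Tm.
  - by move=> s /andP[].
move=> H; have jJ : (j < J)%N.
  by case: H => [[/ltnW]|[<- _]].
exists (T j.+1); split.
- by left; rewrite Tm lexx.
- have [e|ne] := eqVneq j.+1 J.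
    right; split => //; rewrite -e itv_boundlr lexx /=.
    by move: Jb; rewrite -e; case: b H => [[] c|[]] //=; rewrite !bnd_simp.
  by left; rewrite lexx Tm ltn_neqAle ne.
- move=> s [[_ /andP[]//]|[e]]; first by rewrite e ltnn in jJ.
- move=> s [[_ /andP[]//]|[e]].
  by rewrite -e itv_boundlr => /andP[]; rewrite bnd_simp.
Qed.

Lemma htd_ge0 t j : E (t, j) -> 0 <= t.
Proof.
elim: j t => [|j IH] t Et; first exact: htd_start Et.
by have [T [ET _ _ Tmin]] := htd_jump Et; exact: le_trans (IH _ ET) (Tmin _ Et).
Qed.

End time_domain.

(** The conditions that a random solution imposes on a single sample path,
    with input sequence u. *)
Definition solution_arc (R : realType) (n m : nat) (H : shs R n m)
    (u : nat -> 'rV[R]_m) (y0 : 'rV[R]_n) (a : harc R n) : Prop :=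
  [/\ hybrid_arc a, closed (arc_graph a), arc_dom a (0, 0%N) /\ a 0 0%N = y0,
      forall j t1 t2, arc_dom a (t1, j) -> arc_dom a (t2, j) -> t1 < t2 ->
        {ae lebesgue_measure, forall t : R, t1 <= t <= t2 ->
          flow_set H (a t j) /\
          exists2 f, is_derive t 1 (a ^~ j) f & flow_map H (a t j) f} &
      forall t j, arc_dom a (t, j) -> arc_dom a (t, j.+1) ->
        jump_set H (a t j) /\ jump_map H (a t j) (u j) (a t j.+1)].

Lemma ae_ex (R : realType) (P : R -> Prop) (a b : R) : a < b ->
  {ae lebesgue_measure, forall t : R, P t} -> exists2 t, a < t < b & P t.
Proof.
move=> ab [N [mN N0 PN]]; apply: contrapT => nex.
have sub : `]a, b[%classic `<=` N.
  move=> x /=; rewrite in_itv /= => xab; apply: PN => Px.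
  by apply: nex; exists x.
have : (lebesgue_measure `]a, b[%classic <= lebesgue_measure N)%E.
  by apply: le_measure; rewrite ?inE.
have -> : lebesgue_measure N = 0%E by exact: N0.
by rewrite lebesgue_measure_itv /= lte_fin ab -EFinB lee_fin leNgt subr_gt0 ab.
Qed.

Section arc.
Variables (R : realType) (n m : nat) (H : shs R n m) (u : nat -> 'rV[R]_m).
Variables (y0 : 'rV[R]_n) (a : harc R n).
Hypothesis ha : solution_arc H u y0 a.

Lemma arc_near_continuous s t j r e : s <= r <= t -> s < t ->
  arc_dom a (s, j) -> arc_dom a (t, j) -> 0 < e ->
  exists2 d, 0 < d & forall x, s <= x <= t -> `|x - r| < d ->
    `|a x j - a r j| < e.
Proof.
have [[hd hac] _ _ _ _] := ha.
move=> rst st ds dt e0.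
apply: (abs_continuous_near (hac j s t st _) rst e0) => x /andP[sx xt].
exact: (htd_between hd ds dt).
Qed.

(** The flow condition holds at almost every time only; it extends to all
    times since the complement of a null set is dense, the arc is continuous
    and the flow set closed. *)
Lemma arc_in_flow_set s t j r : closed (flow_set H) ->
  arc_dom a (s, j) -> arc_dom a (t, j) -> s < t -> s <= r <= t ->
  flow_set H (a r j).
Proof.
move=> cC ds dt st rst; apply: contrapT => nC.
have /nbhs_ballP[e /= e0 He] : nbhs (a r j) (~` flow_set H).
  by apply: open_nbhs_nbhs; split => //; exact: closed_openC.
have [d d0 Hd] := arc_near_continuous rst st ds dt e0.
have [_ _ _ hfl _] := ha.
have [|x xab] := ae_ex (a := Num.max s (r - d)) (b := Num.min t (r + d)) _ (hfl j s t ds dt st).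
  by rewrite gt_max !lt_min st /=; move: rst => /andP[sr rt]; lra.
move: xab; rewrite gt_max lt_min => /andP[/andP[x1 x2] /andP[x3 x4]].
have xst : s <= x <= t by rewrite !ltW.
move=> /(_ xst)[Cx _]; apply: (He (a x j)) => //.
rewrite -ball_normE /ball_ /= distrC; apply: Hd => //.
by rewrite ltr_distl x2.
Qed.

Variables (E : 'rV[R]_n -> R) (sig : 'rV[R]_n -> R).
Hypotheses (cC : closed (flow_set H)) (lE : locally_lip E).
Hypothesis sig0 : forall y, 0 <= sig y.
Hypothesis Eslope : forall (c : R -> 'rV[R]_n) t f,
  flow_set H (c t) -> flow_map H (c t) f -> expands_at c t f ->
  slope_le (E \o c) (- sig (c t)) t.

Let flow_slope s t j q : arc_dom a (s, j) -> arc_dom a (t, j) -> s <= t ->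
  (forall r, s <= r <= t -> flow_set H (a r j) -> q <= sig (a r j)) ->
  E (a t j) <= E (a s j) - q * (t - s).
Proof.
move=> ds dt; rewrite le_eqVlt => /orP[/eqP -> _|st hq].
  by rewrite subrr mulr0 subr0.
have [[hd hac] _ _ hfl _] := ha.
have acst : abs_continuous (a ^~ j) s t.
  by apply: hac => // x /andP[sx xt]; exact: (htd_between hd ds dt).
have := @flow_decrease _ _ E (a ^~ j) s t (- q) (ltW st) lE acst.
suff ae : {ae lebesgue_measure, forall r : R, s <= r <= t ->
    slope_le (E \o a ^~ j) (- q) r} by move=> /(_ ae); lra.
have [N [mN N0 aeN]] := hfl j s t ds dt st; exists N; split => // x nx.
apply: aeN => Hx; apply: nx => xst; have [Cx [f df Ff]] := Hx xst.
apply: (@slope_leW _ _ (- sig (a x j))); first by rewrite lerN2 hq.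
exact: (Eslope (c := a ^~ j) Cx Ff (is_derive_expands df)).
Qed.

Lemma arc_flow_le s t j : arc_dom a (s, j) -> arc_dom a (t, j) -> s <= t ->
  E (a t j) <= E (a s j).
Proof.
move=> ds dt st; have := flow_slope (q := 0) ds dt st.
by rewrite mul0r subr0; apply => r _ _; exact: sig0.
Qed.

Lemma arc_flow_slope k lo hi s t j :
  (forall y, flow_set H y -> lo <= E y -> E y <= hi -> k <= sig y) ->
  arc_dom a (s, j) -> arc_dom a (t, j) -> s <= t ->
  lo <= E (a t j) -> E (a s j) <= hi -> E (a t j) <= E (a s j) - k * (t - s).
Proof.
move=> hk ds dt st lot his; apply: flow_slope => // r /andP[sr rt] Cr.
have [[hd _] _ _ _ _] := ha; have dr := htd_between hd ds dt sr rt.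
apply: hk => //; first exact: le_trans lot (arc_flow_le dr dt rt).
exact: le_trans (arc_flow_le ds dr sr) his.
Qed.

(** A state of the arc is either in the flow set, when its flow interval is
    not reduced to a point, or the initial state, or a state right after a
    jump. The bounds on V and W are assumed on exactly these states. *)
Lemma arc_states t j : arc_dom a (t, j) -> (flow_set H `|` jump_set H) y0 ->
  (flow_set H `|` jump_set H `|` jump_image (jump_map H) (jump_set H) (range u)) (a t j).
Proof.
have [[hd _] _ [d0 a0] _ hj] := ha; move=> dt Y0.
case: j dt => [|j] dt.
  have := htd_start hd dt; rewrite le_eqVlt => /orP[/eqP <-|t0].
    by left; rewrite a0.
  by left; left; apply: (arc_in_flow_set cC d0 dt t0); rewrite lexx ltW.
have [T [dT dT' _ Tmin]] := htd_jump hd dt.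
have := Tmin _ dt; rewrite le_eqVlt => /orP[/eqP <-|Tt].
  have [DT GT] := hj _ _ dT dT'; right; exists (a T j) => //.
  by exists (u j) => //; exists j.
by left; left; apply: (arc_in_flow_set cC dT' dt Tt); rewrite lexx ltW.
Qed.

End arc.

(** * Measurability of the events of an arc *)

Section hits.
Variables (R : realType) (d : measure_display) (T : measurableType d).
Variables (U : pseudoMetricType R) (Phi : T -> set U).
Hypothesis cPhi : forall w, closed (Phi w).
Hypothesis mPhi : sv_measurable (measurable : set (set T)) Phi.

(** A closed set that misses the compact K misses a neighbourhood of K of
    positive radius; hence Phi w meets K if and only if it meets each of the
    open neighbourhoods of radius 1 / (k + 1). *)
Lemma measurable_hit_compact (K : set U) : compact K ->
  measurable [set w | Phi w `&` K !=set0].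
Proof.
move=> cK.
pose O k := \bigcup_(x in K) (ball x (k.+1%:R^-1 : R))^°.
have -> : [set w | Phi w `&` K !=set0] =
    \bigcap_k [set w | Phi w `&` O k !=set0].
  apply/seteqP; split=> w /=.
    move=> [x [Px Kx]] k _; exists x; split => //; exists x => //.
    by apply: nbhsx_ballx; rewrite invr_gt0.
  move=> HO; apply: contrapT => nK.
  have [|e e0 He] := compact_uniform_pos
      (P := fun e x => ball x (e : R) `<=` ~` Phi w) cK.
    move=> x Kx; have : nbhs x (~` Phi w).
      apply: open_nbhs_nbhs; split; first exact: closed_openC.
      by move=> Px; apply: nK; exists x.
    move=> /nbhs_ballP[r /= r0 Hr].
    have r20 : 0 < r / 2 by rewrite divr_gt0.
    near=> x' e => /= z x'z; apply: Hr.
    apply: (@ball_split _ _ x'); first by near: x'; exact: nbhsx_ballx.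
    apply: le_ball x'z; near: e; exact: nbhs_right_le.
  have [k ke] := inv_succ_lt e0.
  have [z [Pz [x Kx /interior_subset xz]]] := HO k I.
  by apply: (He x Kx z) => //; apply: le_ball xz; exact: ltW.
apply: bigcapT_measurable => k; apply: mPhi.
by apply: bigcup_open => x _; exact: open_interior.
Unshelve. all: by end_near. Qed.

End hits.

Lemma natr_ge_ex (R : realType) (x : R) : exists k : nat, x <= k%:R.
Proof.
exists (Num.truncn `|x|).+1; apply: le_trans (ler_norm _) _.
exact/ltW/truncnS_gt.
Qed.

Definition box (R : realType) (n : nat) (k : nat) : set (R * 'rV[R]_n) :=
  `[(- k%:R), k%:R]%classic `*` [set y | `|y| <= k%:R].

Lemma compact_box (R : realType) (n : nat) k : compact (@box R n k).
Proof.
apply: compact_setX; first exact: segment_compact.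
by apply: (@compact_closed_bounded _ _ _ k%:R) => //; exact: closed_norm_le.
Qed.

Lemma bigcup_box (R : realType) (n : nat) : \bigcup_k @box R n k = setT.
Proof.
rewrite -subTset => -[t y] _.
have [k tk] := natr_ge_ex (Num.max `|t| `|y|).
exists k => //; move: tk; rewrite ge_max => /andP[tk yk].
by split => //=; rewrite in_itv /= -ler_norml.
Qed.

(** The samples whose arc meets F during its flow interval of index j. *)
Definition visits (R : realType) (n : nat) (T : Type) (y : T -> harc R n) (j : nat)
    (F : set (R * 'rV[R]_n)) : set T :=
  [set w | exists2 t, arc_dom (y w) (t, j) & F (t, y w t j)].

Definition last_time (R : realType) (n : nat) (a : harc R n) (j : nat) (t : R) : Prop :=
  arc_dom a (t, j) /\ forall s, arc_dom a (s, j) -> s <= t.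

(** The last time of the flow interval of index j, with the state at that
    time: the state from which a jump may occur. It is (0, 0) when the
    interval has no last point. *)
Definition endpoint (R : realType) (n : nat) (a : harc R n) (j : nat)
    : R * 'rV[R]_n :=
  if pselect (exists t, last_time a j t) is left _
  then let t := xget 0 (last_time a j) in (t, a t j) else (0, 0).

Lemma endpointE (R : realType) (n : nat) (a : harc R n) (j : nat) t :
  last_time a j t -> endpoint a j = (t, a t j).
Proof.
move=> lt; rewrite /endpoint; case: pselect => [h|[]]; last by exists t.
have := xgetPex 0 h; set s := xget _ _ => -[ds smax].
have [dt tmax] := lt.
by have -> : s = t by apply/le_anti; rewrite tmax // smax.
Qed.

Lemma endpoint0 (R : realType) (n : nat) (a : harc R n) (j : nat) :
  ~ (exists t, last_time a j t) -> endpoint a j = (0, 0).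
Proof. by rewrite /endpoint; case: pselect. Qed.

Lemma continuous_pair (X U V : topologicalType) (f : X -> U) (g : X -> V) :
  continuous f -> continuous g -> continuous (fun x => (f x, g x)).
Proof.
move=> cf cg x.
exact: (@cvg_pair _ _ _ (nbhs x) (nbhs (f x)) (nbhs (g x)) _ _ _ f g (cf x) (cg x)).
Qed.

Section level.
Variables (R : realType) (n : nat) (d : measure_display) (T : measurableType d).
Variables (y : T -> harc R n) (l : nat).
Hypothesis cy : forall w, closed (arc_graph (y w)).
Hypothesis my : sv_measurable (measurable : set (set T))
  (fun w => arc_graph (y w) `&` [set q | (q.1.2 <= l)%N]).

Let Phi w := arc_graph (y w) `&` [set q | (q.1.2 <= l)%N].

Let proj (q : R * nat * 'rV[R]_n) : R * 'rV[R]_n := (q.1.1, q.2).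

Let time_cts : continuous (fun q : R * nat * 'rV[R]_n => q.1.1).
Proof.
by move=> q; apply: (@continuous_comp _ _ _ (@fst (R * nat)%type _) fst); exact: cvg_fst.
Qed.

Let idx_cts : continuous (fun q : R * nat * 'rV[R]_n => q.1.2).
Proof.
by move=> q; apply: (@continuous_comp _ _ _ (@fst (R * nat)%type _) snd);
  [exact: cvg_fst|exact: cvg_snd].
Qed.

Let proj_cts : continuous proj.
Proof. by apply: continuous_pair; [exact: time_cts|move=> q; exact: cvg_snd]. Qed.

Let slice j (F : set (R * 'rV[R]_n)) : set (R * nat * 'rV[R]_n) :=
  (fun q => q.1.2) @^-1` [set j] `&` proj @^-1` F.

Let slice_open j F : open F -> open (slice j F).
Proof.
move=> oF; apply: openI.
  by have /continuousP c := idx_cts; exact: (c [set j] (discrete_open _)).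
by have /continuousP c := proj_cts; exact: (c F oF).
Qed.

Let slice_compact j F : compact F -> compact (slice j F).
Proof.
move=> cF.
have -> : slice j F = (fun p : R * 'rV[R]_n => ((p.1, j), p.2)) @` F.
  apply/seteqP; split.
    by move=> [[t i] x] [/= -> Fx]; exists (t, x).
  by move=> _ [[t x] Fx <-].
apply: continuous_compact => //; apply: continuous_subspaceT.
apply: continuous_pair; last by move=> p; exact: cvg_snd.
by apply: continuous_pair; [move=> p; exact: cvg_fst|exact: cst_continuous].
Qed.

Let visitsE j F : (j <= l)%N -> visits y j F = [set w | Phi w `&` slice j F !=set0].
Proof.
move=> jl; apply/seteqP; split=> w /=.
  by move=> [t dt Ft]; exists ((t, j), y w t j); split.
by move=> [[[t i] x] [[[/= dt ->] _] [/= <- Fx]]]; exists t.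
Qed.

Let closedPhi w : closed (Phi w).
Proof.
apply: closedI => //.
have /continuous_closedP c := idx_cts.
exact: (c [set j | (j <= l)%N] (discrete_closed _)).
Qed.

Lemma measurable_visits_open j F : (j <= l)%N -> open F -> measurable (visits y j F).
Proof. by move=> jl oF; rewrite visitsE //; apply: my; exact: slice_open. Qed.

Lemma measurable_visits_closed j F : (j <= l)%N -> closed F ->
  measurable (visits y j F).
Proof.
move=> jl cF; rewrite visitsE //.
have -> : [set w | Phi w `&` slice j F !=set0] =
   \bigcup_k [set w | Phi w `&` slice j (box k `&` F) !=set0].
  apply/seteqP; split=> w /=.
    move=> [q [Pq [qj Fq]]].
    have [k _ Kq] : (\bigcup_k @box R n k) (proj q) by rewrite bigcup_box.
    by exists k => //; exists q.
  by move=> [k _ [q [Pq [qj [_ Fq]]]]]; exists q.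
apply: bigcupT_measurable => k; apply: (measurable_hit_compact closedPhi my).
by apply: slice_compact; apply: compact_closedI => //; exact: compact_box.
Qed.

(** Among the times at which the arc is in F there is a largest one. It is the
    last time of the interval if and only if, for all rational q, an arc that
    has a point after q has a point in F after q. *)
Lemma measurable_last_compact j F : (j <= l)%N -> compact F ->
  measurable [set w | exists2 t, last_time (y w) j t & F (t, y w t j)].
Proof.
move=> jl cF.
pose ge (q : rat) : set (R * 'rV[R]_n) := fst @^-1` [set t | ratr q <= t].
pose gt (q : rat) : set (R * 'rV[R]_n) := fst @^-1` [set t | ratr q < t].
have clF : closed F by exact: (compact_closed (@norm_hausdorff _ _)).
have cge q : closed (ge q).
  have /continuous_closedP c : continuous (@fst R 'rV[R]_n) by move=> p; exact: cvg_fst.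
  exact: (c _ (@closed_ge _ _)).
have ogt q : open (gt q).
  have /continuousP c : continuous (@fst R 'rV[R]_n) by move=> p; exact: cvg_fst.
  exact: (c _ (@open_gt _ _)).
have -> : [set w | exists2 t, last_time (y w) j t & F (t, y w t j)] =
  visits y j F `&` ~` \bigcup_q (visits y j (gt q) `&` ~` visits y j (F `&` ge q)).
  apply/seteqP; split=> w /=.
    move=> [t [dt tmax] Ft]; split; first by exists t.
    move=> [q _ [[s ds /= qs] nm]]; apply: nm; exists t => //; split => //=.
    by apply/ltW/(lt_le_trans qs)/tmax.
  move=> [[t0 dt0 Ft0] nU].
  (* the largest time t at which the arc is in F; a later time s would be
     separated from t by a rational *)
  pose X := arc_graph (y w) `&` slice j F.
  have cX : compact X by rewrite /X setIC; apply: compact_closedI => //; exact: slice_compact.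
  have X0 : X !=set0 by exists ((t0, j), y w t0 j); split.
  have [|[[t i] x] + Xmax] := compact_EVT_max (f := fun q : R * nat * 'rV[R]_n => q.1.1) X0 cX.
    exact/continuous_subspaceT/time_cts.
  rewrite inE => -[[/= dt ->] [/= ij Ft]]; rewrite ij in dt Ft.
  exists t => //; split => // s ds; rewrite leNgt; apply/negP => ts.
  have [q] := rat_in_itvoo ts; rewrite in_itv /= => /andP[tq qs].
  apply: nU; exists q => //; split; first by exists s.
  move=> [r dr [Fr /= qr]].
  have := Xmax ((r, j), y w r j); rewrite inE /= => /(_ (conj (conj dr erefl) (conj erefl Fr))).
  by rewrite leNgt (lt_le_trans tq qr).
apply: measurableI; first exact: measurable_visits_closed.
apply: measurableC; apply: bigcupT_measurable_rat => q.
apply: measurableI; first exact: measurable_visits_open.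
by apply: measurableC; apply: measurable_visits_closed => //; exact: closedI.
Qed.

Lemma measurable_last_closed j F : (j <= l)%N -> closed F ->
  measurable [set w | exists2 t, last_time (y w) j t & F (t, y w t j)].
Proof.
move=> jl cF.
have -> : [set w | exists2 t, last_time (y w) j t & F (t, y w t j)] =
  \bigcup_k [set w | exists2 t, last_time (y w) j t & (box k `&` F) (t, y w t j)].
  apply/seteqP; split=> w /=.
    move=> [t lt Ft].
    have [k _ Kq] : (\bigcup_k @box R n k) (t, y w t j) by rewrite bigcup_box.
    by exists k => //; exists t.
  by move=> [k _ [t lt [_ Ft]]]; exists t.
apply: bigcupT_measurable => k; apply: measurable_last_compact => //.
by apply: compact_closedI => //; exact: compact_box.
Qed.

Lemma measurable_live j : (j <= l)%N -> measurable [set w | exists t, last_time (y w) j t].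
Proof.
move=> jl; have := @measurable_last_closed j setT jl closedT.
congr (measurable _); apply/seteqP; split=> w /= [t]; first by exists t.
by move=> ?; exists t.
Qed.

Lemma measurable_endpoint j F : (j <= l)%N -> closed F ->
  measurable [set w | F (endpoint (y w) j)].
Proof.
move=> jl cF.
have -> : [set w | F (endpoint (y w) j)] =
  [set w | exists2 t, last_time (y w) j t & F (t, y w t j)] `|`
  (~` [set w | exists t, last_time (y w) j t] `&` [set w | F (0, 0)]).
  apply/seteqP; split=> w /=.
    have [[t lt]|nl] := pselect (exists t, last_time (y w) j t).
      by rewrite (endpointE lt) => Ft; left; exists t.
    by rewrite endpoint0 // => F0; right.
  move=> [[t lt Ft]|[nl F0]]; first by rewrite (endpointE lt).
  by rewrite endpoint0.
apply: measurableU; first exact: measurable_last_closed.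
apply: measurableI; first by apply: measurableC; exact: measurable_live.
have [F0|nF0] := pselect (F (0, 0)).
  by rewrite (_ : [set _ | _] = setT) //; apply/seteqP; split.
by rewrite (_ : [set _ | _] = set0) //; apply/seteqP; split.
Qed.

Lemma measurable_fun_endpoint j (phi : R * 'rV[R]_n -> R) : (j <= l)%N ->
  continuous phi -> measurable_fun setT (fun w => phi (endpoint (y w) j)).
Proof.
move=> jl /continuous_closedP cphi.
apply: (measurability _ (measurable_realfun.RGenCInfty.measurableE R)) => _ [_ [x ->] <-].
rewrite setTI; apply: (measurable_endpoint (F := phi @^-1` `[x, +oo[%classic)) => //.
by apply: cphi; rewrite set_itvE; exact: closed_ge.
Qed.

Lemma measurable_fun_endpoint_state j : (j <= l)%N ->
  measurable_fun setT (fun w => (endpoint (y w) j).2 : borel R n).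
Proof.
move=> jl.
have h := @measurability _ _ T (borel R n) setT (fun w => (endpoint (y w) j).2) (@open 'rV[R]_n) erefl.
apply: h => _ [B oB <-].
rewrite setTI -[X in measurable X]setCK; apply: measurableC.
apply: (measurable_endpoint (F := snd @^-1` ~` B)) => //.
have /continuous_closedP c : continuous (@snd R 'rV[R]_n) by move=> p; exact: cvg_snd.
exact: (c _ (open_closedC oB)).
Qed.

End level.

(** * Independence of the past and the next input *)

Definition noise_events (R : realType) (m : nat) (Om : Type)
    (v : nat -> Om -> 'rV[R]_m) (l : nat) : set (set Om) :=
  [set A | exists k (B : set (borel R m)),
     [/\ (k < l)%N, measurable B & A = v k @^-1` B]].

(** The samples with the sigma-algebra generated by the inputs of index less
    than l. *)
Notation history v l := (g_sigma_algebraType (noise_events v l)).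

Section freezing.
Variables (R : realType) (m : nat) (d : measure_display) (Om : measurableType d).
Variables (P : probability Om R) (mu : probability (borel R m) R).
Variable v : nat -> Om -> 'rV[R]_m.
Hypothesis hv : iid P mu v.

Let mv k (B : set (borel R m)) : measurable B -> measurable (v k @^-1` B).
Proof.
by have [h _ _] := hv => mB; rewrite -[X in measurable X]setTI; exact: h.
Qed.

Lemma noise_events_measurable l : noise_events v l `<=` measurable.
Proof. by move=> A [k [B [_ mB ->]]]; exact: mv. Qed.

Lemma history_measurable l (A : set Om) :
  measurable (A : set (history v l)) -> measurable A.
Proof.
apply: smallest_sub; first exact: sigma_algebra_measurable.
exact: noise_events_measurable.
Qed.

(** The cylinders over the inputs of index less than l form a pi-system that
    generates the history. On a cylinder the formula is the product rule, and
    two finite measures that agree on a pi-system agree on the sigma-algebra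
    that it generates. *)
Lemma history_independent l (A : set Om) (B : set (borel R m)) :
  measurable (A : set (history v l)) -> measurable B ->
  P (A `&` v l @^-1` B) = (P A * mu B)%E.
Proof.
move=> mA mB; have [_ hmu hprod] := hv.
pose cyl (C : nat -> set (borel R m)) := \bigcap_(k in [set` iota 0 l]) (v k @^-1` C k).
pose G := [set A | exists2 C, (forall k, measurable (C k)) & A = cyl C].
have mcyl C : (forall k, measurable (C k)) -> measurable (cyl C : set (history v l)).
  move=> mC; apply: fin_bigcap_measurable => // k /=; rewrite mem_iota add0n => kl.
  by apply: sub_sigma_algebra; exists k, (C k).
have muB0 : 0 <= fine (mu B) by exact: fine_ge0.
pose m1 := mrestr P (mv l mB).
pose m2 := mscale (NngNum muB0) P.
have GA : <<s G >> A.
  move: mA; apply: smallest_sub; first exact: smallest_sigma_algebra.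
  move=> _ [k [C [kl mC ->]]]; apply: sub_sigma_algebra.
  exists (fun i => if i == k then C else setT).
    by move=> i; case: ifP.
  apply/seteqP; split=> w /=.
    by move=> Cw i _ /=; case: eqP => // ->.
  by move=> /(_ k); rewrite /= eqxx; apply; rewrite mem_iota.
suff : m1 A = m2 A.
  by rewrite /m1 /m2 /mrestr /mscale /= => ->; rewrite fineK ?fin_num_measure // muleC.
apply: (@g_sigma_algebra_measure_unique _ R Om G _ (fun=> setT)) => //.
- by move=> _ [C mC ->]; apply: history_measurable; exact: mcyl.
- move=> _; exists (fun=> setT) => //.
  by apply/seteqP; split.
- by apply/seteqP; split => // x _; exists 0%N.
- move=> _ _ [C mC ->] [D mD ->]; exists (fun k => C k `&` D k).
    by move=> k; exact: measurableI.
  by rewrite /cyl -bigcapI.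
- move=> _ [C mC ->].
  rewrite [LHS](_ : _ = P (cyl C `&` v l @^-1` B)) //.
  rewrite [RHS](_ : _ = ((fine (mu B))%:E * P (cyl C))%E) // fineK ?fin_num_measure //.
  pose D k := if k == l then B else C k.
  have mD k : measurable (D k) by rewrite /D; case: ifP.
  have inl k : k \in iota 0 l -> D k = C k.
    by rewrite mem_iota add0n /D => kl; rewrite ltn_eqF.
  have ul : uniq (l :: iota 0 l) by rewrite /= iota_uniq mem_iota ltnn andbF.
  have := hprod _ _ ul mD; rewrite big_cons /D eqxx hmu // -/D.
  have -> : (\prod_(k <- iota 0 l) P (v k @^-1` (if k == l then B else C k)) =
     \prod_(k <- iota 0 l) P (v k @^-1` C k))%E.
    rewrite !big_seq; apply: eq_bigr => k kl.
    by have := inl _ kl; rewrite /D => ->.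
  rewrite -(hprod _ _ (iota_uniq 0 l) mC) => <-; congr (P _).
  apply/seteqP; split=> w /=.
    move=> [Cw Bw] k /=; rewrite inE => /orP[/eqP ->|kl]; first by rewrite eqxx.
    by have := inl _ kl; rewrite /D => ->; exact: Cw.
  move=> H; split.
    move=> k kl; have := H k; rewrite /= inE kl orbT => /(_ isT).
    by have := inl _ kl; rewrite /D => ->.
  by have := H l; rewrite /= inE eqxx; exact.
- move=> _; rewrite [ltLHS](_ : _ = P (setT `&` v l @^-1` B)) // setTI hmu //.
  exact: le_lt_trans (probability_le1 _ mB) (ltry _).
Qed.

(** The joint law of the past and of the next input is a product measure, by
    independence, so this is Tonelli's theorem. *)
Lemma freezing l (f : history v l * borel R m -> \bar R) :
  measurable_fun setT f -> (forall p, (0 <= f p)%E) ->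
  (\int[P]_w f (w, v l w) = \int[P]_w \int[mu]_u f (w, u))%E.
Proof.
move=> mf f0; have [mvl hmu _] := hv.
have midl : measurable_fun setT (fun w : Om => w : history v l).
  by move=> _ A mA; rewrite setTI; exact: history_measurable mA.
have mpair : measurable_fun setT (fun w : Om => ((w : history v l), (v l w : borel R m))).
  by apply: measurable_fun_pair => //; exact: mvl.
pose idl : {mfun Om >-> history v l} :=
  HB.pack (fun w : Om => w : history v l) (isMeasurableFun.Build _ _ _ _ _ midl).
pose pr : {mfun Om >-> (history v l * borel R m)%type} :=
  HB.pack (fun w : Om => ((w : history v l), (v l w : borel R m)))
    (isMeasurableFun.Build _ _ _ _ _ mpair).
pose Pl := distribution P idl.
transitivity (\int[pushforward P pr]_p f p)%E.
  by rewrite ge0_integral_pushforward.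
transitivity (\int[Pl \x mu]_p f p)%E.
  apply: eq_measure_integral => X mX _; symmetry.
  apply: (product_measure_unique (m1 := Pl) (m2 := mu) (m' := pushforward P pr)) => //.
  by move=> A B mA mB; rewrite /pushforward /= -(history_independent mA mB).
rewrite fubini_tonelli1 //.
transitivity (\int[pushforward P idl]_w fubini_F mu f w)%E => //.
rewrite ge0_integral_pushforward //.
  exact: measurable_fun_fubini_tonelli_F.
by move=> w _; apply: integral_ge0.
Qed.

(** The form in which conditional expectations are used: X' is the value after
    the jump, bounded by a function f of the past and of the next input, and X
    is the value before it. *)
Lemma one_step l (f : history v l * borel R m -> \bar R) (X X' : Om -> \bar R) :
  measurable_fun setT f -> (forall p, (0 <= f p)%E) ->
  measurable_fun setT X -> measurable_fun setT X' ->
  (forall w, (0 <= X' w)%E) ->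
  (forall w, (X' w <= f (w, v l w))%E) ->
  (forall w, (\int[mu]_u f (w, u) <= X w)%E) ->
  (\int[P]_w X' w <= \int[P]_w X w)%E.
Proof.
move=> mf f0 mX mX' X'0 X'f fX.
have midl : measurable_fun setT (fun w : Om => w : history v l).
  by move=> _ A mA; rewrite setTI; exact: history_measurable mA.
have [mvl _ _] := hv.
apply: (@le_trans _ _ (\int[P]_w f (w, v l w))%E).
  apply: ge0_le_integral => //.
  apply: (measurableT_comp mf); apply: measurable_fun_pair => //; exact: mvl.
rewrite freezing //; apply: ge0_le_integral => //.
  by move=> w _; exact: integral_ge0.
exact: (measurableT_comp (measurable_fun_fubini_tonelli_F f mf f0) midl).
Qed.

End freezing.

(** * Expected value of a function after a jump *)

Lemma rat_vector_near (R : realType) (n : nat) (y : 'rV[R]_n) (e : R) : 0 < e ->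
  exists q : 'rV[rat]_n, `|y - map_mx ratr q| < e.
Proof.
move=> e0; have e20 : 0 < e / 2 by rewrite divr_gt0.
have H i : exists q : rat, `|y 0 i - ratr q| < e / 2.
  have [|q] := @rat_in_itvoo _ (y 0 i) (y 0 i + e / 2); first by rewrite ltrDl.
  rewrite in_itv /= => /andP[q1 q2]; exists q.
  by rewrite distrC ger0_norm ?subr_ge0 ?ltW // ltrBlDl.
have [f Hf] := choice H; exists (\row_i f i).
apply: (@le_lt_trans _ _ (e / 2)); last by rewrite ltr_pdivrMr // ltr_pMr // ltr1n.
apply: normr_le_coord => [|i]; first exact: ltW.
by rewrite !mxE; exact/ltW/Hf.
Qed.

Lemma limn_einf_le_ub (R : realType) (f : nat -> \bar R) (x : \bar R) :
  (forall k, (f k <= x)%E) -> (limn_einf f <= x)%E.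
Proof.
move=> fx; rewrite limn_einf_lim (cvg_lim _ (@cvg_einfs_sup _ f)) //.
apply: ge_ereal_sup => _ [k _ <-]; apply: ge_ereal_inf.
by exists (f k); [exists k => //=|exact: fx].
Qed.

Lemma limn_einf_ge_lb (R : realType) (f : nat -> \bar R) (x : R) :
  (forall e, 0 < e -> exists N, forall k, (N <= k)%N -> ((x - e)%:E <= f k)%E) ->
  (x%:E <= limn_einf f)%E.
Proof.
move=> H; rewrite limn_einf_lim (cvg_lim _ (@cvg_einfs_sup _ f)) //.
apply/lee_addgt0Pr => e e0; have [N HN] := H e e0.
rewrite -leeBlDr // -EFinB; apply: le_ereal_sup_tmp.
exists (einfs f N); first by exists N.
by apply: le_ereal_inf_tmp => _ [k /= Nk <-]; exact: HN.
Qed.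

Section jump_payoff.
Variables (R : realType) (n m : nat).
Variables (G : 'rV[R]_n -> 'rV[R]_m -> set 'rV[R]_n) (E : 'rV[R]_n -> R).
Hypothesis Gbdd : loc_bounded (fun p : 'rV[R]_n * 'rV[R]_m => G p.1 p.2).
Hypothesis Gcl : forall u, closed (sv_graph (G ^~ u)).
Hypothesis Gmeas : sv_measurable (measurable : set (set (borel R m)))
  (fun u => sv_graph (G ^~ u)).
Hypothesis E0 : forall y, 0 <= E y.
Hypothesis Ec : continuous (E : 'rV[R]_n -> R).

Definition jump_sup y u : \bar R := ereal_sup [set (E g)%:E | g in G y u].

(** The largest value of E after a jump from y with input u, truncated to [0,
    c]. The truncation makes it real and bounded, which Fatou's lemma needs to
    be applied from above. *)
Definition jump_payoff (c : R) y u : R :=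
  fine (maxe 0%E (mine c%:E (jump_sup y u))).

(** The states reached from near y with the input u stay in a compact set,
    because G is locally bounded. Near a pair (y, g) either E(g) < a persists,
    or g is not in G(y, u) and this persists because the graph is closed. *)
Lemma jump_usc y u a : (forall g, G y u g -> E g < a) ->
  exists2 e, 0 < e & forall y', `|y' - y| < e -> forall g, G y' u g -> E g <= a - e.
Proof.
move=> Ga.
have [B [_ HB]] : bounded_set
    (\bigcup_(p in [set p : 'rV[R]_n * 'rV[R]_m | `|p.1 - y| <= 1 /\ p.2 = u]) G p.1 p.2).
  apply: Gbdd; exists (`|y| + 1 + `|u|); split; first by rewrite num_real.
  move=> r Br [y' u'] /= [yy' ->]; rewrite /Num.norm /= ge_max; apply/andP; split.
    apply: ltW; apply: le_lt_trans Br; rewrite -[y'](subrK y).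
    by apply: le_trans (ler_normD _ _) _; have := normr_ge0 u; lra.
  by apply: ltW; apply: le_lt_trans Br; have := normr_ge0 y; lra.
pose K := [set g : 'rV[R]_n | `|g| <= `|B| + 1].
have cK : compact K.
  by apply: (@compact_closed_bounded _ _ _ (`|B| + 1)) => //; exact: closed_norm_le.
have [|k k0 Hk] := compact_uniform_pos (P := fun k g => forall y' : 'rV[R]_n,
    `|y' - y| < k -> G y' u g -> E g <= a - k) cK.
  move=> g _; have [Gg|nGg] := pselect (G y u g).
    have ag : 0 < (a - E g) / 2 by rewrite divr_gt0 // subr_gt0 Ga.
    have Hg : \forall g' \near g, E g' <= (a + E g) / 2.
      have F : Filter (nbhs g) by exact: nbhs_filter.
      have := @Ec g; move=> /cvgrPdist_lt /(_ _ ag); apply: filterS => g'.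
      by rewrite ltr_distlC => /andP[_ h]; lra.
    near=> g' k; move=> /= y' _ _.
    have h1 : E g' <= (a + E g) / 2 by near: g'.
    have h2 : k <= (a - E g) / 2 by near: k; exact: nbhs_right_le.
    by lra.
  have : nbhs (y, g) (~` sv_graph (G ^~ u)).
    by apply: open_nbhs_nbhs; split; [exact: closed_openC|exact: nGg].
  move=> /nbhs_ballP[r /= r0 Hr].
  near=> g' k; move=> /= y' yy' Gg'; exfalso.
  apply: (Hr (y', g')) => //; split => /=.
    rewrite -ball_normE /ball_ /= distrC; apply: lt_le_trans yy' _.
    by near: k; exact: nbhs_right_le.
  by near: g'; exact: nbhsx_ballx.
exists (Num.min k 1); first by rewrite lt_min k0 ltr01.
move=> y'; rewrite lt_min => /andP[yk y1] g Gg.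
apply: (@le_trans _ _ (a - k)); last by rewrite lerD2l lerN2 ge_min lexx.
apply: (Hk g _ y') => //; apply: HB; first by rewrite (le_lt_trans (ler_norm _)) ?ltrDl.
by exists (y', u) => //=; rewrite ltW.
Unshelve. all: by end_near. Qed.

(** By upper semicontinuity, E reaches a on G(y, u) if and only if, for all k,
    it exceeds a - 1 / (k + 1) on G(y', u) for some y' near y. Here nearness
    may be measured through a rational point q, which makes the set a
    countable combination of products of an open set of y and an event on u.
    *)
Lemma measurable_jump_ge a : measurable
  ([set p | exists2 g, G p.1 p.2 g & a <= E g] : set (borel R n * borel R m)).
Proof.
have bo k (O : set 'rV[R]_k) : open O -> measurable (O : set (borel R k)).
  by move=> oO; exact: sub_sigma_algebra.
pose e k : R := k.+1%:R^-1.
have e0 k : 0 < e k by rewrite invr_gt0.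
pose N (k : nat) (q : 'rV[rat]_n) : set (borel R n) :=
  [set y : 'rV[R]_n | `|y - map_mx ratr q| < e k].
pose O (k : nat) (q : 'rV[rat]_n) : set ('rV[R]_n * 'rV[R]_n) :=
  fst @^-1` N k q `&` snd @^-1` (E @^-1` [set x | a - e k < x]).
pose Hit k q : set (borel R m) := [set u | sv_graph (G ^~ u) `&` O k q !=set0].
have oN k q : open (N k q : set 'rV[R]_n).
  suff /continuousP c : continuous (fun y : 'rV[R]_n => `|y - map_mx ratr q| : R).
    exact: (c _ (@open_lt _ (e k))).
  move=> y; apply: (@continuous_comp _ _ _ (fun y : 'rV[R]_n => y - map_mx ratr q) Num.norm).
    by apply: continuousB; [exact: cvg_id|exact: cst_continuous].
  exact: norm_continuous.
have oO k q : open (O k q).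
  apply: openI.
    have /continuousP c : continuous (@fst 'rV[R]_n 'rV[R]_n) by move=> p; exact: cvg_fst.
    by apply: c; exact: oN.
  have /continuousP c : continuous (@snd 'rV[R]_n 'rV[R]_n) by move=> p; exact: cvg_snd.
  apply: c; have /continuousP c := Ec; exact: (c _ (@open_gt _ (a - e k))).
rewrite (_ : [set p | _] = \bigcap_k \bigcup_q (N k q `*` Hit k q)).
  apply: bigcapT_measurable => k; apply: countable_bigcupT_measurable.
    exact: countableP.
  by move=> q; apply: measurableX; [apply: bo; exact: oN|apply: Gmeas; exact: oO].
apply/seteqP; split=> -[y u] /=.
  move=> [g Gg ag] k _; have [q yq] := rat_vector_near y (e0 k).
  exists q => //; split => //=; exists (y, g); split => //; split => //=.
  by apply: lt_le_trans ag; rewrite ltrBlDr ltrDl.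
move=> H; apply: contrapT => nex.
have [|r r0 Hr] := @jump_usc y u a.
  by move=> g Gg; rewrite ltNge; apply/negP => ag; apply: nex; exists g.
have [k kr] := inv_succ_lt (divr_gt0 r0 (ltr0n R 2)).
have [q _ [/= yq [[y' g] [/= Gg [/= y'q Eg]]]]] := H k I.
have yy' : `|y' - y| < r.
  have -> : y' - y = (y' - map_mx ratr q) - (y - map_mx ratr q) by rewrite opprB addrA subrK.
  apply: le_lt_trans (ler_normB _ _) _; rewrite [r]splitr; apply: ltrD.
    exact: lt_trans y'q kr.
  exact: lt_trans yq kr.
have h := Hr y' yy' g Gg; have := lt_le_trans Eg h.
by rewrite ltrD2l ltrN2 ltNge; move/negP; apply; rewrite ltW // (lt_trans kr) //; lra.
Qed.

Lemma measurable_jump_sup :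
  measurable_fun setT (fun p : borel R n * borel R m => jump_sup p.1 p.2).
Proof.
apply: (measurability _ (ErealGenOInfty.measurableE R)) => _ [_ [x ->] <-].
rewrite setTI (_ : _ @^-1` _ = \bigcup_k [set p | exists2 g, G p.1 p.2 g & x + k.+1%:R^-1 <= E g]).
  by apply: bigcupT_measurable => k; exact: measurable_jump_ge.
apply/seteqP; split=> -[y u] /=.
  rewrite in_itv /= andbT => /ereal_sup_gt[_ [g Gg <-]]; rewrite lte_fin => xg.
  have [k kx] := @inv_succ_lt R (E g - x) ltac:(by rewrite subr_gt0).
  by exists k => //; exists g => //; rewrite -lerBrDl ltW.
move=> [k _ [g Gg xg]]; rewrite in_itv /= andbT.
apply: (@lt_le_trans _ _ (E g)%:E).
  by rewrite lte_fin; apply: lt_le_trans xg; rewrite ltrDl invr_gt0.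
by apply: ereal_sup_ubound; exists g.
Qed.

Lemma measurable_jump_payoff c :
  measurable_fun setT (fun p : borel R n * borel R m => jump_payoff c p.1 p.2).
Proof.
have mfine : measurable_fun setT (fine : \bar R -> R) by exact: fine_measurable.
apply: (measurableT_comp mfine).
apply: measurable_maxe => //; apply: measurable_mine => //.
exact: measurable_jump_sup.
Qed.

Lemma measurable_jump_payoffr c y :
  measurable_fun setT (fun u : borel R m => jump_payoff c y u).
Proof.
exact: (measurableT_comp (measurable_jump_payoff c) (pair1_measurable (y : borel R n))).
Qed.

Lemma measurable_jump_supr y :
  measurable_fun setT (fun u : borel R m => jump_sup y u).
Proof.
exact: (measurableT_comp measurable_jump_sup (pair1_measurable (y : borel R n))).
Qed.

Variable c : R.
Hypothesis c0 : 0 <= c.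

Lemma jump_payoffE y u :
  (jump_payoff c y u)%:E = maxe 0%E (mine c%:E (jump_sup y u)).
Proof.
rewrite fineK // fin_numElt; apply/andP; split.
  by apply: (@lt_le_trans _ _ 0%E); rewrite ?ltNyr // le_max lexx.
by rewrite gt_max ltry /= gt_min ltry.
Qed.

Lemma jump_payoff_ge0 y u : 0 <= jump_payoff c y u.
Proof. by rewrite -lee_fin jump_payoffE le_max lexx. Qed.

Lemma jump_payoff_le y u : jump_payoff c y u <= c.
Proof. by rewrite -lee_fin jump_payoffE ge_max ge_min lexx lee_fin c0. Qed.

Lemma jump_payoff_ge y u g : G y u g -> Num.min (E g) c <= jump_payoff c y u.
Proof.
move=> Gg; rewrite -lee_fin jump_payoffE le_max; apply/orP; right.
rewrite le_min !lee_fin !ge_min lexx orbT /=.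
apply: (@le_trans _ _ (E g)%:E); first by rewrite lee_fin ge_min lexx.
by apply: ereal_sup_ubound; exists g.
Qed.

Lemma jump_payoff_ub y u b : 0 <= b -> (forall g, G y u g -> E g <= b) ->
  jump_payoff c y u <= b.
Proof.
move=> b0 Gb; rewrite -lee_fin jump_payoffE ge_max lee_fin b0 /= ge_min.
by apply/orP; right; apply: ge_ereal_sup => _ [g Gg <-]; rewrite lee_fin Gb.
Qed.

Variable mu : probability (borel R m) R.

Let I y := (\int[mu]_u (jump_payoff c y u)%:E)%E.

Lemma integral_jump_payoff_le y (b : R) :
  (forall u, G y u !=set0) -> (\int[mu]_u jump_sup y u <= b%:E)%E ->
  (I y <= b%:E)%E.
Proof.
move=> Gne; apply: le_trans; apply: ge0_le_integral => //.
- by move=> u _; rewrite lee_fin jump_payoff_ge0.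
- by apply/measurable_EFinP; exact: measurable_jump_payoffr.
- exact: measurable_jump_supr.
move=> u _; rewrite jump_payoffE ge_max ge_min lexx orbT andbT.
have [g Gg] := Gne u; apply: (@le_trans _ _ (E g)%:E); first by rewrite lee_fin.
by apply: ereal_sup_ubound; exists g.
Qed.

(** Fatou's lemma, applied to the nonnegative functions c - jump_payoff along
    a sequence that would contradict the statement; pointwise, their lower
    limit is bounded below by upper semicontinuity of the payoff. *)
Lemma integral_jump_payoff_usc y (b : R) : (I y < b%:E)%E ->
  \forall y' \near y, (I y' <= b%:E)%E.
Proof.
move=> Ib; apply: contrapT => nnear.
have Hk k : exists y' : 'rV[R]_n, `|y' - y| < k.+1%:R^-1 /\ (b%:E < I y')%E.
  apply: contrapT => nex; apply: nnear.
  apply/nbhs_ballP; exists k.+1%:R^-1; first by rewrite /= invr_gt0.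
  move=> y'; rewrite -ball_normE /ball_ /= distrC => yy'.
  by rewrite leNgt; apply/negP => bI; apply: nex; exists y'.
have [yk Hyk] := choice Hk.
pose f k (u : borel R m) : \bar R := (c - jump_payoff c (yk k) u)%:E.
pose J y := (\int[mu]_u (c - jump_payoff c y u)%:E)%E.
have mp y' : measurable_fun setT (fun u : borel R m => (jump_payoff c y' u)%:E).
  by apply/measurable_EFinP; exact: measurable_jump_payoffr.
have mf y' : measurable_fun setT (fun u : borel R m => (c - jump_payoff c y' u)%:E).
  by apply/measurable_EFinP; apply: measurable_funB => //; exact: measurable_jump_payoffr.
have I0 y' : (0 <= I y')%E.
  by apply: integral_ge0 => u _; rewrite lee_fin jump_payoff_ge0.
have f0 y' u : (0 <= (c - jump_payoff c y' u)%:E)%E.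
  by rewrite lee_fin subr_ge0 jump_payoff_le.
have J0 y' : (0 <= J y')%E by apply: integral_ge0.
have JI y' : (J y' + I y' = c%:E)%E.
  rewrite /J /I -ge0_integralD //; last first.
    by move=> u _; rewrite lee_fin jump_payoff_ge0.
  under eq_integral do rewrite -EFinD subrK.
  rewrite (_ : (fun=> c%:E) = cst c%:E) // integral_cst //.
  by rewrite [X in (_ * X)%E](_ : _ = 1%E) ?mule1 //; exact: probability_setT.
have Jfin y' : J y' = (fine (J y'))%:E.
  rewrite fineK // ge0_fin_numE // (le_lt_trans _ (ltry c)) // -(JI y').
  by rewrite leeDl.
have Ifin y' : I y' = (fine (I y'))%:E.
  rewrite fineK // ge0_fin_numE // (le_lt_trans _ (ltry c)) // -(JI y').
  by rewrite leeDr.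
have JI' y' : fine (J y') + fine (I y') = c.
  by apply: EFin_inj; rewrite EFinD -Jfin -Ifin.
have fat := fatou mu measurableT (fun k => mf (yk k)) (fun k u _ => f0 (yk k) u).
have : (J y <= (c - b)%:E)%E.
  apply: (le_trans _ (le_trans fat _)); last first.
    apply: limn_einf_le_ub => k; have [_] := Hyk k.
    rewrite -/(J (yk k)) Jfin Ifin lte_fin lee_fin; have := JI' (yk k); lra.
  apply: ge0_le_integral => //.
    apply: measurableT_comp => //; apply: measurable_fun_limn_esup => k.
    by apply: measurableT_comp => //; exact: mf.
  move=> u _; apply: limn_einf_ge_lb => e e0.
  pose a := jump_payoff c y u + e.
  have a0 : 0 < a by rewrite ltr_wpDl // jump_payoff_ge0.
  have [ca|ac] := leP c a.
    exists 0%N => k _; rewrite lee_fin.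
    have := jump_payoff_le (yk k) u; rewrite /a in ca; lra.
  have [|r r0 Hr] := @jump_usc y u a.
    move=> g Gg; have := jump_payoff_ge Gg; rewrite ge_min /a => /orP[|] h; first by lra.
    by rewrite /a in ac; lra.
  have [N Nr] := inv_succ_lt r0.
  exists N => k Nk; rewrite lee_fin.
  suff : jump_payoff c (yk k) u <= a by rewrite /a; lra.
  apply: jump_payoff_ub; first exact: ltW.
  move=> g Gg; have [yky _] := Hyk k.
  have ykr : `|yk k - y| < r.
    apply: lt_trans yky (le_lt_trans _ Nr).
    by rewrite lef_pV2 ?posrE // ler_nat.
  by have := Hr _ ykr _ Gg; lra.
rewrite Ifin lte_fin in Ib; rewrite Jfin lee_fin; have := JI' y; lra.
Qed.

(** The decrease rho may be as irregular as it likes: at each point of K it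
    leaves room for a constant that remains valid nearby, since the integral
    is upper semicontinuous and E is continuous. *)
Lemma uniform_jump_decrease (K : set 'rV[R]_n) (rho : 'rV[R]_n -> R) :
  compact K -> (forall y u, K y -> G y u !=set0) ->
  (forall y, K y -> 0 < rho y /\ (\int[mu]_u jump_sup y u <= (E y - rho y)%:E)%E) ->
  exists2 k, 0 < k & forall y, K y -> (I y <= (E y - k)%:E)%E.
Proof.
move=> cK Gne HK.
have [|k k0 Hk] := compact_uniform_pos
    (P := fun k y => K y -> (I y <= (E y - k)%:E)%E) cK; last first.
  by exists k => // y Ky; exact: Hk.
move=> y Ky; have [r0 Hr] := HK y Ky.
have r30 : 0 < rho y / 3 by rewrite divr_gt0.
have Hy : \forall y' \near y, (I y' <= (E y - 2 * (rho y / 3))%:E)%E.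
  apply: integral_jump_payoff_usc.
  apply: (le_lt_trans (integral_jump_payoff_le (Gne y ^~ Ky) Hr)).
  by rewrite lte_fin; lra.
have HE : \forall y' \near y, E y - rho y / 3 <= E y'.
  have F : Filter (nbhs y) by exact: nbhs_filter.
  have := @Ec y; move=> /cvgrPdist_lt /(_ _ r30); apply: filterS => y'.
  by rewrite ltr_distlC => /andP[+ _]; lra.
near=> y' k; move=> /= _.
have h1 : (I y' <= (E y - 2 * (rho y / 3))%:E)%E by near: y'.
have h2 : E y - rho y / 3 <= E y' by near: y'.
have h3 : k <= rho y / 3 by near: k; exact: nbhs_right_le.
by apply: le_trans h1 _; rewrite lee_fin; lra.
Unshelve. all: by end_near. Qed.

End jump_payoff.

(** * Maximal inequalities *)

Lemma measurable_fun_mem (d : measure_display) (T : measurableType d) (A : set T) :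
  measurable A -> measurable_fun setT (fun w => w \in A).
Proof.
move=> mA; apply: (measurable_fun_bool true); rewrite setTI.
rewrite (_ : _ @^-1` _ = A) //.
by apply/seteqP; split => w /=; [exact: set_mem|exact: mem_set].
Qed.

Lemma markov_bound (d : measure_display) (T : measurableType d) (R : realType)
    (P : probability T R) (A : set T) (X : T -> R) (c b : R) :
  0 < c -> measurable A -> measurable_fun setT X -> (forall w, 0 <= X w) ->
  (forall w, A w -> c <= X w) -> (\int[P]_w (X w)%:E <= b%:E)%E ->
  (P A <= (b / c)%:E)%E.
Proof.
move=> c0 mA mX X0 AX Xb.
have : (\int[P]_(w in A) (cst c%:E) w <= b%:E)%E.
  apply: le_trans Xb.
  apply: (@le_trans _ _ (\int[P]_(w in A) (X w)%:E)%E).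
    apply: ge0_le_integral => //.
    - by move=> w _; rewrite lee_fin ltW.
    - exact/measurable_EFinP/(measurable_funS measurableT _ mX).
  have mEX : measurable_fun setT (fun w => (X w)%:E) by exact/measurable_EFinP.
  apply: (ge0_subset_integral P mA measurableT mEX) => // w _.
  by rewrite lee_fin.
have PA : P A = (fine (P A))%:E by rewrite fineK // fin_num_measure.
rewrite integral_cst // => h; rewrite PA lee_fin ler_pdivlMr //.
by rewrite -lee_fin mulrC EFinM -PA.
Qed.

Section supermartingale.
Variables (R : realType) (n m : nat) (d : measure_display) (Om : measurableType d).
Variables (P : probability Om R) (mu : probability (borel R m) R).
Variable v : nat -> Om -> 'rV[R]_m.
Hypothesis hv : iid P mu v.
Variables (H : shs R n m) (y : Om -> harc R n) (y0 : 'rV[R]_n).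
Hypothesis hsol : forall w, solution_arc H (fun k => v k w) y0 (y w).
Hypothesis hadapt : adapted v y.
Let G := jump_map H.
Let D := jump_set H.
Hypothesis Dcl : closed D.
Hypothesis Gbdd : loc_bounded (fun p : 'rV[R]_n * 'rV[R]_m => G p.1 p.2).
Hypothesis Gcl : forall u, closed (sv_graph (G ^~ u)).
Hypothesis Gmeas : sv_measurable (measurable : set (set (borel R m)))
  (fun u => sv_graph (G ^~ u)).
Variable E : 'rV[R]_n -> R.
Hypothesis E0 : forall y, 0 <= E y.
Hypothesis Ec : continuous (E : 'rV[R]_n -> R).
Hypothesis Eflow : forall w s t j, arc_dom (y w) (s, j) -> arc_dom (y w) (t, j) ->
  s <= t -> E (y w t j) <= E (y w s j).

Let xi N w := (endpoint (y w) N).2.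
Let tau N w := (endpoint (y w) N).1.
Let live N : set Om := [set w | exists t, last_time (y w) N t].

Let cy w : closed (arc_graph (y w)).
Proof. by have [_ h _ _ _] := hsol w. Qed.

Let hd w : hybrid_time_domain (arc_dom (y w)).
Proof. by have [[h _] _ _ _ _] := hsol w. Qed.

Let my N : sv_measurable (measurable : set (set (history v N)))
  (fun w => arc_graph (y w) `&` [set q | (q.1.2 <= N)%N]).
Proof. exact: hadapt. Qed.

Let m_open N j F : (j <= N)%N -> open F -> measurable (visits y j F : set (history v N)).
Proof. exact: (measurable_visits_open (T := history v N) (@my N)). Qed.

Let m_closed N j F : (j <= N)%N -> closed F -> measurable (visits y j F : set (history v N)).
Proof. exact: (measurable_visits_closed (T := history v N) cy (@my N)). Qed.

Let m_live N : measurable (live N : set (history v N)).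
Proof. exact: (measurable_live (T := history v N) cy (@my N) (leqnn N)). Qed.

Let m_endpoint N F : closed F -> measurable ([set w | F (endpoint (y w) N)] : set (history v N)).
Proof. exact: (measurable_endpoint (T := history v N) cy (@my N) (leqnn N)). Qed.

Let mf_endpoint N phi : continuous phi ->
  measurable_fun setT (fun w : history v N => phi (endpoint (y w) N) : R).
Proof. exact: (measurable_fun_endpoint (T := history v N) cy (@my N) (leqnn N)). Qed.

Let mf_xi N : measurable_fun setT (fun w : history v N => xi N w : borel R n).
Proof. exact: (measurable_fun_endpoint_state (T := history v N) cy (@my N) (leqnn N)). Qed.

Let forget N (f : Om -> measurableTypeR R) :
  measurable_fun setT (f : history v N -> measurableTypeR R) -> measurable_fun setT f.
Proof.
by move=> mf _ A mA; have := mf measurableT A mA; rewrite !setTI; exact: history_measurable hv _ _.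
Qed.

Let m_xiD N : measurable ([set w | D (xi N w)] : set (history v N)).
Proof.
apply: (m_endpoint (F := snd @^-1` D)).
have /continuous_closedP c : continuous (@snd R 'rV[R]_n) by move=> p; exact: cvg_snd.
exact: c.
Qed.

Let tau_ge0 N w : 0 <= tau N w.
Proof.
rewrite /tau; have [[t lt]|nl] := pselect (exists t, last_time (y w) N t).
  rewrite (endpointE lt) /=; have [dt _] := lt. exact (htd_ge0 (hd w) dt).
by rewrite endpoint0.
Qed.

Let jumps N w t : arc_dom (y w) (t, N.+1) -> exists T,
  [/\ last_time (y w) N T, arc_dom (y w) (T, N.+1), T <= t,
      D (y w T N) & G (y w T N) (v N w) (y w T N.+1)].
Proof.
move=> dt; have [T [dT dT' Tmax Tmin]] := htd_jump (hd w) dt.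
have [_ _ _ _ hj] := hsol w; have [DT GT] := hj _ _ dT dT'.
by exists T; split => //; exact: Tmin.
Qed.

(** One step of a supermartingale. On the event B of the past the system may
    jump from a state of interest: S' is then bounded by the payoff of the
    jump plus a term r known before it. Off B the value S' is at most S for
    every input. *)
Lemma lyapunov_step N (B : set Om) (S S' r : Om -> R) (c : R) : 0 <= c ->
  measurable (B : set (history v N)) ->
  measurable_fun setT (S : history v N -> R) ->
  measurable_fun setT (r : history v N -> R) -> measurable_fun setT S' ->
  (forall w, 0 <= S w) -> (forall w, 0 <= S' w) -> (forall w, 0 <= r w) ->
  (forall w, ~ B w -> S' w <= S w) ->
  (forall w, B w -> S' w <= jump_payoff G E c (xi N w) (v N w) + r w) ->
  (forall w, B w ->
     (\int[mu]_u (jump_payoff G E c (xi N w) u)%:E + (r w)%:E <= (S w)%:E)%E) ->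
  (\int[P]_w (S' w)%:E <= \int[P]_w (S w)%:E)%E.
Proof.
move=> c0 mB mS mr mS' S0 S'0 r0 nBS BS' BS.
pose f (p : history v N * borel R m) : R :=
  if p.1 \in B then jump_payoff G E c (xi N p.1) p.2 + r p.1 else S p.1.
have mf : measurable_fun setT f.
  apply: measurable_fun_ifT.
  - exact: (measurableT_comp (measurable_fun_mem mB) measurable_fst).
  - apply: measurable_funD; last exact: (measurableT_comp mr measurable_fst).
    have h : measurable_fun setT (fun p : history v N * borel R m =>
        ((xi N p.1 : borel R n), (p.2 : borel R m))).
      apply: measurable_fun_pair; last exact: measurable_snd.
      exact (measurableT_comp (@mf_xi N) (@measurable_fst _ _ (history v N) (borel R m))).
    exact: (measurableT_comp (measurable_jump_payoff Gbdd Gcl Gmeas Ec c) h).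
  - exact: (measurableT_comp mS measurable_fst).
apply: (one_step hv (l := N) (f := EFin \o f)).
- exact/measurable_EFinP.
- move=> p; rewrite lee_fin /f; case: ifP => // _.
  by rewrite addr_ge0 // jump_payoff_ge0.
- by apply/measurable_EFinP; exact: forget mS.
- exact/measurable_EFinP.
- by move=> w; rewrite lee_fin.
- move=> w; rewrite lee_fin /f /=; case: (boolP (w \in B)) => [/set_mem|/negP h].
    exact: BS'.
  by apply: nBS => Bw; apply: h; rewrite inE.
- move=> w; rewrite /f /=; case: (boolP (w \in B)) => [/set_mem Bw|_].
    apply: le_trans (BS w Bw).
    under eq_integral do rewrite EFinD.
    rewrite ge0_integralD //.
    + rewrite (_ : (fun=> (r w)%:E) = cst (r w)%:E) // integral_cst //.
      by rewrite [X in (_ + _ * X)%E](_ : _ = 1%E) ?mule1 //; exact: probability_setT.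
    + by move=> u _; rewrite lee_fin jump_payoff_ge0.
    + by apply/measurable_EFinP; exact: (measurable_jump_payoffr Gbdd Gcl Gmeas Ec).
    + by move=> u _; rewrite lee_fin.
  rewrite (_ : (fun=> (S w)%:E) = cst (S w)%:E) // integral_cst //.
  by rewrite [X in (_ * X)%E](_ : _ = 1%E) ?mule1 //; exact: probability_setT.
Qed.

Let low a : set (R * 'rV[R]_n) := snd @^-1` (E @^-1` [set x | x < a]).
Let high c : set (R * 'rV[R]_n) := snd @^-1` (E @^-1` [set x | c <= x]).

Let Esnd_cts : continuous (fun p : R * 'rV[R]_n => E p.2).
Proof. by move=> p; apply: continuous_comp; [exact: cvg_snd|exact: Ec]. Qed.

Let open_low a : open (low a).
Proof. by have /continuousP c := Esnd_cts; exact: (c _ (@open_lt _ a)). Qed.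

Let closed_high c : closed (high c).
Proof. by have /continuous_closedP k := Esnd_cts; exact: (k _ (@closed_ge _ c)). Qed.

Definition ever_low a N : set Om := \bigcup_(i in [set i | (i <= N)%N]) visits y i (low a).
Definition ever_high c N : set Om := \bigcup_(i in [set i | (i <= N)%N]) visits y i (high c).

(** Some value is at least c at a jump index larger than the index of some
    value below a. The indices have to differ: along a single flow interval E
    does not increase. *)
Definition rebound a c N : set Om :=
  \bigcup_(j in [set j | (j <= N)%N]) \bigcup_(i in [set i | (i < j)%N])
    (visits y i (low a) `&` visits y j (high c)).

Let m_low a N K : (N <= K)%N -> measurable (ever_low a N : set (history v K)).
Proof.
move=> NK; apply: bigcup_measurable => i iN; apply: m_open => //.
exact: leq_trans iN NK.
Qed.

Let m_high c N K : (N <= K)%N -> measurable (ever_high c N : set (history v K)).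
Proof.
move=> NK; apply: bigcup_measurable => i iN; apply: m_closed => //.
exact: leq_trans iN NK.
Qed.

Let m_rebound_history a c N : measurable (rebound a c N : set (history v N)).
Proof.
apply: bigcup_measurable => j jN; apply: bigcup_measurable => i ij.
apply: measurableI; first by apply: m_open => //; exact: (leq_trans (ltnW ij) jN).
by apply: m_closed.
Qed.

Lemma measurable_rebound a c N : measurable (rebound a c N).
Proof. exact (history_measurable hv (@m_rebound_history a c N)). Qed.

Let Eend N w t : last_time (y w) N t -> E (xi N w) = E (y w t N).
Proof. by move=> lt; rewrite /xi (endpointE lt). Qed.

Section rebound_bound.
Hypothesis Edecr : forall x, D x ->
  (forall u, G x u !=set0) /\ (\int[mu]_u jump_sup G E x u <= (E x)%:E)%E.
Variables a c : R.
Hypotheses (a0 : 0 <= a) (c0 : 0 < c).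

(** The supermartingale: it waits at a until E has been below a, then follows
    the value of E before each jump (0 once the arc has ended), and stops at c
    when the rebound occurs. *)
Let S N w : R := if w \in rebound a c N then c
  else if w \in ever_low a N then (if w \in live N then E (xi N w) else 0) else a.

Let S_ge0 N w : 0 <= S N w.
Proof. by rewrite /S; case: ifP => _; [exact: ltW|case: ifP => // _; case: ifP]. Qed.

Let mS N : measurable_fun setT (S N : history v N -> R).
Proof.
have h1 := measurable_fun_mem (@m_rebound_history a c N).
have h2 := measurable_fun_mem (@m_low a N N (leqnn N)).
have h3 := measurable_fun_mem (@m_live N).
have h4 := @mf_endpoint N (fun p => E p.2) Esnd_cts.
apply: (measurable_fun_ifT h1) => //; apply: (measurable_fun_ifT h2) => //.
exact: (measurable_fun_ifT h3).
Qed.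

Let S_step N : (\int[P]_w (S N.+1 w)%:E <= \int[P]_w (S N w)%:E)%E.
Proof.
pose B := [set w | [/\ ever_low a N w, ~ rebound a c N w, live N w & D (xi N w)]].
have no_jump w : ever_low a N w -> ~ rebound a c N w -> ~ B w ->
    forall t, ~ arc_dom (y w) (t, N.+1).
  move=> Lw nR nB t dt; apply: nB; have [T [lT _ _ DT _]] := jumps dt.
  by split => //; [exists T|rewrite /xi (endpointE lT)].
have rebound_mono w : rebound a c N w -> rebound a c N.+1 w.
  by move=> [j jN Hj]; exists j => //; exact: leqW.
have low_mono w : ever_low a N w -> ever_low a N.+1 w.
  by move=> [i iN Hi]; exists i => //; exact: leqW.
have new_rebound w : rebound a c N.+1 w -> ~ rebound a c N w ->
    ever_low a N w /\ visits y N.+1 (high c) w.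
  move=> [j /= jN [i /= ij [li hj]]] nR; move: jN; rewrite leq_eqVlt => /orP[/eqP jN|jN].
    by rewrite jN in ij hj; split => //; exists i.
  by exfalso; apply: nR; exists j => //; exists i.
apply: (lyapunov_step (N := N) (B := B) (r := cst 0) (c := c)) => //.
- exact: ltW.
- rewrite (_ : B = ever_low a N `&` ~` rebound a c N `&` live N `&` [set w | D (xi N w)]).
    do 2 (apply: measurableI; last by []).
    by apply: measurableI; [exact: m_low|apply: measurableC].
  by apply/seteqP; split => w; [case|move=> [[[]]]].
- exact (@forget N.+1 _ (@mS N.+1)).
- move=> w nB; have [Rw|nR] := pselect (rebound a c N w).
    by rewrite /S !mem_set //; exact: rebound_mono.
  have [Lw|nL] := pselect (ever_low a N w); last first.
    have nR' : ~ rebound a c N.+1 w by move=> /new_rebound /(_ nR)[].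
    rewrite /S !(memNset nR) !(memNset nR') (memNset nL).
    case: (boolP (w \in ever_low a N.+1)) => // /set_mem [i /= iN [t dt Et]].
    case: (boolP (w \in live N.+1)) => // /set_mem [s ls]; rewrite (Eend ls).
    move: iN; rewrite leq_eqVlt => /orP[/eqP iN|iN]; last by exfalso; apply: nL; exists i => //; exists t.
    rewrite iN in dt Et; have [ds smax] := ls.
    by apply: le_trans (Eflow dt ds (smax _ dt)) (ltW Et).
  have nj := no_jump w Lw nR nB.
  have nR' : ~ rebound a c N.+1 w by move=> /new_rebound /(_ nR)[_ [t /nj]].
  rewrite {1}/S (memNset nR') (mem_set (low_mono _ Lw)).
  case: (boolP (w \in live N.+1)) => // /set_mem [s [ds _]].
  by have := nj _ ds.
- move=> w [Lw nR lw Dw]; rewrite addr0.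
  have [[t dt]|nj] := pselect (exists t, arc_dom (y w) (t, N.+1)); last first.
    have nR' : ~ rebound a c N.+1 w.
      by move=> /new_rebound /(_ nR)[_ [t dt _]]; apply: nj; exists t.
    rewrite /S (memNset nR') (mem_set (low_mono _ Lw)) memNset ?jump_payoff_ge0 //.
    by move=> [s [ds _]]; apply: nj; exists s.
  have [T [lT dT Tt DT GT]] := jumps dt.
  have xiT : xi N w = y w T N by rewrite /xi (endpointE lT).
  rewrite xiT; apply: le_trans (jump_payoff_ge E c GT).
  have Tmin s : arc_dom (y w) (s, N.+1) -> T <= s.
    move=> ds; have [T' [lT' _ T's _ _]] := jumps ds.
    by have [_ /(_ T)] := lT'; have [dTN _] := lT => /(_ dTN) /le_trans; apply.
  rewrite /S; case: (boolP (w \in rebound a c N.+1)) => [/set_mem R'|/negP nR'].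
    have [_ [s ds Es]] := new_rebound w R' nR.
    rewrite le_min lexx andbT; apply: (@le_trans _ _ (E (y w s N.+1))); first exact: Es.
    by apply: Eflow => //; exact: Tmin.
  rewrite (mem_set (low_mono _ Lw)).
  have Tc : E (y w T N.+1) < c.
    rewrite ltNge; apply/negP => cT; apply: nR'; apply/mem_set; exists N.+1; first exact: leqnn.
    have [i iN Hi] := Lw.
    exists i => //; split => //; by exists T.
  rewrite (min_idPl (ltW Tc)).
  case: (boolP (w \in live N.+1)) => // /set_mem [s ls]; rewrite (Eend ls).
  by have [ds _] := ls; apply: Eflow => //; exact: Tmin.
- move=> w [Lw nR lw Dw]; rewrite adde0 /S (memNset nR) (mem_set Lw) (mem_set lw).
  have [Gne dec] := Edecr Dw.
  exact: (integral_jump_payoff_le Gbdd Gcl Gmeas E0 Ec).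
Qed.

(** The supermartingale starts at most at a, and it is equal to c on the
    rebound event. *)
Lemma rebound_bound N : (P (rebound a c N) <= (a / c)%:E)%E.
Proof.
apply: (markov_bound c0 (measurable_rebound a c N) (@forget N _ (@mS N)) (S_ge0 N)).
  by move=> w Rw; rewrite /S mem_set.
apply: (@le_trans _ _ (\int[P]_w (S 0 w)%:E)%E).
  by elim: N => // N IH; exact: le_trans (S_step N) IH.
rewrite -[leRHS]mule1 -(probability_setT P) -(integral_cst P measurableT).
apply: ge0_le_integral => //.
- by move=> w _; rewrite lee_fin.
- by apply/measurable_EFinP; exact (@forget 0 _ (@mS 0)).
move=> w _; rewrite lee_fin /S memNset; last by move=> [j /=]; rewrite leqn0 => /eqP -> [].
case: (boolP (w \in ever_low a 0)) => // /set_mem [i /=]; rewrite leqn0 => /eqP -> [t dt Et].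
case: (boolP (w \in live 0)) => // /set_mem [s ls]; rewrite (Eend ls).
have [ds smax] := ls.
by apply: le_trans (Eflow dt ds (smax _ dt)) (ltW Et).
Qed.

End rebound_bound.

Section slow_bound.
Variables a c k Tm : R.
Hypotheses (c0 : 0 < c) (k0 : 0 < k) (Tm0 : 0 < Tm).
Hypothesis Eflow_slope : forall w s t j, arc_dom (y w) (s, j) ->
  arc_dom (y w) (t, j) -> s <= t -> a <= E (y w t j) -> E (y w s j) <= c ->
  E (y w t j) <= E (y w s j) - k * (t - s).
Hypothesis Ejump : forall x, D x -> a <= E x -> E x <= c ->
  (\int[mu]_u (jump_payoff G E c x u)%:E <= (E x - k)%:E)%E.

Let late j : set (R * 'rV[R]_n) :=
  (snd @^-1` (E @^-1` [set x | a <= x])) `&` (fst @^-1` [set t | Tm - j%:R <= t]).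

Let closed_late j : closed (late j).
Proof.
apply: closedI; first exact: closed_high.
have /continuous_closedP h : continuous (@fst R 'rV[R]_n) by move=> p; exact: cvg_fst.
exact: (h _ (@closed_ge _ _)).
Qed.

(** Hybrid time Tm is reached with E between a and c all along. On the last
    interval the condition a <= E is only required at the time reached: it
    holds before since E does not increase. *)
Definition slow N : set Om := \bigcup_(j in [set j | (j <= N)%N])
  (visits y j (late j) `&` ~` (\bigcup_(i in [set i | (i < j)%N]) visits y i (low a))
    `&` ~` ever_high c j).

Let alive N : set Om := live N `&` ~` ever_low a N `&` ~` ever_high c N.

Let m_slow_history N : measurable (slow N : set (history v N)).
Proof.
apply: bigcup_measurable => j jN.
have h1 := m_closed jN (@closed_late j).
have h2 : measurable (\bigcup_(i in [set i | (i < j)%N]) visits y i (low a)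
    : set (history v N)).
  apply: bigcup_measurable => i ij; apply: m_open => //.
  exact: (leq_trans (ltnW ij) jN).
have h3 := @m_high c j N jN.
pose Th := history v N.
exact (@measurableI _ Th _ _ (@measurableI _ Th _ _ h1 (@measurableC _ Th _ h2))
  (@measurableC _ Th _ h3)).
Qed.

Lemma measurable_slow N : measurable (slow N).
Proof. exact (history_measurable hv (@m_slow_history N)). Qed.

Let m_alive N : measurable (alive N : set (history v N)).
Proof.
have h1 := @m_live N; have h2 := @m_low a N N (leqnn N).
have h3 := @m_high c N N (leqnn N).
pose Th := history v N.
exact (@measurableI _ Th _ _ (@measurableI _ Th _ _ h1 (@measurableC _ Th _ h2))
  (@measurableC _ Th _ h3)).
Qed.

Let r N w : R := k * (tau N w + N%:R) + k.

(** As long as E remains between a and c, the value of E before the jump plus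
    k times the hybrid time; the process stops at k Tm when the hybrid time
    reaches Tm, and at 0 when E leaves [a, c] or when the arc ends. *)
Let S N w : R := if w \in slow N then k * Tm
  else if w \in alive N then E (xi N w) + k * (tau N w + N%:R) else 0.

Let clock_ge0 N w : 0 <= k * (tau N w + N%:R).
Proof. by apply: mulr_ge0; [exact: ltW|exact: addr_ge0]. Qed.

Let r_ge0 N w : 0 <= r N w.
Proof. by apply: addr_ge0; [exact: clock_ge0|exact: ltW]. Qed.

Let S_ge0 N w : 0 <= S N w.
Proof.
rewrite /S; case: ifP => _; first by rewrite mulr_ge0 // ltW.
by case: ifP => // _; apply: addr_ge0; [exact: E0|exact: clock_ge0].
Qed.

Let Efst_cts (b : R) : continuous (fun p : R * 'rV[R]_n => k * (p.1 + b)).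
Proof.
have c1 : continuous (fun t : R => k * (t + b)).
  move=> t; apply: cvgM; first exact: cvg_cst.
  by apply: cvgD; [exact: cvg_id|exact: cvg_cst].
by move=> p; apply: (@continuous_comp _ _ _ fst (fun t : R => k * (t + b)));
  [exact: cvg_fst|exact: c1].
Qed.

Let mS N : measurable_fun setT (S N : history v N -> R).
Proof.
have h1 := measurable_fun_mem (@m_slow_history N).
have h2 := measurable_fun_mem (@m_alive N).
have h3 := @mf_endpoint N (fun p => E p.2) Esnd_cts.
have h4 := @mf_endpoint N (fun p => k * (p.1 + N%:R)) (@Efst_cts N%:R).
apply: (measurable_fun_ifT h1) => //; apply: (measurable_fun_ifT h2) => //.
exact: measurable_funD h3 h4.
Qed.

Let mr N : measurable_fun setT (r N : history v N -> R).
Proof.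
have h4 := @mf_endpoint N (fun p => k * (p.1 + N%:R)) (@Efst_cts N%:R).
by apply: measurable_funD h4 _.
Qed.

Let not_low N w : ~ ever_low a N w -> forall i t, (i <= N)%N ->
  arc_dom (y w) (t, i) -> a <= E (y w t i).
Proof.
move=> nl i t iN dt; rewrite leNgt; apply/negP => Ea.
by apply: nl; exists i => //; exists t.
Qed.

Let not_high N w : ~ ever_high c N w -> forall i t, (i <= N)%N ->
  arc_dom (y w) (t, i) -> E (y w t i) < c.
Proof.
move=> nl i t iN dt; rewrite ltNge; apply/negP => Ea.
by apply: nl; exists i => //; exists t.
Qed.

Let S_step N : (\int[P]_w (S N.+1 w)%:E <= \int[P]_w (S N w)%:E)%E.
Proof.
pose B := [set w | [/\ alive N w, ~ slow N w & D (xi N w)]].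
have slow_mono w : slow N w -> slow N.+1 w.
  by move=> [j jN Hj]; exists j => //; exact: leqW.
have new_slow w : slow N.+1 w -> ~ slow N w ->
    [/\ visits y N.+1 (late N.+1) w, ~ ever_low a N w & ~ ever_high c N.+1 w].
  move=> [j /= jN [[vj nl] nh]] nS; move: jN; rewrite leq_eqVlt => /orP[/eqP jN|jN].
    by rewrite jN in vj nl nh.
  by exfalso; apply: nS; exists j.
have high_mono w : ever_high c N w -> ever_high c N.+1 w.
  by move=> [i iN Hi]; exists i => //; exact: leqW.
have low_mono w : ever_low a N w -> ever_low a N.+1 w.
  by move=> [i iN Hi]; exists i => //; exact: leqW.
have alive_pre w t : arc_dom (y w) (t, N.+1) -> ~ ever_low a N w ->
    ~ ever_high c N.+1 w -> alive N w /\ D (xi N w).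
  move=> dt nl nh; have [T [lT _ _ DT _]] := jumps dt.
  split; last by rewrite /xi (endpointE lT).
  by split; [split => //; exists T|move=> /high_mono].
apply: (lyapunov_step (N := N) (B := B) (r := r N) (c := c)) => //.
- exact: ltW.
- rewrite (_ : B = alive N `&` ~` slow N `&` [set w | D (xi N w)]).
    apply: measurableI; last by [].
    by apply: measurableI => //; apply: measurableC.
  by apply/seteqP; split => w; [case|move=> [[]]].
- exact (@forget N.+1 _ (@mS N.+1)).
- move=> w nB; have [Sw|nS] := pselect (slow N w).
    by rewrite /S !mem_set //; exact: slow_mono.
  rewrite {1}/S; case: (boolP (w \in slow N.+1)) => [/set_mem S'|_].
    exfalso; have [[t dt _] nl nh] := new_slow w S' nS.
    by have [Al Dx] := alive_pre _ _ dt nl nh; exact: nB.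
  case: (boolP (w \in alive N.+1)) => // /set_mem [[[t [dt _]] nl] nh].
  exfalso; have nl' : ~ ever_low a N w by move=> /low_mono.
  by have [Al Dx] := alive_pre _ _ dt nl' nh; exact: nB.
- move=> w [[[lw nl] nh] nS Dw].
  have [[t dt]|nj] := pselect (exists t, arc_dom (y w) (t, N.+1)); last first.
    rewrite /S memNset; last by move=> /new_slow /(_ nS)[[t dt _] _ _]; apply: nj; exists t.
    rewrite memNset; last by move=> [[[t [dt _]] _] _]; apply: nj; exists t.
    by rewrite addr_ge0 // jump_payoff_ge0.
  have [T [lT dT Tt DT GT]] := jumps dt.
  have xiT : xi N w = y w T N by rewrite /xi (endpointE lT).
  have tauT : tau N w = T by rewrite /tau (endpointE lT).
  have pay := jump_payoff_ge E c GT; rewrite -xiT in pay.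
  have Tmin s : arc_dom (y w) (s, N.+1) -> T <= s.
    move=> ds; have [T' [lT' _ T's _ _]] := jumps ds.
    by have [_ /(_ T)] := lT'; have [dTN _] := lT => /(_ dTN) /le_trans; apply.
  (* along the new interval, the value plus the clock does not exceed its
     value right after the jump *)
  have run s : arc_dom (y w) (s, N.+1) -> a <= E (y w s N.+1) ->
      ~ ever_high c N.+1 w ->
      E (y w s N.+1) + k * (s + N.+1%:R) <=
        jump_payoff G E c (xi N w) (v N w) + r N w.
    move=> ds as_ nh'.
    have Tc := not_high nh' (leqnn _) dT.
    have := Eflow_slope dT ds (Tmin _ ds) as_ (ltW Tc).
    have := pay; rewrite (min_idPl (ltW Tc)) /r tauT -natr1; lra.
  rewrite /S; case: (boolP (w \in slow N.+1)) => [/set_mem S'|_].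
    have [[s ds [/= as_ sT]] _ nh'] := new_slow w S' nS.
    apply: le_trans (run s ds as_ nh'); have Es := E0 (y w s N.+1).
    have : k * Tm <= k * (s + N.+1%:R) by rewrite ler_pM2l // -lerBlDr.
    lra.
  case: (boolP (w \in alive N.+1)) => [/set_mem [[[s ls] nl'] nh']|_]; last first.
    by rewrite addr_ge0 // jump_payoff_ge0.
  have [ds _] := ls; rewrite (Eend ls) {1}/tau (endpointE ls).
  exact: run ds (not_low nl' (leqnn _) ds) nh'.
- move=> w [Al nS Dw]; rewrite /S (memNset nS) (mem_set Al).
  have [[[t lt] nl] nh] := Al; have [dt _] := lt.
  have h1 : a <= E (xi N w) by rewrite (Eend lt); exact: not_low nl _ _ (leqnn _) dt.
  have h2 : E (xi N w) < c by rewrite (Eend lt); exact: not_high nh _ _ (leqnn _) dt.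
  apply: le_trans (leeD2r _ (Ejump Dw h1 (ltW h2))) _.
  by rewrite -EFinD lee_fin /r; lra.
Qed.

(** The supermartingale starts at most at E(y0), and it is equal to k Tm on
    the event. *)
Lemma slow_bound N : (P (slow N) <= (E y0 / (k * Tm))%:E)%E.
Proof.
have kT : 0 < k * Tm by rewrite mulr_gt0.
apply: (markov_bound kT (measurable_slow N) (@forget N _ (@mS N)) (S_ge0 N)).
  by move=> w Rw; rewrite /S mem_set.
apply: (@le_trans _ _ (\int[P]_w (S 0 w)%:E)%E).
  by elim: N => // N IH; exact: le_trans (S_step N) IH.
rewrite -[leRHS]mule1 -(probability_setT P) -(integral_cst P measurableT).
apply: ge0_le_integral => //.
- by move=> w _; rewrite lee_fin.
- by apply/measurable_EFinP; exact (@forget 0 _ (@mS 0)).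
move=> w _; rewrite lee_fin.
have [_ _ [d0 a00] _ _] := hsol w.
have run s : arc_dom (y w) (s, 0%N) -> a <= E (y w s 0) -> ~ ever_high c 0 w ->
    E (y w s 0) + k * s <= E y0.
  move=> ds as_ nh; have s0 := htd_ge0 (hd w) ds.
  have := Eflow_slope d0 ds s0 as_ (ltW (not_high nh (leqnn _) d0)).
  by rewrite a00 subr0; lra.
rewrite /S; case: (boolP (w \in slow 0)) => [/set_mem [j /=]|_].
  rewrite leqn0 => /eqP -> [[[s ds [/= as_ sT]] _] nh].
  have := run s ds as_ nh; have := E0 (y w s 0); rewrite subr0 in sT.
  have : k * Tm <= k * s by rewrite ler_pM2l.
  lra.
case: (boolP (w \in alive 0)) => [/set_mem [[[s ls] nl] nh]|_] //.
have [ds _] := ls; rewrite (Eend ls) /tau (endpointE ls) addr0.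
exact: run ds (not_low nl (leqnn _) ds) nh.
Qed.

End slow_bound.

End supermartingale.

(** * Lyapunov functions and stability in probability *)

(** Continuity of the probability from below. *)
Lemma probability_bigcup_le (d : measure_display) (T : measurableType d) (R : realType)
    (P : probability T R) (F : nat -> set T) (b : R) :
  (forall k, measurable (F k)) -> {homo F : i j / (i <= j)%N >-> i `<=` j} ->
  (forall k, (P (F k) <= b%:E)%E) -> (P (\bigcup_k F k) <= b%:E)%E.
Proof.
move=> mF ndF Fb; have mU : measurable (\bigcup_k F k) by exact: bigcupT_measurable.
have cv : (P \o F) x @[x --> \oo] --> P (\bigcup_k F k).
  by apply: nondecreasing_cvg_mu => // i j ij; apply/subsetPset; exact: ndF.
rewrite -(cvg_lim _ cv) //; apply: lime_le.
  by apply/cvg_ex; eexists; exact: cv.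
by apply: nearW => k; exact: Fb.
Qed.

Section lyapunov.
Variables (R : realType) (n m : nat) (d : measure_display) (Om : measurableType d).
Variables (P : probability Om R) (mu : probability (borel R m) R).
Variable v : nat -> Om -> 'rV[R]_m.
Hypothesis hv : iid P mu v.
Variable H : shs R n m.
Hypotheses (Ccl : closed (flow_set H)) (Dcl : closed (jump_set H)).
Hypothesis Gne : forall y u, jump_set H y -> jump_map H y u !=set0.
Hypothesis Gbdd : loc_bounded (fun p : 'rV[R]_n * 'rV[R]_m => jump_map H p.1 p.2).
Hypothesis Gcl : forall u, closed (sv_graph (jump_map H ^~ u)).
Hypothesis Gmeas : sv_measurable (measurable : set (set (borel R m)))
  (fun u => sv_graph (jump_map H ^~ u)).
Variables (A : set 'rV[R]_n) (E sig rho : 'rV[R]_n -> R).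
Let Y := flow_set H `|` jump_set H `|`
  jump_image (jump_map H) (jump_set H) (noise_range v).
Hypotheses (E0 : forall y, 0 <= E y) (lE : locally_lip E).
Hypothesis sig0 : forall y, 0 <= sig y.
Hypothesis Eslope : forall (c : R -> 'rV[R]_n) t f,
  flow_set H (c t) -> flow_map H (c t) f -> expands_at c t f ->
  slope_le (E \o c) (- sig (c t)) t.
Hypothesis sig_pos : forall a c, 0 < a -> exists2 k, 0 < k &
  forall y, flow_set H y -> a <= E y -> E y <= c -> k <= sig y.
Hypothesis rho0 : forall y, 0 <= rho y.
Hypothesis rho_pos : forall y, jump_set H y -> 0 < E y -> 0 < rho y.
Hypothesis Ejump : forall y, jump_set H y ->
  (\int[mu]_u jump_sup (jump_map H) E y u <= (E y - rho y)%:E)%E.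
Hypothesis E_bdd : forall c, exists B, forall y, Y y -> E y <= c -> `|y| <= B.
Hypothesis E_small : forall e, 0 < e -> exists2 c, 0 < c &
  forall y, Y y -> E y < c -> inflate A e y.
Hypothesis E_large : forall c, exists2 e, 0 < e &
  forall y, Y y -> E y <= c -> inflate A e y.
Hypothesis start_small : forall eta, 0 < eta -> exists2 r, 0 < r &
  forall y, Y y -> (eset_dist A y <= r%:E)%E -> E y < eta.
Hypothesis start_bdd : forall r, 0 < r -> exists c,
  forall y, Y y -> (eset_dist A y <= r%:E)%E -> E y <= c.

Let Ec : continuous (E : 'rV[R]_n -> R).
Proof. exact: locally_lip_continuous. Qed.

Lemma random_solution_arc y0 y w : random_solution v H y0 y ->
  solution_arc H (fun k => v k w) y0 (y w).
Proof.
move=> [[[ha ca _] _] hst hfl hj].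
by split; [exact: ha|exact: ca|exact: hst|exact: hfl|exact: hj].
Qed.

(** A sublevel set of E in the closed jump set is compact, and rho is positive
    on it where E is at least a. *)
Let jump_uniform a c : 0 < a -> 0 <= c -> exists2 k, 0 < k &
  forall y, jump_set H y -> a <= E y -> E y <= c ->
    (\int[mu]_u (jump_payoff (jump_map H) E c y u)%:E <= (E y - k)%:E)%E.
Proof.
move=> a0 c0; have [B HB] := E_bdd c.
pose K := jump_set H `&` ((E @^-1` [set x | a <= x]) `&` (E @^-1` [set x | x <= c])).
have cK : compact K.
  apply: (@compact_closed_bounded _ _ _ B) => [|y [Dy [_ yc]]].
    have /continuous_closedP Ecl := Ec.
    apply: closedI => //; apply: closedI.
      exact: (Ecl [set x | a <= x] (@closed_ge _ a)).
    exact: (Ecl [set x | x <= c] (@closed_le _ c)).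
  by apply: HB => //; left; right.
have [||k k0 Hk] := uniform_jump_decrease Gbdd Gcl Gmeas E0 Ec c0 (mu := mu) (rho := rho) cK.
- by move=> y u [Dy _]; exact: Gne.
- move=> y [Dy [/= ay _]]; split; last exact: Ejump.
  by apply: rho_pos => //; exact: lt_le_trans ay.
by exists k => // y Dy ay yc; apply: Hk.
Qed.

Let solution_bounds y0 y : random_solution v H y0 y -> (flow_set H `|` jump_set H) y0 ->
  [/\ forall w s t j, arc_dom (y w) (s, j) -> arc_dom (y w) (t, j) ->
        s <= t -> E (y w t j) <= E (y w s j),
      forall w t j, arc_dom (y w) (t, j) -> Y (y w t j) &
      forall w t, arc_dom (y w) (t, 0%N) -> E (y w t 0%N) <= E y0].
Proof.
move=> sol Y0; have ha w := random_solution_arc w sol.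
have Efl w s t j : arc_dom (y w) (s, j) -> arc_dom (y w) (t, j) ->
    s <= t -> E (y w t j) <= E (y w s j).
  exact: (arc_flow_le (ha w) lE sig0 Eslope).
split => // [w t j dt|w t dt].
  have [|[x Dx [_ [k _ <-] xk]]] := arc_states (ha w) Ccl dt Y0; first by left.
  right; exists x => //; exists (v k w) => //; exists k => //; by exists w.
have [[hd _] _ [d0 a0] _ _] := ha w.
by rewrite -a0; apply: Efl => //; exact (htd_start hd dt).
Qed.

(** The events in the definition of stability are complements of countable
    unions of visits to closed sets. *)
Lemma measurable_avoid y0 y (F : nat -> set (R * 'rV[R]_n)) :
  random_solution v H y0 y -> (forall j, closed (F j)) ->
  measurable [set w | forall t j, arc_dom (y w) (t, j) -> ~ F j (t, y w t j)].
Proof.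
move=> sol cF; have [[[_ ca _] adp] _ _ _] := sol.
rewrite (_ : [set w | _] = ~` \bigcup_j visits y j (F j)).
  apply: measurableC; apply: bigcupT_measurable => j.
  apply: (history_measurable hv (l := j)).
  exact (measurable_visits_closed (T := history v j) ca (adp j) (leqnn j) (cF j)).
apply/seteqP; split=> w /=.
  by move=> h [j _ [t dt Ft]]; exact: (h t j).
by move=> h t j dt Ft; apply: h; exists j => //; exists t.
Qed.

Lemma probability_ge_of_compl (X B : set Om) (b q : R) : measurable X -> measurable B ->
  ~` X `<=` B -> (P B <= b%:E)%E -> b <= q -> ((1 - q)%:E <= P X)%E.
Proof.
move=> mX mB XB Bb bq.
have : (P (~` X) <= q%:E)%E.
  apply: le_trans (_ : b%:E <= _)%E; last by rewrite lee_fin.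
  by apply: le_trans Bb; apply: le_measure => //; rewrite inE //; exact: measurableC.
have PX : P X = (fine (P X))%:E by rewrite fineK // fin_num_measure.
by rewrite probability_setC // PX -EFinB !lee_fin; lra.
Qed.

Lemma rebound_total y0 y a c : random_solution v H y0 y ->
  (flow_set H `|` jump_set H) y0 -> 0 < a -> 0 < c ->
  measurable (\bigcup_N rebound y E a c N) /\
  (P (\bigcup_N rebound y E a c N) <= (a / c)%:E)%E.
Proof.
move=> sol Y0 a0 c0; have ha w := random_solution_arc w sol.
have [[_ adp] _ _ _] := sol; have [Efl _ _] := solution_bounds sol Y0.
have mr N : measurable (rebound y E a c N) by exact: (measurable_rebound hv ha adp Ec).
split; first exact: bigcupT_measurable.
apply: probability_bigcup_le => //.
  by move=> i j ij w [l li Hl]; exists l => //; exact: leq_trans li ij.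
move=> N; apply: (rebound_bound hv (mu := mu) ha adp Dcl Gbdd Gcl Gmeas E0 Ec Efl) => //.
  move=> x Dx; split; first by move=> u; exact: Gne.
  by apply: le_trans (Ejump Dx) _; rewrite lee_fin gerBl.
exact: ltW.
Qed.

(** As E(y0) < a at index 0, and E does not exceed E(y0) at index 0, a value
    at least c is a rebound. *)
Lemma exceed_rebound y0 y a c w t j : random_solution v H y0 y ->
  (flow_set H `|` jump_set H) y0 -> E y0 < a -> a <= c ->
  arc_dom (y w) (t, j) -> c <= E (y w t j) -> (\bigcup_N rebound y E a c N) w.
Proof.
move=> sol Y0 ya ac dt ct; have [_ _ [d0 _] _ _] := random_solution_arc w sol.
have [_ _ E00] := solution_bounds sol Y0.
case: j dt ct => [|j] dt ct.
  by have := le_lt_trans (le_trans ct (E00 w t dt)) (lt_le_trans ya ac); rewrite ltxx.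
exists j.+1 => //; exists j.+1; first exact: leqnn.
exists 0%N => //; split; last by exists t.
exists 0 => //=; apply: le_lt_trans ya; exact: E00.
Qed.

Let closed_off e T j : 0 < e ->
  closed ((snd @^-1` ~` inflate A e) `&` (fst @^-1` [set t | T - j%:R <= t])
    : set (R * 'rV[R]_n)).
Proof.
move=> e0; apply: closedI.
  have /continuous_closedP c : continuous (@snd R 'rV[R]_n) by move=> p; exact: cvg_snd.
  exact: (c (~` inflate A e) (open_closedC (open_inflate e0))).
have /continuous_closedP h : continuous (@fst R 'rV[R]_n) by move=> p; exact: cvg_fst.
exact: (h _ (@closed_ge _ _)).
Qed.

Let stays y (e : R) := [set w : Om | forall t j,
  arc_dom (y w) (t, j) -> inflate A e (y w t j)].
Let stays_after y (e T : R) := [set w : Om | forall t j,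
  arc_dom (y w) (t, j) -> T <= t + j%:R -> inflate A e (y w t j)].

Let m_stays_after y0 y e T : random_solution v H y0 y -> 0 < e ->
  measurable (stays_after y e T).
Proof.
move=> sol e0.
have h := measurable_avoid (F := fun j => (snd @^-1` ~` inflate A e) `&`
  (fst @^-1` [set t | T - j%:R <= t])) sol (fun j => @closed_off e T j e0).
rewrite (_ : stays_after y e T = [set w | forall t j, arc_dom (y w) (t, j) ->
  ~ ((snd @^-1` ~` inflate A e) `&` (fst @^-1` [set t | T - j%:R <= t])) (t, y w t j)]) //.
apply/seteqP; split=> w /= Hw t j dt.
  by move=> [/= nin]; rewrite lerBlDr => /(Hw t j dt).
by move=> Tt; apply: contrapT => nin; apply: (Hw t j dt); split => //=; rewrite lerBlDr.
Qed.

Let m_stays y0 y e : random_solution v H y0 y -> 0 < e -> measurable (stays y e).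
Proof.
move=> sol e0; rewrite (_ : stays y e = stays_after y e 0).
  exact: m_stays_after sol e0.
apply/seteqP; split=> w /= Hw t j dt; first by move=> _; exact: Hw.
apply: Hw => //; rewrite addr_ge0 //.
by have [[hd _] _ _ _ _] := random_solution_arc w sol; exact (htd_ge0 hd dt).
Qed.

(** Leaving the neighbourhood forces E to reach c, which from E(y0) < a is a
    rebound, of probability at most a / c. *)
Let stays_prob y0 y a c e q : random_solution v H y0 y ->
  (flow_set H `|` jump_set H) y0 -> E y0 < a -> 0 < a -> a <= c -> 0 < e ->
  a / c <= q -> (forall x, Y x -> E x < c -> inflate A e x) ->
  ((1 - q)%:E <= P (stays y e))%E.
Proof.
move=> sol Y0 ya a0 ac e0 acq He; have c0 : 0 < c by exact: lt_le_trans ac.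
have [mU PU] := rebound_total sol Y0 a0 c0.
apply: (probability_ge_of_compl (m_stays sol e0) mU _ PU acq) => w /=.
move=> /existsNP[t /existsNP[j /not_implyP[dt nin]]].
apply: (exceed_rebound sol Y0 ya ac dt); rewrite leNgt; apply/negP => Ect.
by apply: nin; apply: He => //; have [_ Yy _] := solution_bounds sol Y0; exact: Yy.
Qed.

Let slow_total y0 y a c k T : random_solution v H y0 y ->
  (flow_set H `|` jump_set H) y0 -> 0 < c -> 0 < k -> 0 < T ->
  (forall x, flow_set H x -> a <= E x -> E x <= c -> k <= sig x) ->
  (forall x, jump_set H x -> a <= E x -> E x <= c ->
    (\int[mu]_u (jump_payoff (jump_map H) E c x u)%:E <= (E x - k)%:E)%E) ->
  measurable (\bigcup_N slow y E a c T N) /\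
  (P (\bigcup_N slow y E a c T N) <= (E y0 / (k * T))%:E)%E.
Proof.
move=> sol Y0 c0 k0 T0 kflow kjump; have ha w := random_solution_arc w sol.
have [[_ adp] _ _ _] := sol.
have ms N : measurable (slow y E a c T N) by exact: (measurable_slow hv ha adp Ec).
split; first exact: bigcupT_measurable.
apply: probability_bigcup_le => //.
  by move=> i j ij w [l li Hl]; exists l => //; exact: leq_trans li ij.
move=> N; apply: (slow_bound hv (mu := mu) ha adp Dcl Gbdd Gcl Gmeas E0 Ec) => //.
move=> w s t j; exact: (arc_flow_slope (ha w) lE sig0 Eslope kflow).
Qed.

(** For attractivity the constants are chosen in this order: c1 such that E <
    c1 implies closeness to the target, a = q' c1 so that a rebound from a to
    c1 is unlikely, c = a1 / q' so that exceeding c from a start with E(y0) <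
    a1 is unlikely, the rate k valid for a <= E <= c, and T such that a1 / (k
    T) = q'. Each of the three events has probability at most q', a third of
    the tolerance. *)
Theorem lyapunov_UGASp : UGASp P v H A.
Proof.
split.
- move=> e q e0 q0; have [c c0 Hc] := E_small e0.
  pose q' := Num.min q 1.
  have q'0 : 0 < q' by rewrite lt_min q0 ltr01.
  have q'q : q' <= q by rewrite ge_min lexx.
  have q'1 : q' <= 1 by rewrite ge_min lexx orbT.
  have a0 : 0 < q' * c by rewrite mulr_gt0.
  have [r r0 Hr] := start_small a0.
  exists r => // y0 y [sol _] [Y0 dist].
  apply: (stays_prob sol Y0 (a := q' * c) (c := c)) => //.
  + by apply: Hr => //; left.
  + by rewrite ger_pMl.
  + by rewrite mulfK // gt_eqF.
- move=> r q r0 q0; have [c1 Hc1] := start_bdd r0.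
  pose q' := Num.min q 1.
  have q'0 : 0 < q' by rewrite lt_min q0 ltr01.
  have q'q : q' <= q by rewrite ge_min lexx.
  have q'1 : q' <= 1 by rewrite ge_min lexx orbT.
  pose a := Num.max c1 0 + 1.
  have c1a : c1 < a by rewrite /a ltr_pwDr // le_max lexx.
  have a0 : 0 < a by rewrite /a ltr_wpDl // le_max lexx orbT.
  have [e e0 He] := E_large (a / q').
  exists e => // y0 y [sol _] [Y0 dist].
  apply: (stays_prob sol Y0 (a := a) (c := a / q')) => //.
  + by apply: le_lt_trans c1a; apply: Hc1 => //; left.
  + by rewrite ler_pdivlMr // ger_pMr.
  + by rewrite invf_div mulrCA divff ?mulr1 // gt_eqF.
  + by move=> x Yx /ltW; exact: He.
move=> e q r e0 q0 r0.
have [c1 c10 Hc1] := E_small e0; have [b Hb] := start_bdd r0.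
pose q' := Num.min q 1 / 3.
have q'0 : 0 < q' by rewrite divr_gt0 // lt_min q0 ltr01.
have q'q : q' + q' + q' <= q.
  have : Num.min q 1 <= q by rewrite ge_min lexx.
  by rewrite /q'; lra.
have q'1 : q' <= 1.
  have : Num.min q 1 <= 1 by rewrite ge_min lexx orbT.
  by rewrite /q'; lra.
pose a := q' * c1; pose a1 := Num.max b 0 + 1; pose c := a1 / q'.
have a0 : 0 < a by rewrite mulr_gt0.
have ba1 : b < a1 by rewrite /a1 ltr_pwDr // le_max lexx.
have a10 : 0 < a1 by rewrite /a1 ltr_wpDl // le_max lexx orbT.
have c0 : 0 < c by rewrite divr_gt0.
have a1c : a1 <= c by rewrite ler_pdivlMr // ger_pMr.
have [k1 k10 Hk1] := sig_pos c a0.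
have [k2 k20 Hk2] := jump_uniform a0 (ltW c0).
pose k := Num.min k1 k2.
have k0 : 0 < k by rewrite lt_min k10.
pose T := a1 / (k * q').
have T0 : 0 < T by rewrite divr_gt0 // mulr_gt0.
exists T; first exact: ltW.
move=> y0 y sol [Y0 dist].
have Ea1 : E y0 < a1 by apply: le_lt_trans ba1; apply: Hb => //; left.
have [mU1 PU1] := rebound_total sol Y0 a10 c0.
have [mU2 PU2] := rebound_total sol Y0 a0 c10.
have [||mU3 PU3] := @slow_total y0 y a c k T sol Y0 c0 k0 T0.
- by move=> x Cx ax xc; apply: le_trans (Hk1 x Cx ax xc); rewrite ge_min lexx.
- move=> x Dx ax xc; apply: le_trans (Hk2 x Dx ax xc) _.
  by rewrite lee_fin lerD2l lerN2 ge_min lexx orbT.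
set U1 := \bigcup_N _ in mU1 PU1; set U2 := \bigcup_N _ in mU2 PU2.
set U3 := \bigcup_N _ in mU3 PU3.
have mU : measurable (U1 `|` U2 `|` U3) by apply: measurableU => //; exact: measurableU.
apply: (probability_ge_of_compl (m_stays_after T sol e0) mU (b := q' + q' + q')) => //.
  move=> w /= /existsNP[t /existsNP[j /not_implyP[dt /not_implyP[Tt nin]]]].
  have Ect : c1 <= E (y w t j).
    rewrite leNgt; apply/negP => Ect; apply: nin; apply: Hc1 => //.
    by have [_ Yy _] := solution_bounds sol Y0; exact: Yy.
  have [hi|nhi] := pselect (exists s i, arc_dom (y w) (s, i) /\ c <= E (y w s i)).
    have [s [i [ds cs]]] := hi; left; left.
    exact: (exceed_rebound sol Y0 Ea1 a1c ds cs).
  have [lo|nlo] := pselect (exists s i, [/\ arc_dom (y w) (s, i), (i < j)%N & E (y w s i) < a]).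
    have [s [i [ds ij sa]]] := lo; left; right.
    exists j => //; exists j; first exact: leqnn.
    by exists i => //; split; [exists s|exists t].
  right; exists j => //; exists j; first exact: leqnn.
  split; first split.
  + exists t => //; split => /=; last by rewrite lerBlDr.
    by apply: le_trans Ect; rewrite /a ger_pMl.
  + by move=> [i ij [s ds sa]]; apply: nlo; exists s, i; split.
  + by move=> [i ij [s ds sa]]; apply: nhi; exists s, i; split.
apply: (le_trans (measureU2 P (measurableU _ _ mU1 mU2) mU3)).
rewrite EFinD; apply: leeD.
  apply: (le_trans (measureU2 P mU1 mU2)); rewrite EFinD; apply: leeD.
    apply: (le_trans PU1); rewrite lee_fin /c invf_div mulrCA divff ?mulr1 // gt_eqF //.
  by apply: (le_trans PU2); rewrite lee_fin /a mulfK // gt_eqF.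
apply: (le_trans PU3); rewrite lee_fin ler_pdivrMr; last exact: mulr_gt0 k0 T0.
apply: (le_trans (ltW Ea1)); rewrite le_eqVlt; apply/orP; left; apply/eqP.
by rewrite /T; field; rewrite !gt_eqF.
Qed.

End lyapunov.

(** * The singularly perturbed system *)

Theorem theorem1 (R : realType) (n1 n2 m : nat)
  (d : measure_display) (Om : measurableType d) (P : probability Om R)
  (mu : probability (borel R m) R) (v : nat -> Om -> 'rV[R]_m)
  (hv : iid P mu v)
  (S : sp_data R n1 n2 m) (M : 'rV[R]_n1 -> set 'rV[R]_n2)
  (hBC : forall eps : R, 0 < eps -> basic_conditions (perturbed S eps))
  (hBCred : basic_conditions (reduced S M))
  (A : set 'rV[R]_n1) (hA : compact A)
  (hMosc : osc M) (hMlb : loc_bounded M)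
  (hMC : forall x, sp_Cx S x -> M x !=set0 /\ M x `<=` sp_Cz S)
  (alpha : R -> R) (halpha : class_Kinf alpha)
  (hMalpha : forall x r1 r2, A r1 -> M r1 r2 ->
     (eset_dist (M x) r2 <= (alpha (enorm (x - r1)))%:E)%E)
  (W : 'rV[R]_n1 -> 'rV[R]_n2 -> R) (V : 'rV[R]_n1 -> R)
  (hW0 : forall x z, 0 <= W x z) (hV0 : forall x, 0 <= V x)
  (hWlip : loc_lipschitz (joint W)) (hWreg : regular_fun (joint W))
  (hVlip : loc_lipschitz V) (hVreg : regular_fun V)
  (alpha1 alpha2 alpha3 alpha4 : R -> R)
  (halpha1 : class_Kinf alpha1) (halpha2 : class_Kinf alpha2)
  (halpha3 : class_Kinf alpha3) (halpha4 : class_Kinf alpha4)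
  (phiz : R -> R) (phix : 'rV[R]_n1 -> R)
  (hphizc : {within `[0, +oo[, continuous phiz})
  (hphiz : class_PD `[0, +oo[ [set 0] phiz)
  (hphixc : continuous (phix : 'rV[R]_n1 -> R^o))
  (hphix : class_PD setT A phix)
  (kz kx k1 k2 k3 : R)
  (hkz : 0 < kz) (hkx : 0 < kx) (hk1 : 0 < k1) (hk2 : 0 < k2) (hk3 : 0 < k3)
  (h_i : forall x z,
     (sp_C S `|` sp_D S `|` jump_image (sp_jump S) (sp_D S) (noise_range v))
       (row_mx x z) ->
     alpha1 (set_dist (M x) z) <= W x z <= alpha2 (set_dist (M x) z))
  (h_ii : forall x z fz, sp_Cx S x -> sp_Cz S z -> sp_Fz S x z fz ->
     (clarke_max (W x) z fz <= (- kz * phiz (set_dist (M x) z) ^+ 2)%:E)%E)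
  (h_iii : forall x,
     (sp_Cx S `|` sp_Dx S `|`
      jump_image (reduced_jump S) (sp_Dx S) (noise_range v)) x ->
     alpha3 (set_dist A x) <= V x <= alpha4 (set_dist A x))
  (h_iv : forall x fx, sp_Cx S x -> reduced_flow S M x fx ->
     (clarke_max V x fx <= (- kx * phix x ^+ 2)%:E)%E)
  (h_v : forall x z fx, sp_Cx S x -> sp_Cz S z -> sp_Fx S x z fx ->
     (clarke_max (W ^~ z) x fx <=
      (k1 * phiz (set_dist (M x) z) * phix x + k2 * phiz (set_dist (M x) z) ^+ 2)%:E)%E)
  (h_vi : forall x z fx, sp_Cx S x -> sp_Cz S z -> sp_Fx S x z fx ->
     exists2 fx', reduced_flow S M x fx' &
     (clarke_max V x (fx - fx') <= (k3 * phiz (set_dist (M x) z) * phix x)%:E)%E)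
  (h_b : let theta := k3 / (k1 + k3) in
     let E := joint (fun x z => (1 - theta) * V x + theta * W x z) in
     exists2 rho : 'rV[R]_(n1 + n2) -> R, class_PD setT (joint_set A M) rho &
     forall x z, sp_Dx S x -> sp_Dz S z ->
     (\int[mu]_u ereal_sup [set (E g)%:E | g in sp_G S x z u]
      <= (E (row_mx x z) - rho (row_mx x z))%:E)%E) :
  exists2 epsstar : R, 0 < epsstar &
    forall eps : R, 0 < eps -> eps < epsstar ->
      UGASp P v (perturbed S eps) (joint_set A M).
Proof.
have [Cl [Fne Gne] _ Gbdd [Gcl Gmeas]] := hBC 1 ltr01.
have [Ccl Dcl] := Cl; rewrite /= in Ccl Dcl.
pose th := k3 / (k1 + k3); pose lam := 1 - th.
have k13 : 0 < k1 + k3 by rewrite addr_gt0.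
have th0 : 0 < th by rewrite divr_gt0.
have lamE : lam = k1 / (k1 + k3) by rewrite /lam /th; field; rewrite gt_eqF.
have lam0 : 0 < lam by rewrite lamE divr_gt0.
have balance : lam * k3 = th * k1 by rewrite lamE /th; field; rewrite gt_eqF.
have [epsstar [c0 [eps0 c00 slope]]] := composite_slope hWlip hWreg hVlip hVreg
  hphiz hphix hkz hkx hk2 hk3 h_ii h_iv h_v h_vi lam0 th0 balance.
exists epsstar => // eps epsp epslt.
(* if the target is empty then the distance to it is infinite and no initial
   state is admissible *)
have [Atne|Atempty] := pselect (joint_set A M !=set0); last first.
  have no_start r y0 : ~ (eset_dist (joint_set A M) y0 <= r%:E)%E.
    suff -> : joint_set A M = set0.
      by rewrite /eset_dist image_set0 ereal_inf0 leNgt ltry.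
    by rewrite -subset0 => y Ay; apply: Atempty; exists y.
  split.
  - by move=> e rho _ _; exists 1 => // y0 y _ [_ /no_start].
  - by move=> r rho _ _; exists 1 => // y0 y _ [_ /no_start].
  - by move=> e rho r _ _ _; exists 0 => // y0 y _ [_ /no_start].
have [p [Ap Mp]] := Atne.
have A0 : A !=set0 by exists (lsubmx p).
(* M(x) is nonempty for every x, since |r2|_M(x) is finite for a point (r1,
   r2) of the target; so the distances below are genuine ones *)
have M0 x : M x !=set0.
  have [|s Ms _] := @eset_dist_lt _ _ (M x) (rsubmx p) (alpha (enorm (x - lsubmx p)) + 1).
    by apply: le_lt_trans (hMalpha x _ _ Ap Mp) _; rewrite lte_fin ltrDl.
  by exists s.
pose H := perturbed S eps.
pose Y := flow_set H `|` jump_set H `|`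
  jump_image (jump_map H) (jump_set H) (noise_range v).
have YW y : Y y -> alpha1 (set_dist (M (lsubmx y)) (rsubmx y)) <= W (lsubmx y) (rsubmx y)
    <= alpha2 (set_dist (M (lsubmx y)) (rsubmx y)).
  by move=> Yy; apply: h_i; rewrite hsubmxK.
have YV y : Y y -> alpha3 (set_dist A (lsubmx y)) <= V (lsubmx y)
    <= alpha4 (set_dist A (lsubmx y)).
  move=> Yy; apply: h_iii; case: Yy => [[[Cx _]|[Dx _]]|[q [Dx Dz] [u Vu Gy]]].
  - by left; left.
  - by left; right.
  - right; exists (lsubmx q) => //; exists u => //.
    by exists (rsubmx y), (rsubmx q); split => //; rewrite hsubmxK.
pose E (y : 'rV[R]_(n1 + n2)) := lam * V (lsubmx y) + th * W (lsubmx y) (rsubmx y).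
have lE : locally_lip E.
  exact: (locally_lip_combination (ltW lam0) (ltW th0) (loc_lipschitzE hVlip)
    (loc_lipschitzE hWlip)).
have E0 y : 0 <= E y by rewrite addr_ge0 // mulr_ge0 // ltW.
have [rho hrho Hrho] := h_b.
pose sig (y : 'rV[R]_(n1 + n2)) := c0 * (phix (lsubmx y) ^+ 2 +
  phiz (set_dist (M (lsubmx y)) (rsubmx y)) ^+ 2).
have CY : sp_C S `<=` Y by move=> y Cy; left; left.
apply: (@lyapunov_UGASp R (n1 + n2) m d Om P mu v hv H Ccl Dcl _ Gbdd Gcl Gmeas
  (joint_set A M) E sig rho) => //.
- by move=> y; apply: mulr_ge0; [exact: ltW|apply: addr_ge0; exact: sqr_ge0].
- exact: slope.
- move=> a c a0.
  have [k k0 Hk] := @dissipation_pos _ _ _ M A hA hMosc hMlb A0 M0 W V alpha1 alpha2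
    alpha3 alpha4 halpha1 halpha2 halpha3 halpha4 Y YW YV lam th lam0 th0 (sp_C S) phiz phix
    Ccl CY (locally_lip_continuous lE) hphizc hphiz hphixc hphix a c a0.
  exists (c0 * k); first exact: mulr_gt0.
  by move=> y Cy ay yc; rewrite ler_pM2l //; exact: Hk.
- move=> y; have [h1 h2] := hrho y I.
  by have [/h1 ->//|/h2 /ltW//] := pselect (joint_set A M y).
- move=> y Dy Ey; have [_] := hrho y I; apply => Aty.
  have Yy : Y y by left; right.
  have := composite_in_eq0 halpha2 halpha4 YW YV lam0 th0 Yy Aty.
  by rewrite leNgt => /negP; apply; exact: Ey.
- by move=> y [Dx Dz]; have := Hrho _ _ Dx Dz; rewrite hsubmxK.
- move=> c; have [B B0 HB] := composite_sublevel_bounded hA hMlb A0 M0 halpha1 halpha3 YW YV lam0 th0 c.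
  by exists B => y Yy yc; have [] := HB y Yy yc.
- exact: (composite_small_inflate hA hMosc hMlb A0 M0 halpha1 halpha3 YW YV lam0 th0).
- exact: (composite_sublevel_inflate hA hMlb A0 M0 halpha1 halpha3 YW YV lam0 th0).
- exact: (composite_start_small halpha hMalpha halpha2 halpha4 YW YV lam0 th0).
- move=> r r0; eexists => y Yy dy.
  exact: (composite_dist_le halpha hMalpha halpha2 halpha4 YW YV lam0 th0 r0 Yy dy).
Qed.
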